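(* Let $K$ be a field, $Q$ a quiver, $\boldsymbol{\underline d}$ a filtration and $F$ a field extension of $K$. Assume that there is an $M\in\mathcal{A}_{\boldsymbol{\underline d}}(F)$ such that $\dim_F\mathrm{Ext}^1_{FQ}(M,M)=\operatorname{codim}\mathcal{A}_{\boldsymbol{\underline d}}$. Then $\mathrm{Fl}_Q\binom{M}{\boldsymbol{\underline d}}$ is smooth over $F$ and geometrically irreducible.
   Context: $Q$ is a finite quiver. A filtration is a sequence $\boldsymbol{\underline d}=(\underline d^0,\dots,\underline d^\nu)$ of dimension vectors with $\underline d^0=0$, $\underline d^i\le\underline d^{i+1}$. $\mathrm{Rep}_Q(\underline d)=\prod_{\alpha:i\to j}\mathrm{Hom}(d_i,d_j)$ is the affine space of representations, as a $K$-scheme. $\mathrm{Fl}(\boldsymbol{\underline d})$ is the scheme of $Q_0$-graded flags $U^0\subset\dots\subset U^\nu$ with $U^k_i$ a direct summand of $R^{d_i^\nu}$ of rank $d_i^k$ on $R$-points. $\mathcal{A}_{\boldsymbol{\underline d}}$ is the scheme-theoretic image in $\mathrm{Rep}_Q(\underline d^\nu)$ under the first projection of the closed subscheme $\mathrm{RepFl}_Q(\boldsymbol{\underline d})\subset\mathrm{Rep}_Q(\underline d^\nu)\times\mathrm{Fl}(\boldsymbol{\underline d})$ of pairs $(M,\boldsymbol U)$ such that each $U^k$ is a subrepresentation of $M$; it is a closed irreducible subvariety, with codimension taken in $\mathrm{Rep}_Q(\underline d^\nu)$. For an $F$-representation $M$ of dimension vector $\underline d^\nu$, $\mathrm{Fl}_Q\binom{M}{\boldsymbol{\underline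 d}}$ is the projective $F$-scheme whose $R$-points are the flags $\boldsymbol U\in\mathrm{Fl}(\boldsymbol{\underline d})(R)$ of subrepresentations of $M\otimes_FR$. *)

(* Defs.v *)
From HB Require Import structures.
From mathcomp Require Import all_boot all_order all_algebra.
From mathcomp Require Import mpoly.
From Stdlib Require Import FunctionalExtensionality PropExtensionality.
From Stdlib Require Import ProofIrrelevance.

Set Implicit Arguments.
Unset Strict Implicit.
Unset Printing Implicit Defensive.

Import GRing.Theory.
Local Open Scope ring_scope.

(** A scheme over [K] is given by its functor of points on commutative
    [K]-algebras.  An algebra is a ring with a structure morphism (rather than
    a [comAlgType K]) so that restriction of scalars along [K -> L] is plain
    composition.  The zero algebra, on which every scheme has exactly one
    point, is left out of the test category. *)

Record kalg (K : fieldType) := KAlg {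
  kalg_ring :> comNzRingType;
  kstr : {rmorphism K -> kalg_ring} }.

Record kalg_hom (K : fieldType) (A B : kalg K) := KAlgHom {
  kalg_fun :> {rmorphism A -> B};
  kalg_funP : forall c, kalg_fun (kstr A c) = kstr B c }.

Record kfunctor (K : fieldType) := KFunctor {
  pts :> kalg K -> Type;
  pmap : forall A B : kalg K, kalg_hom A B -> pts A -> pts B;
  pmap_id : forall (A : kalg K) (f : kalg_hom A A) (x : pts A),
    f =1 id -> pmap f x = x;
  pmap_comp : forall (A B C : kalg K) (f : kalg_hom A B) (g : kalg_hom B C)
    (h : kalg_hom A C) (x : pts A),
    h =1 g \o f -> pmap h x = pmap g (pmap f x) }.

Arguments pmap {K} _ {A B} _ _.

(* The ideal of [B] generated by [f @ I] is the unit ideal. *)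
Definition generates_unit (A B : comNzRingType) (f : A -> B) (I : A -> Prop) :=
  exists (n : nat) (a : 'I_n -> A) (b : 'I_n -> B),
    (forall j, I (a j)) /\ \sum_(j < n) b j * f (a j) = 1.

(* Open subfunctors (Demazure-Gabriel, I.1.3.6): the pull-back of [U] along
   every [x : Spec A -> X] is the open subfunctor [D(I)] of [Spec A].  Stability
   of [U] under [pmap] is a consequence. *)
Definition open_sub (K : fieldType) (X : kfunctor K)
    (U : forall A : kalg K, X A -> Prop) :=
  forall (A : kalg K) (x : X A), exists I : A -> Prop,
    forall (B : kalg K) (f : kalg_hom A B),
      U B (pmap X f x) <-> generates_unit f I.

(* The points of the space underlying [X] are classes of field-valued points,
   and its open sets correspond to the open subfunctors. *)
Definition nonempty_sub (K : fieldType) (X : kfunctor K)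
    (U : forall A : kalg K, X A -> Prop) :=
  exists (L : fieldType) (i : {rmorphism K -> L}) (x : X (KAlg i)), U _ x.

Definition irreducible (K : fieldType) (X : kfunctor K) :=
  nonempty_sub (fun (A : kalg K) (_ : X A) => True) /\
  forall U V : forall A : kalg K, X A -> Prop,
    open_sub U -> open_sub V -> nonempty_sub U -> nonempty_sub V ->
    nonempty_sub (fun A x => U A x /\ V A x).

Definition restr (K L : fieldType) (i : {rmorphism K -> L}) (A : kalg L) :
  kalg K := KAlg (kstr A \o i : {rmorphism K -> A}).

Definition restr_hom (K L : fieldType) (i : {rmorphism K -> L}) (A B : kalg L)
  (f : kalg_hom A B) : kalg_hom (restr i A) (restr i B) :=
  @KAlgHom K (restr i A) (restr i B) (kalg_fun f)
    (fun c => kalg_funP f (i c)).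

Definition base_change (K L : fieldType) (i : {rmorphism K -> L})
    (X : kfunctor K) : kfunctor L :=
  @KFunctor L (fun A => X (restr i A))
    (fun A B f => pmap X (restr_hom i f))
    (fun A f x fid => pmap_id (f := restr_hom i f) x fid)
    (fun A B C f g h x hgf =>
       pmap_comp (f := restr_hom i f) (g := restr_hom i g)
                 (h := restr_hom i h) x hgf).

Definition geometrically_irreducible (K : fieldType) (X : kfunctor K) :=
  forall (L : fieldType) (i : {rmorphism K -> L}),
    irreducible (base_change i X).

(* The third hypothesis says that the kernel of [f] is nilpotent. *)
Definition formally_smooth (K : fieldType) (X : kfunctor K) :=
  forall (A B : kalg K) (f : kalg_hom A B),
    (forall b : B, exists a : A, f a = b) ->
    (exists n : nat, forall a : 'I_n -> A,
        (forall j, f (a j) = 0) -> \prod_(j < n) a j = 0) ->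
    forall y : X B, exists x : X A, pmap X f x = y.

Section Sol.
Variables (K : fieldType) (n m : nat) (P : 'I_m -> {mpoly K[n]}).

Definition is_sol (A : kalg K) (t : 'rV[A]_n) :=
  forall j, mmap (kstr A) (fun l => t 0 l) (P j) = 0.

Lemma mmap_hom (A B : kalg K) (f : kalg_hom A B) (N : nat) (t : 'I_N -> A)
    (p : {mpoly K[N]}) :
  f (mmap (kstr A) t p) = mmap (kstr B) (fun l => f (t l)) p.
Proof.
rewrite /mmap rmorph_sum; apply: eq_bigr => k _.
rewrite rmorphM kalg_funP; congr (_ * _).
by rewrite /mmap1 rmorph_prod; apply: eq_bigr => l _; rewrite rmorphXn.
Qed.

Lemma is_sol_map (A B : kalg K) (f : kalg_hom A B) (t : 'rV[A]_n) :
  is_sol t -> @is_sol B (map_mx f t).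
Proof.
move=> tP j; rewrite -[RHS](rmorph0 f) -(tP j) mmap_hom.
by congr (mmap _ _ _); apply: functional_extensionality => l; rewrite mxE.
Qed.

(* [Spec K[T_1, .., T_n] / (P_1, .., P_m)]. *)
Definition Sol : kfunctor K.
Proof.
refine (@KFunctor K (fun A => {t : 'rV[A]_n | is_sol t})
  (fun A B f t => exist _ (map_mx f (sval t)) (is_sol_map f (svalP t))) _ _).
- move=> A f t fid; apply: eq_sig_hprop => [x|]; first exact: proof_irrelevance.
  by apply/rowP => l; rewrite !mxE fid.
- move=> A B C f g h t hgf.
  apply: eq_sig_hprop => [x|]; first exact: proof_irrelevance.
  by apply/rowP => l; rewrite !mxE hgf.
Defined.
End Sol.

(* Around each point there is an open immersion [g] of the spectrum of a finitely
   presented algebra. *)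
Definition locally_fin_pres (K : fieldType) (X : kfunctor K) :=
  forall (L : fieldType) (i : {rmorphism K -> L}) (x : X (KAlg i)),
  exists (n m : nat) (P : 'I_m -> {mpoly K[n]})
         (g : forall A : kalg K, Sol P A -> X A),
    [/\ forall (A B : kalg K) (f : kalg_hom A B) (t : Sol P A),
          g B (pmap (Sol P) f t) = pmap X f (g A t),
        forall A : kalg K, injective (g A),
        open_sub (fun A y => exists t : Sol P A, g A t = y)
      & exists t : Sol P (KAlg i), g _ t = x].

(* EGA IV 17.3.1. *)
Definition smooth (K : fieldType) (X : kfunctor K) :=
  locally_fin_pres X /\ formally_smooth X.

Record quiver := Quiver {
  vert : finType;
  arr : finType;
  src : arr -> vert;
  tgt : arr -> vert }.

Arguments src {q} _.
Arguments tgt {q} _.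

Definition dimvec (Q : quiver) := vert Q -> nat.

Record filtration (Q : quiver) := Filtration {
  flen : nat;
  fdim :> 'I_flen.+1 -> dimvec Q;
  fdim0 : forall i, fdim ord0 i = 0%N;
  fdim_le : forall (k l : 'I_flen.+1) i,
    l = k.+1 :> nat -> (fdim k i <= fdim l i)%N }.

Definition ftop (Q : quiver) (d : filtration Q) : dimvec Q := d ord_max.

(* Linear maps act on row vectors from the right. *)
Definition rep (Q : quiver) (R : Type) (d : dimvec Q) :=
  forall a : arr Q, 'M[R]_(d (src a), d (tgt a)).

Definition map_rep (Q : quiver) (R S : Type) (f : R -> S) (d : dimvec Q)
    (M : rep R d) : rep S d :=
  fun a => map_mx f (M a).

Definition submod (R : comNzRingType) (n : nat) (U : 'rV[R]_n -> Prop) :=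
  [/\ U 0, forall x y, U x -> U y -> U (x + y)
    & forall c x, U x -> U (c *: x)].

Definition direct_summand (R : comNzRingType) (n : nat) (U : 'rV[R]_n -> Prop) :=
  submod U /\ exists W : 'rV[R]_n -> Prop,
    [/\ submod W, forall x, exists u w, [/\ U u, W w & x = u + w]
      & forall x, U x -> W x -> x = 0].

(* The [S]-span of the image of [U] in [S^n]; for a direct summand [U] of [R^n]
   this is [U (x)_R S]. *)
Definition extend (R S : comNzRingType) (f : R -> S) (n : nat)
    (U : 'rV[R]_n -> Prop) : 'rV[S]_n -> Prop :=
  fun v => exists (m : nat) (c : 'rV[S]_m) (X : 'M[R]_(m, n)),
    (forall l, U (row l X)) /\ v = c *m map_mx f X.

(* Constant rank: [U (x)_R L] has dimension [r] for every field [L] over [R]. *)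
Definition has_rank (R : comNzRingType) (n : nat) (U : 'rV[R]_n -> Prop)
    (r : nat) :=
  forall (L : fieldType) (f : {rmorphism R -> L}),
    exists B : 'M[L]_(r, n), row_free B /\
      forall v, extend f U v <-> (v <= B)%MS.

Definition graded_flag (Q : quiver) (d : filtration Q) (R : comNzRingType) :=
  forall (k : 'I_(flen d).+1) (i : vert Q), 'rV[R]_(ftop d i) -> Prop.

(* The [R]-points of [Fl(d)]. *)
Definition is_flag (Q : quiver) (d : filtration Q) (R : comNzRingType)
    (U : graded_flag d R) :=
  (forall k i, direct_summand (U k i) /\ has_rank (U k i) (d k i)) /\
  (forall (k l : 'I_(flen d).+1) i x, l = k.+1 :> nat -> U k i x -> U l i x).

Definition is_subrep_flag (Q : quiver) (d : filtration Q) (R : comNzRingType)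
    (M : rep R (ftop d)) (U : graded_flag d R) :=
  forall k (a : arr Q) x, U k (src a) x -> U k (tgt a) (x *m M a).

Section FlQ.
Variables (Q : quiver) (d : filtration Q).

Definition extend_flag (R S : comNzRingType) (f : R -> S) (U : graded_flag d R) :
  graded_flag d S := fun k i => extend f (U k i).

Lemma submod_comb (R : comNzRingType) n (U : 'rV[R]_n -> Prop) m
    (c : 'rV[R]_m) (X : 'M_(m, n)) :
  submod U -> (forall l, U (row l X)) -> U (c *m X).
Proof.
case=> U0 UD UZ UX; rewrite mulmx_sum_row.
by apply: big_ind => // l _; apply: UZ.
Qed.

Lemma extend_incl (R S : comNzRingType) (f : {rmorphism R -> S}) n
    (U : 'rV[R]_n -> Prop) x : U x -> extend f U (map_mx f x).
Proof.
move=> Ux; exists 1%N, 1%:M, x; split; last by rewrite mul1mx.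
by move=> l; rewrite ord1 [row 0 x](_ : _ = x) //; apply/rowP => j; rewrite mxE.
Qed.

Lemma extend_submod (R S : comNzRingType) (f : {rmorphism R -> S}) n
    (U : 'rV[R]_n -> Prop) : submod (extend f U).
Proof.
split.
- exists 0%N, 0, 0; split; first by case.
  by rewrite mul0mx.
- move=> _ _ [m1 [c1 [X1 [UX1 ->]]]] [m2 [c2 [X2 [UX2 ->]]]].
  exists (m1 + m2)%N, (row_mx c1 c2), (col_mx X1 X2); split.
    move=> l; case: (split_ordP l) => l' ->.
      by rewrite rowKu.
    by rewrite rowKd.
  by rewrite map_col_mx mul_row_col.
- move=> b _ [m [c [X [UX ->]]]]; exists m, (b *: c), X; split=> //.
  by rewrite scalemxAl.
Qed.

Lemma extend_min (R S : comNzRingType) (f : {rmorphism R -> S}) n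
    (U : 'rV[R]_n -> Prop) (V : 'rV[S]_n -> Prop) : submod V ->
  (forall x, U x -> V (map_mx f x)) -> forall v, extend f U v -> V v.
Proof.
move=> sV UV _ [m [c [X [UX ->]]]]; apply: submod_comb => // l.
by rewrite -map_row; apply: UV.
Qed.

Lemma extend_id (R : comNzRingType) (f : {rmorphism R -> R}) n
    (U : 'rV[R]_n -> Prop) : f =1 id -> submod U -> extend f U = U.
Proof.
move=> fid sU; apply: functional_extensionality => v.
have fmx (x : 'rV[R]_n) : map_mx f x = x by apply/rowP => j; rewrite mxE fid.
apply: propositional_extensionality; split=> [|Uv].
  by apply: extend_min => // x; rewrite fmx.
by rewrite -(fmx v); apply: extend_incl.
Qed.

Lemma extend_comp (R S T : comNzRingType) (f : {rmorphism R -> S})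
    (g : {rmorphism S -> T}) (h : {rmorphism R -> T}) n (U : 'rV[R]_n -> Prop) :
  h =1 g \o f -> extend h U = extend g (extend f U).
Proof.
move=> hgf; have hmx (x : 'rV[R]_n) : map_mx h x = map_mx g (map_mx f x).
  by apply/rowP => j; rewrite !mxE hgf.
apply: functional_extensionality => v; apply: propositional_extensionality.
split; apply: extend_min; try exact: extend_submod.
  by move=> x Ux; rewrite hmx; do 2!apply: extend_incl.
move=> _ [m [c [X [UX ->]]]]; rewrite map_mxM.
apply: submod_comb; first exact: extend_submod.
by move=> l; rewrite -!map_row -hmx; apply: extend_incl.
Qed.

Lemma extend_summand (R S : comNzRingType) (f : {rmorphism R -> S}) n
    (U : 'rV[R]_n -> Prop) : direct_summand U -> direct_summand (extend f U).
Proof.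
case=> sU [W [sW UW UW0]]; split; first exact: extend_submod.
exists (extend f W).
have [p pP] : exists p : 'I_n -> ('rV[R]_n * 'rV[R]_n)%type, forall j,
    [/\ U (p j).1, W (p j).2 & row j 1%:M = (p j).1 + (p j).2].
  apply: (fin_all_exists (P := fun j p =>
    [/\ U p.1, W p.2 & row j 1%:M = p.1 + p.2])) => j.
  by have [u [w UWx]] := UW (row j 1%:M); exists (u, w).
pose E1 := \matrix_(j < n) (p j).1; pose E2 := \matrix_(j < n) (p j).2.
have E1U j : U (row j E1) by rewrite rowK; case: (pP j).
have E2W j : W (row j E2) by rewrite rowK; case: (pP j).
have E12 : 1%:M = E1 + E2.
  by apply/row_matrixP => j; rewrite linearD /= !rowK; case: (pP j).
have fE12 : 1%:M = map_mx f E1 + map_mx f E2.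
  by rewrite -map_mxD -E12 map_mx1.
have dec (x : 'rV[R]_n) : x = x *m E1 + x *m E2.
  by rewrite -mulmxDr -E12 mulmx1.
have UE2 x : U x -> x *m E2 = 0.
  move=> Ux; apply: UW0; last exact: submod_comb.
  rewrite (_ : x *m E2 = x + (-1) *: (x *m E1)); last first.
    by rewrite {2}[x]dec scaleN1r addrAC subrr add0r.
  by have [_ UD UZ] := sU; apply: UD => //; apply: UZ; apply: submod_comb.
have WE1 x : W x -> x *m E1 = 0.
  move=> Wx; apply: UW0; first exact: submod_comb.
  rewrite (_ : x *m E1 = x + (-1) *: (x *m E2)); last first.
    by rewrite {2}[x]dec scaleN1r addrK.
  by have [_ WD WZ] := sW; apply: WD => //; apply: WZ; apply: submod_comb.
have kill (V : 'rV[R]_n -> Prop) (E : 'M[R]_n) :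
    (forall x, V x -> x *m E = 0) -> forall v, extend f V v -> v *m map_mx f E = 0.
  move=> VE _ [m [c [X [VX ->]]]]; rewrite -mulmxA -map_mxM.
  rewrite (_ : X *m E = 0) ?map_mx0 ?mulmx0 //.
  by apply/row_matrixP => j; rewrite row_mul VE // row0.
split; first exact: extend_submod.
- move=> x; exists (x *m map_mx f E1), (x *m map_mx f E2); split.
  + by exists n, x, E1.
  + by exists n, x, E2.
  + by rewrite -mulmxDr -fE12 mulmx1.
- move=> x /(kill _ _ UE2) xE2 /(kill _ _ WE1) xE1.
  by rewrite -(mulmx1 x) fE12 mulmxDr xE1 xE2 addr0.
Qed.

Lemma extend_is_flag (R S : comNzRingType) (f : {rmorphism R -> S})
    (U : graded_flag d R) : is_flag U -> is_flag (extend_flag f U).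
Proof.
case=> U1 U2; split=> [k i|k l i x lk].
  have [sU rU] := U1 k i; split; first exact: extend_summand.
  move=> L g; have [B [fB BP]] := rU L (g \o f : {rmorphism R -> L}).
  by exists B; split=> // v; rewrite -BP (extend_comp (f := f) (g := g)).
apply: extend_min; first exact: extend_submod.
by move=> y /(U2 _ _ _ _ lk); apply: extend_incl.
Qed.

Lemma extend_is_subrep (R S : comNzRingType) (f : {rmorphism R -> S})
    (M : rep R (ftop d)) (N : rep S (ftop d)) (U : graded_flag d R) :
  (forall a, N a = map_mx f (M a)) ->
  is_subrep_flag M U -> is_subrep_flag N (extend_flag f U).
Proof.
move=> NM MU k a _ [m [c [X [UX ->]]]].
exists m, c, (X *m M a); split; last by rewrite NM map_mxM mulmxA.
by move=> l; rewrite row_mul; apply: MU.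
Qed.

Variables (F : fieldType) (M : rep F (ftop d)).

Definition FlQ_pt (A : kalg F) (U : graded_flag d A) :=
  is_flag U /\ is_subrep_flag (map_rep (kstr A) M) U.

Lemma FlQ_map (A B : kalg F) (f : kalg_hom A B) (U : graded_flag d A) :
  FlQ_pt U -> @FlQ_pt B (extend_flag f U).
Proof.
case=> flU subU; split; first exact: extend_is_flag.
apply: extend_is_subrep subU => a.
by apply/matrixP => i j; rewrite !mxE kalg_funP.
Qed.

(* The scheme [Fl_Q(M, d)] of flags of subrepresentations of [M]. *)
Definition FlQ : kfunctor F.
Proof.
refine (@KFunctor F (fun A => {U : graded_flag d A | FlQ_pt U})
  (fun A B f U => exist _ (extend_flag f (sval U)) (FlQ_map f (svalP U))) _ _).
- move=> A f [U [[U1 U2] U3]] fid.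
  apply: eq_sig_hprop => [x|/=]; first exact: proof_irrelevance.
  apply: functional_extensionality_dep => k.
  apply: functional_extensionality_dep => i.
  by apply: extend_id => //; case: (U1 k i) => [[]].
- move=> A B C f g h U hgf.
  apply: eq_sig_hprop => [x|/=]; first exact: proof_irrelevance.
  apply: functional_extensionality_dep => k.
  apply: functional_extensionality_dep => i.
  exact: extend_comp.
Defined.
End FlQ.

Section Ad.
Variables (K : fieldType) (Q : quiver).

(* The coordinates of [Rep_Q(d)]: one for each matrix entry of each arrow. *)
Definition coord (d : dimvec Q) :=
  {a : arr Q & ('I_(d (src a)) * 'I_(d (tgt a)))%type}.

Definition ncoord (d : dimvec Q) := #|{: coord d}|.

Definition rep_coords (R : Type) (d : dimvec Q) (M : rep R d) :
    'I_(ncoord d) -> R :=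
  fun l => let c := enum_val l in M (tag c) (tagged c).1 (tagged c).2.

(* The ideal of [A_d] in [K[Rep_Q(d^nu)]]: the scheme-theoretic image of
   [RepFl_Q(d)] is the smallest closed subscheme of [Rep_Q(d^nu)] through which
   the projection factors, so its ideal consists of the functions vanishing at
   all algebra-valued points [(N, U)] of [RepFl_Q(d)]. *)
Definition Ad_ideal (d : filtration Q) (p : {mpoly K[ncoord (ftop d)]}) :=
  forall (A : kalg K) (N : rep A (ftop d)) (U : graded_flag d A),
    is_flag U -> is_subrep_flag N U -> mmap (kstr A) (rep_coords N) p = 0.

Definition in_Ad (d : filtration Q) (F : fieldType) (iota : {rmorphism K -> F})
    (M : rep F (ftop d)) :=
  forall p, Ad_ideal p -> mmap iota (rep_coords M) p = 0.

Definition prime_ideal (R : comNzRingType) (p : R -> Prop) :=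
  [/\ p 0, forall x y, p x -> p y -> p (x + y), forall x y, p y -> p (x * y),
      ~ p 1 & forall x y, p (x * y) -> p x \/ p y].

(* Chains of primes [p_0 < p_1 < .. < p_n = I], that is, of irreducible closed
   subsets [V(I) < .. < V(p_0)] of [Spec R]. *)
Definition prime_chain (R : comNzRingType) (I : R -> Prop) (n : nat) :=
  exists p : 'I_n.+1 -> R -> Prop,
    [/\ forall k, prime_ideal (p k),
        forall (k l : 'I_n.+1), l = k.+1 :> nat ->
          (forall x, p k x -> p l x) /\ (exists x, p l x /\ ~ p k x)
      & forall x, p ord_max x <-> I x].

Definition codim_is (R : comNzRingType) (I : R -> Prop) (c : nat) :=
  prime_chain I c /\ forall n, prime_chain I n -> (n <= c)%N.
End Ad.

(** Modules over the path algebra [FQ], finite-dimensional or not, are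
    representations of [Q] by [F]-vector spaces. *)

Section Ext.
Variables (F : fieldType) (Q : quiver).

Record qmod := QMod {
  qspace :> vert Q -> lmodType F;
  qact : forall a : arr Q, {linear qspace (src a) -> qspace (tgt a)} }.

Record qhom (V W : qmod) := QHom {
  qfun :> forall i, {linear V i -> W i};
  qfunP : forall (a : arr Q) (x : V (src a)),
    qfun (tgt a) (qact V a x) = qact W a (qfun (src a) x) }.

Definition qsurj (V W : qmod) (g : qhom V W) :=
  forall i (w : W i), exists v : V i, g i v = w.

Definition qprojective (P : qmod) :=
  forall (V W : qmod) (g : qhom V W) (h : qhom P W), qsurj g ->
    exists h' : qhom P V, forall i x, g i (h' i x) = h i x.

Definition short_exact (U V W : qmod) (f : qhom U V) (g : qhom V W) :=
  [/\ forall i, injective (f i), qsurj g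
    & forall i y, g i y = 0 <-> exists x, f i x = y].

(* [Ext^1(V, W)] is the cokernel of [Hom(P, W) -> Hom(O, W)] for a short exact
   sequence [0 -> O -> P -> V -> 0] with [P] projective; it has dimension [c]
   when the classes of some [psi_1, .., psi_c] form a basis of this cokernel. *)
Definition ext1_dim (V W : qmod) (c : nat) :=
  exists (O P : qmod) (f : qhom O P) (g : qhom P V),
    [/\ qprojective P, short_exact f g
      & exists psi : 'I_c -> qhom O W, forall phi : qhom O W,
          exists! b : 'rV[F]_c, exists h : qhom P W, forall i x,
            phi i x = \sum_(j < c) b 0 j *: psi j i x + h i (f i x)].

Definition qmod_of_rep (d : dimvec Q) (M : rep F d) : qmod :=
  @QMod (fun i => 'rV[F]_(d i)) (fun a => mulmxr (M a)).
End Ext.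

(* Main.v *)
(* Write [V] for the affine space of representations of dimension vector [d^nu] and
   [N] for its dimension.  Flags being locally conjugate to the standard one, the
   ideal of [A_d] is the kernel [I] of the pull-back to the generic conjugate
   [\adj g * T * g] of the generic block triangular representation [T]; hence it is
   prime over every field, and compatible with extensions of the field.

   Let [r] be the rank of [X |-> X M - M X].  As [Ext^1(M, M)] is the cokernel of
   this map, [r >= N - c], where [c] is the codimension.  Counting polynomials of
   bounded degree that are independent modulo an ideal shows that every strict
   inclusion of primes lowers the growth of the quotient by one degree, so that
   [K[V] / I] grows at most like [m ^ (N - c)]; while the orbit of [M] is seen to grow
   at least like [m ^ r] from the curve [1 + z X].  So every function vanishing on the
   orbit of [M] belongs to [I].

   By Cramer's rule, applied to a minor of [X |-> X x - M X] of size [r] that does not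
   vanish at [x = M], this yields matrices [X(x)] of polynomials with [X(M) = 1] and
   [X(x) x = M X(x)] for all [x] in [A_d]: near [M], they conjugate [A_d] to [M].
   An infinitesimal lift of a flag is first made a flag of subrepresentations of some
   [x] congruent to [M], then conjugated by [X(x)]; this gives formal smoothness.
   For irreducibility, the generic pair [(g, T)] gives a flag of subrepresentations of
   [x = \adj g * T * g], and then one of [M] after conjugation by [X(x)]; every
   field-valued point arises by specializing [(g, T)] to a point with [x = M], so it is
   a specialization of this single point. *)

Require Import Defs.
From HB Require Import structures.
From mathcomp Require Import all_boot all_order all_algebra.
From mathcomp Require Import ring zify.
From mathcomp Require Import fraction generic_quotient ring_quotient.
From mathcomp Require Import mpoly.
From mathcomp Require boolp classical_sets.
From Stdlib Require Import FunctionalExtensionality PropExtensionality.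
From Stdlib Require Import ProofIrrelevance.

Set Implicit Arguments.
Unset Strict Implicit.
Unset Printing Implicit Defensive.

Import GRing.Theory.
Local Open Scope ring_scope.

(** * Residue fields *)

(** Flags are handled throughout as chains of commuting idempotent matrices: conjugation, base
    change and lifting become matrix identities, and over an arbitrary ring ranks and units are
    tested on fields.

    The generic conjugate is written with [\adj g] in place of an inverse so that its entries are
    polynomials. Each arrow is thereby multiplied by a determinant, and these scalars have to be
    absorbed in [T] or removed by rescaling.

    The density of the orbit is used scheme-theoretically. For [x] in the orbit, X |-> X x - M X
    factors through dimension r, so it satisfies polynomial identities over the base field. These
    functions of [x] vanish on the orbit, hence lie in the ideal of A_d, and the identities hold at
    points of A_d with values in any algebra, nilpotents included; infinitesimal lifts need this.

    X(x) is invertible only near [M]. Irreducibility therefore passes through the local ring of the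
    generic pair at a specialization: X(x) is invertible there, and the flag over it maps both to
    the generic flag and to the given one. *)

Definition is_ideal (A : comNzRingType) (I : A -> Prop) :=
  [/\ I 0, forall x y, I x -> I y -> I (x + y) & forall a x, I x -> I (a * x)].

Section MaximalIdeal.
Variables (A : comNzRingType) (J : A -> Prop).
Hypotheses (idJ : is_ideal J) (J1 : ~ J 1).
Hypothesis maxJ : forall x, ~ J x -> exists a, J (a * x - 1).

Lemma residue_field : exists (L : fieldType) (f : {rmorphism A -> L}),
  (forall x, J x -> f x = 0) /\ (forall z, exists a, f a = z).
Proof.
have [J0 JD JM] := idJ.
pose S : pred A := fun x => boolp.asbool (J x).
have SP x : reflect (J x) (x \in S) by apply: boolp.asboolP.
have Sid : @idealr_closed A S.
  split; first exact/SP; first by apply/SP.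
  by move=> a u v /SP Ju /SP Jv; apply/SP/JD => //; apply: JM.
pose I : idealr A := HB.pack S (isIdealr.Build A S Sid).
pose Q : comNzRingType := {ideal_quot I}.
pose p : {rmorphism A -> Q} := \pi_({ideal_quot I})%qT.
have psurj (z : Q) : exists a, p a = z by exists (repr z); rewrite /p /= reprK.
have p0 x : p x = 0 <-> J x.
  rewrite -(rmorph0 p); split=> [/eqP|Jx].
    by rewrite -Quotient.idealrBE subr0 => /SP.
  by apply/eqP; rewrite -Quotient.idealrBE subr0; apply/SP.
have invE (z : Q) : exists y, (z = 0 -> y = 0) /\ (z != 0 -> y * z = 1).
  case: (eqVneq z 0) => [->|z0]; first by exists 0.
  have [x xz] := psurj z.
  have /maxJ [a Ja] : ~ J x by move/p0; rewrite xz => /eqP; apply/negP.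
  exists (p a); split=> [/eqP|_]; first by rewrite (negPf z0).
  by apply/eqP; rewrite -subr_eq0 -xz -rmorphM -(rmorph1 p) -rmorphB; apply/eqP/p0.
have [inv invP] := boolp.choice invE.
pose F : fieldType := HB.pack Q (@GRing.ComNzRing_isField.Build Q inv
  (fun z z0 => (invP z).2 z0) ((invP 0).1 erefl)).
exists F, p; split=> // x Jx; exact/p0.
Qed.
End MaximalIdeal.

(** A maximal ideal above [I] comes from Zorn's lemma. Surjectivity onto the residue field is
    recorded because matrices over it have to be lifted to [A]. *)
Lemma ideal_to_field (A : comNzRingType) (I : A -> Prop) :
  is_ideal I -> ~ I 1 ->
  exists (L : fieldType) (f : {rmorphism A -> L}),
    (forall x, I x -> f x = 0) /\ (forall z, exists a, f a = z).
Proof.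
move=> idI I1.
(* The empty chain has empty union, so [P] admits empty sets; a maximal element is not empty, being
   otherwise contained in [I]. *)
pose P (X : A -> Prop) :=
  (forall x, ~ X x) \/ [/\ is_ideal X, ~ X 1 & forall x, I x -> X x].
have [|J [PJ maxJ]] := @classical_sets.Zorn_bigcup A P.
  move=> F FP totF.
  case: (boolp.EM (exists X x, F X /\ X x)) => [[X [x [FX Xx]]]|noX]; last first.
    by left=> x [X FX Xx]; apply: noX; exists X, x.
  have ideal_of Y y : F Y -> Y y ->
      [/\ is_ideal Y, ~ Y 1 & forall x, I x -> Y x].
    by move=> FY Yy; case: (FP _ FY) => // /(_ y).
  right; split.
  - split.
    + by exists X => //; have [[]] := ideal_of _ _ FX Xx.
    + move=> u v [Y FY Yu] [Z FZ Zv].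
      have [[_ YD _] _ _] := ideal_of _ _ FY Yu.
      have [[_ ZD _] _ _] := ideal_of _ _ FZ Zv.
      by case: (totF _ _ FY FZ) => YZ; [exists Z|exists Y] => //;
        [apply: ZD => //; apply: YZ | apply: YD => //; apply: YZ].
    + move=> a u [Y FY Yu]; exists Y => //.
      by have [[_ _ YM] _ _] := ideal_of _ _ FY Yu; apply: YM.
  - by case=> Y FY Y1; have [] := ideal_of _ _ FY Y1.
  - by move=> y Iy; exists X => //; have [_ _] := ideal_of _ _ FX Xx; apply.
have PI : P I by right.
case: PJ => [J0|[idJ J1 IJ]].
  case: (maxJ I) => //; split; first by move=> x /J0.
  by move=> IJ; case: idI => I0 _ _; apply: (J0 _ (IJ _ I0)).
have [JJ0 JD JM] := idJ.
have [|L [f [fJ fsurj]]] := residue_field idJ J1.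
  move=> x nJx; apply: boolp.contrapT => nox.
  pose J' y := exists a u, J u /\ y = a * x + u.
  have JJ' y : J y -> J' y by exists 0, y; rewrite mul0r add0r.
  apply: (maxJ J'); first split=> //.
    by move=> sub; apply/nJx/sub; exists 1, 0; rewrite mul1r addr0.
  right; split; last by move=> y /IJ /JJ'.
  - split; first exact: JJ'.
    + move=> _ _ [a [u [Ju ->]]] [b [v [Jv ->]]]; exists (a + b), (u + v).
      by split; [apply: JD | rewrite mulrDl addrACA].
    + move=> c _ [a [u [Ju ->]]]; exists (c * a), (c * u).
      by split; [apply: JM | rewrite mulrDr mulrA].
  - case=> a [u [Ju e]]; apply: nox; exists a.
    by rewrite e opprD addrA subrr add0r -mulN1r; apply: JM.
by exists L, f; split=> // x /IJ /fJ.
Qed.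

(** Otherwise the multiples of [a] form a proper ideal, and some residue field kills [a]. *)
Lemma unit_of_fields (A : comNzRingType) (a : A) :
  (forall (L : fieldType) (f : {rmorphism A -> L}), f a != 0) ->
  exists b, b * a = 1.
Proof.
move=> fa; apply: boolp.contrapT => na.
have [||L [f [fI _]]] := @ideal_to_field A (fun x => exists b, x = b * a).
- split; first by exists 0; rewrite mul0r.
  + by move=> _ _ [b ->] [c ->]; exists (b + c); rewrite mulrDl.
  + by move=> c _ [b ->]; exists (c * b); rewrite mulrA.
- by case=> b e; apply: na; exists b.
by have := fa L f; rewrite fI ?eqxx //; exists 1; rewrite mul1r.
Qed.

Lemma mulmx_det_unit (A : comNzRingType) n (M : 'M[A]_n) b :
  b * \det M = 1 -> M *m (b *: \adj M) = 1%:M /\ (b *: \adj M) *m M = 1%:M.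
Proof.
move=> bM; rewrite -scalemxAr -scalemxAl mul_mx_adj mul_adj_mx.
by rewrite scale_scalar_mx bM.
Qed.

(** The matrix [1%:M - G] kills [G], and it is invertible because its determinant is 1 in every
    field. *)
Lemma idempotent_eq0 (A : comNzRingType) n (G : 'M[A]_n) : G *m G = G ->
  (forall (L : fieldType) (f : {rmorphism A -> L}), map_mx f G = 0) -> G = 0.
Proof.
move=> GG fG; have [|b bG] := @unit_of_fields A (\det (1%:M - G)).
  by move=> L f; rewrite -det_map_mx map_mxB fG map_mx1 subr0 det1 oner_eq0.
have [_ inv] := mulmx_det_unit bG.
by rewrite -(mul1mx G) -inv -mulmxA mulmxBl GG mul1mx subrr mulmx0.
Qed.

(** * Direct summands and projectors *)

Definition prj (A : comNzRingType) n (E : 'M[A]_n) : 'rV[A]_n -> Prop :=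
  fun v => v *m E = v.

Lemma prj_ext (A : comNzRingType) n (U : 'rV[A]_n -> Prop) (E : 'M[A]_n) :
  (forall v, U v <-> v *m E = v) -> U = prj E.
Proof.
move=> UE; apply: functional_extensionality => v.
exact/propositional_extensionality.
Qed.

Lemma prj_sub (A : comNzRingType) n (P Q : 'M[A]_n) : P *m P = P ->
  (forall v : 'rV_n, v *m P = v -> v *m Q = v) -> P *m Q = P.
Proof.
move=> PP PQ; apply/row_matrixP => j; rewrite row_mul; apply: PQ.
by rewrite -row_mul PP.
Qed.

Lemma submod_prj (A : comNzRingType) n (E : 'M[A]_n) : submod (prj E).
Proof.
rewrite /prj; split; first by rewrite mul0mx.
  by move=> x y xE yE; rewrite mulmxDl xE yE.
by move=> c x xE; rewrite -scalemxAl xE.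
Qed.

Lemma summand_prj (A : comNzRingType) n (E : 'M[A]_n) :
  E *m E = E -> direct_summand (prj E).
Proof.
move=> EE; split; first exact: submod_prj.
exists (prj (1%:M - E)); split; first exact: submod_prj.
- move=> x; exists (x *m E), (x *m (1%:M - E)); rewrite /prj; split.
  + by rewrite -mulmxA EE.
  + by rewrite -mulmxA mulmxBr mulmx1 mulmxBl mul1mx EE subrr subr0.
  + by rewrite -mulmxDr addrCA subrr addr0 mulmx1.
- move=> x; rewrite /prj mulmxBr mulmx1 => -> /eqP.
  by rewrite subrr eq_sym => /eqP.
Qed.

(** The rows of [E] are the components in [U] of the standard basis vectors. *)
Lemma prj_of_summand (A : comNzRingType) n (U : 'rV[A]_n -> Prop) :
  direct_summand U -> exists E : 'M[A]_n, E *m E = E /\ U = prj E.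
Proof.
case=> sU [W [sW UW UW0]].
have [p pP] : exists p : 'I_n -> ('rV[A]_n * 'rV[A]_n)%type, forall j,
    [/\ U (p j).1, W (p j).2 & row j 1%:M = (p j).1 + (p j).2].
  apply: (fin_all_exists (P := fun j p =>
    [/\ U p.1, W p.2 & row j 1%:M = p.1 + p.2])) => j.
  by have [u [w UWx]] := UW (row j 1%:M); exists (u, w).
pose E := \matrix_(j < n) (p j).1; pose E2 := \matrix_(j < n) (p j).2.
have UE (x : 'rV_n) : U (x *m E).
  by apply: submod_comb => // l; rewrite rowK; case: (pP l).
have WE (x : 'rV_n) : W (x *m E2).
  by apply: submod_comb => // l; rewrite rowK; case: (pP l).
have E12 : 1%:M = E + E2.
  by apply/row_matrixP => j; rewrite linearD /= !rowK; case: (pP j).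
have UxE x : U x -> x *m E = x.
  move=> Ux; have xE2 : x *m E2 = x - x *m E.
    by apply/eqP; rewrite eq_sym subr_eq addrC -mulmxDr -E12 mulmx1.
  apply/eqP; rewrite -subr_eq0 -opprB -xE2 oppr_eq0; apply/eqP/UW0 => //.
  have [_ UD UZ] := sU; rewrite xE2 -scaleN1r; apply: UD => //.
  exact: UZ.
exists E; split; first by apply/row_matrixP => j; rewrite row_mul UxE // rowE.
apply: prj_ext => v; split; [exact: UxE | by move=> <-].
Qed.

Lemma extend_prj (A B : comNzRingType) (f : {rmorphism A -> B}) n (E : 'M[A]_n) :
  E *m E = E -> extend f (prj E) = prj (map_mx f E).
Proof.
move=> EE; apply: prj_ext => v; split=> [|vE].
  apply: (extend_min (submod_prj (map_mx f E))).
  by move=> x xE; rewrite /prj -map_mxM xE.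
exists n, v, E; split=> // l; rewrite /prj -row_mul EE //.
Qed.

Lemma prj_field (L : fieldType) n (E : 'M[L]_n) (v : 'rV[L]_n) :
  E *m E = E -> (v *m E = v) <-> (v <= E)%MS.
Proof.
move=> EE; split=> [<-|/submxP [w ->]]; first exact: submxMl.
by rewrite -mulmxA EE.
Qed.

Lemma has_rank_prj (A : comNzRingType) n (E : 'M[A]_n) r : E *m E = E ->
  has_rank (prj E) r <->
  forall (L : fieldType) (f : {rmorphism A -> L}), \rank (map_mx f E) = r.
Proof.
move=> EE; split=> rE L f.
all: have fEE : map_mx f E *m map_mx f E = map_mx f E by rewrite -map_mxM EE.
  have [B [fB BE]] := rE L f.
  rewrite (_ : \rank (map_mx f E) = \rank B); first exact/eqP.
  apply/eqmx_rank/andP; split; apply/row_subP => j.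
    apply/BE; rewrite extend_prj //; apply/prj_field => //; exact: row_sub.
  apply/prj_field => //; have := row_sub j B; move/BE.
  by rewrite extend_prj.
rewrite -(rE L f); exists (row_base (map_mx f E)); split.
  exact: row_base_free.
by move=> v; rewrite extend_prj // eq_row_base; apply: prj_field.
Qed.

(** Nested images give only [E k *m E l = E k]; the kernels need not be nested. Replacing each
    smaller projector [e k] by [E m.+1 *m e k] keeps its image and makes its kernel contain that of
    the largest one. *)
Lemma commuting_chain (A : comNzRingType) n (m : nat) (E : nat -> 'M[A]_n) :
  (forall k, (k <= m)%N -> E k *m E k = E k) ->
  (forall k, (k < m)%N -> E k *m E k.+1 = E k) ->
  exists e : nat -> 'M[A]_n,
    (forall k, (k <= m)%N -> prj (E k) = prj (e k)) /\
    forall k l, (k <= l)%N -> (l <= m)%N ->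
      e k *m e l = e k /\ e l *m e k = e k.
Proof.
elim: m => [|m IH] EE EchE.
  exists E; split=> // k l; rewrite leqn0 => kl /eqP l0; move: kl.
  by rewrite l0 leqn0 => /eqP ->; rewrite EE.
have [||e [eE ech]] := IH; first by move=> k km; apply/EE/leqW.
  by move=> k km; apply/EchE/leqW.
have ee k : (k <= m)%N -> e k *m e k = e k by move=> km; case: (ech k k).
have eEm k : (k <= m)%N -> e k *m E m.+1 = e k.
  move=> km; have e_m : e m *m E m.+1 = e m.
    have emE : e m *m E m = e m.
      apply: prj_sub; first exact: ee.
      by move=> v; rewrite -/(prj (e m) v) -eE.
    by rewrite -emE -mulmxA EchE.
  by have [<- _] := ech k m km (leqnn m); rewrite -mulmxA e_m.
exists (fun k => if (k <= m)%N then E m.+1 *m e k else E k); split.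
  move=> k km1; case: leqP => km.
    rewrite eE //; apply: prj_ext => v; rewrite /prj; split=> vE.
      have vEm : v *m E m.+1 = v by rewrite -vE -mulmxA eEm.
      by rewrite mulmxA vEm.
    by rewrite -vE -!mulmxA ee.
  by [].
have EEm := EE _ (leqnn m.+1).
move=> k l kl lm1; case: (leqP l m) => lm.
  have km := leq_trans kl lm; rewrite km.
  have [kl1 kl2] := ech k l kl lm.
  split; first by rewrite mulmxA -(mulmxA _ (e k)) eEm // -mulmxA kl1.
  by rewrite mulmxA -(mulmxA _ (e l)) eEm // -mulmxA kl2.
have -> : l = m.+1 by apply/eqP; rewrite eqn_leq lm1.
case: (leqP k m) => km; first by rewrite -mulmxA eEm // mulmxA EEm.
suff -> : k = m.+1 by [].
by apply/eqP; rewrite eqn_leq km (leq_trans kl).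
Qed.

Section FlagChain.
Variables (Q : quiver) (d : filtration Q) (A : comNzRingType).
Local Notation nu := (flen d).
Local Notation n := (ftop d).

(* A flag of direct summands, presented by commuting projectors. *)
Record chain (e : nat -> forall i, 'M[A]_(n i)) : Prop := Chain {
  chain_mul : forall k l i, (k <= l)%N -> (l <= nu)%N -> e k i *m e l i = e k i;
  chain_mul' : forall k l i, (k <= l)%N -> (l <= nu)%N -> e l i *m e k i = e k i;
  chain0 : forall i, e 0%N i = 0;
  chain1 : forall i, e nu i = 1%:M;
  chain_rank : forall (L : fieldType) (f : {rmorphism A -> L}) (k : 'I_nu.+1) i,
    \rank (map_mx f (e k i)) = d k i }.

Lemma flag_chain (U : graded_flag d A) : is_flag U ->
  exists e, chain e /\ U = fun k i => prj (e k i).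
Proof.
case=> Udir Unest.
have [E EP] : exists E : forall (k : 'I_nu.+1) i, 'M[A]_(n i), forall k i,
    E k i *m E k i = E k i /\ U k i = prj (E k i).
  pose h k i := prj_of_summand (Udir k i).1.
  exists (fun k i => sval (boolp.cid (h k i))).
  by move=> k i; case: boolp.cid.
have {EP} [EE EU] : (forall k i, E k i *m E k i = E k i) /\
    (forall k i, U k i = prj (E k i)).
  by split=> k i; case: (EP k i).
have h i : exists e : nat -> 'M[A]_(n i),
    (forall k, (k <= nu)%N -> prj (E (inord k) i) = prj (e k)) /\
    forall k l, (k <= l)%N -> (l <= nu)%N ->
      e k *m e l = e k /\ e l *m e k = e k.
  apply: commuting_chain => [k _|k knu]; first exact: EE.
  apply: prj_sub => // v; rewrite -/(prj _ _) -EU => Uv.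
  rewrite -/(prj _ _) -EU; apply: Unest Uv.
  by rewrite !inordK // ltnS // ltnW.
pose e k i := sval (boolp.cid (h i)) k.
have eE (k : 'I_nu.+1) i : prj (E k i) = prj (e k i).
  rewrite /e; case: boolp.cid => e' /= [eE _].
  by rewrite -eE ?inord_val // -ltnS.
have ech k l i : (k <= l)%N -> (l <= nu)%N ->
    e k i *m e l i = e k i /\ e l i *m e k i = e k i.
  by rewrite /e; case: boolp.cid => e' /= [_]; apply.
have ee (k : 'I_nu.+1) i : e k i *m e k i = e k i.
  by case: (ech k k i) => //; rewrite -ltnS.
have rk (L : fieldType) (f : {rmorphism A -> L}) (k : 'I_nu.+1) i :
    \rank (map_mx f (e k i)) = d k i.
  have [+ _] := has_rank_prj (d k i) (ee k i).
  by rewrite -eE -EU; apply; case: (Udir k i).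
exists e; split; first split=> //.
- by move=> k l i kl lnu; case: (ech k l i kl lnu).
- by move=> k l i kl lnu; case: (ech k l i kl lnu).
(* The values at both ends are forced by the ranks: [e 0 i] has rank 0 at every field, and so does
   the idempotent [1%:M - e nu i]. *)
- move=> i; apply: idempotent_eq0; first exact: (ee ord0).
  move=> L f; apply/eqP; rewrite -mxrank_eq0.
  by rewrite (rk L f ord0) fdim0.
- move=> i; apply/eqP; rewrite eq_sym -subr_eq0; apply/eqP.
  have enu : e nu i *m e nu i = e nu i by case: (ech nu nu i).
  apply: idempotent_eq0.
    by rewrite mulmxBr mulmx1 mulmxBl mul1mx enu subrr subr0.
  move=> L f; rewrite map_mxB map_mx1.
  have fu : map_mx f (e nu i) \in unitmx.
    by rewrite -row_full_unit /row_full (rk L f ord_max).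
  rewrite -(mulKmx fu (_ - _)) mulmxBr mulmx1 -map_mxM enu subrr mulmx0 //.
- apply: functional_extensionality_dep => k.
  apply: functional_extensionality_dep => i.
  by rewrite EU eE.
Qed.

Lemma chain_flag e : chain e ->
  is_flag ((fun k i => prj (e k i)) : graded_flag d A).
Proof.
move=> ce; split=> [k i|k l i x lk].
  have ee : e k i *m e k i = e k i by apply: chain_mul => //; rewrite -ltnS.
  split; first exact: summand_prj.
  by apply: (has_rank_prj (d k i) ee).2 => L f; apply: chain_rank.
move=> xk; rewrite /prj -xk -mulmxA (chain_mul ce) //; first by rewrite lk.
by rewrite -ltnS.
Qed.

Lemma chain_subrep (M : rep A n) e : chain e ->
  is_subrep_flag M ((fun k i => prj (e k i)) : graded_flag d A) <->
  forall (k : 'I_nu.+1) a, e k (src a) *m M a *m e k (tgt a) = e k (src a) *m M a.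
Proof.
move=> ce; split=> [subM k a|subM k a x].
  apply/row_matrixP => j; rewrite -mulmxA !row_mul mulmxA; apply: subM.
  by rewrite /prj -row_mul (chain_mul ce) // -ltnS.
by rewrite /prj => <-; rewrite -!mulmxA (mulmxA (e _ _)) subM.
Qed.
End FlagChain.

Lemma chain_map (Q : quiver) (d : filtration Q) (A B : comNzRingType)
    (f : {rmorphism A -> B}) (e : nat -> forall i, 'M[A]_(ftop d i)) :
  chain e -> chain (d := d) (fun k i => map_mx f (e k i)).
Proof.
move=> ce; split=> [k l i kl lnu|k l i kl lnu|i|i|L g k i].
- by rewrite -map_mxM (chain_mul ce).
- by rewrite -map_mxM (chain_mul' ce).
- by rewrite (chain0 ce) map_mx0.
- by rewrite (chain1 ce) map_mx1.
- by rewrite -map_mx_comp (chain_rank ce (g \o f : {rmorphism A -> L})).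
Qed.

Lemma extend_chain (Q : quiver) (d : filtration Q) (A B : comNzRingType)
    (f : {rmorphism A -> B}) (e : nat -> forall i, 'M[A]_(ftop d i)) :
  chain (d := d) e ->
  extend_flag f ((fun k i => prj (e k i)) : graded_flag d A) =
  fun k i => prj (map_mx f (e k i)).
Proof.
move=> ce; apply: functional_extensionality_dep => k.
apply: functional_extensionality_dep => i.
by apply: extend_prj; apply: (chain_mul ce) => //; rewrite -ltnS.
Qed.

(** * Adapted bases *)

Section DiagChain.
Variables (L : fieldType) (n : nat) (e : nat -> 'M[L]_n) (r : nat -> nat).

Lemma rank_idem_diff (E1 E2 : 'M[L]_n) :
  E1 *m E1 = E1 -> E2 *m E2 = E2 -> E1 *m E2 = E1 -> E2 *m E1 = E1 ->
  \rank E2 = (\rank E1 + \rank (E2 - E1)%R)%N.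
Proof.
move=> E11 E22 E12 E21; rewrite -mxrank_disjoint_sum.
  apply/eqmx_rank/andP; split.
    have -> : E2 = E1 + (E2 - E1) by rewrite addrC subrK.
    by rewrite {2}addrC subrK addmx_sub_adds.
  rewrite addsmx_sub; apply/andP; split; apply/submxP.
    by exists E1.
  by exists (E2 - E1); rewrite mulmxBl E22 E12.
apply/eqP; rewrite -submx0; apply/rV_subP => v; rewrite sub_capmx submx0.
case/andP=> /submxP [w1 vE1] /submxP [w2 vE2].
have vv : v *m E1 = v by rewrite vE1 -mulmxA E11.
by rewrite -vv vE2 -mulmxA mulmxBl E11 E21 subrr mulmx0.
Qed.

(** A basis of the image of [e m] is completed by one of the image of the idempotent [e m.+1 - e m],
    whose rows are killed by all the earlier [e k]. *)
Lemma adapted_rows m : (forall k l, (k <= l)%N -> (l <= m)%N ->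
      e k *m e l = e k /\ e l *m e k = e k) ->
  e 0%N = 0 -> r 0%N = 0%N -> (forall k, (k <= m)%N -> \rank (e k) = r k) ->
  exists y : nat -> 'rV[L]_n,
    (forall k l, (k <= m)%N -> (l < r m)%N ->
       y l *m e k = if (l < r k)%N then y l else 0) /\
    (e m <= \matrix_(l < r m) y l)%MS.
Proof.
move=> + e0 r0; elim: m => [|m IH] ech rk.
  exists (fun _ => 0); split; first by move=> k l _; rewrite r0.
  by rewrite e0 sub0mx.
have [||y [yE em]] := IH.
- by move=> k l kl /leqW; apply: ech.
- by move=> k /leqW; apply: rk.
have ee k : (k <= m.+1)%N -> e k *m e k = e k by move=> km; case: (ech k k).
have [em1 em2] := ech m m.+1 (leqnSn m) (leqnn _).
pose phi := e m.+1 - e m.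
have r_phi : r m.+1 = (r m + \rank phi)%N.
  by rewrite -!rk // (rank_idem_diff _ _ em1 em2) ?ee.
pose B := row_base phi.
(* The new rows are numbered from [r m] on; the default 0 is met only beyond [r m.+1]. *)
pose y' l := if (l < r m)%N then y l else
  if insub (l - r m)%N is Some j then row j B else 0.
have Bphi : (B <= phi)%MS by rewrite eq_row_base.
have phiphi : phi *m phi = phi.
  rewrite /phi mulmxBr mulmxBl ee // em1 mulmxBl em2 ee ?subrr ?subr0 //.
have y'phi l : (r m <= l)%N -> exists w, y' l = w *m phi.
  move=> ml; rewrite /y' ltnNge ml /=; case: insubP => [j _ _|_]; last first.
    by exists 0; rewrite mul0mx.
  by apply/submxP; apply: submx_trans Bphi; apply: row_sub.
exists y'; split.
  move=> k l km1 lm1; case: (ltnP l (r m)) => lrm.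
    have -> : y' l = y l by rewrite /y' lrm.
    case: (leqP k m) => km; first exact: yE.
    have -> : k = m.+1 by apply/eqP; rewrite eqn_leq km1.
    have ym : y l *m e m = y l by rewrite yE // lrm.
    by rewrite lm1 -ym -mulmxA em1.
  have [w ->] := y'phi l lrm; rewrite -mulmxA.
  case: (leqP k m) => km.
    have -> : (l < r k)%N = false.
      apply/negbTE; rewrite -leqNgt (leq_trans _ lrm) //.
      rewrite -!rk ?leqnSn //.
      have [<- _] := ech k m km (leqnSn m); exact: mxrankM_maxr.
    have [k1 k2] := ech k m km (leqnSn m).
    have [k3 k4] := ech k m.+1 km1 (leqnn _).
    by rewrite mulmxBl k4 k2 subrr mulmx0.
  have -> : k = m.+1 by apply/eqP; rewrite eqn_leq km1.
  by rewrite lm1 mulmxBl em1 ee.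
have -> : e m.+1 = e m + phi by rewrite addrC subrK.
have sub_row l (lm : (l < r m.+1)%N) :
    (y' l <= \matrix_(l < r m.+1) y' l)%MS.
  by have := row_sub (Ordinal lm) (\matrix_(l < r m.+1) y' l); rewrite rowK.
apply: addmx_sub.
  apply: submx_trans em _; apply/row_subP => l; rewrite rowK.
  have -> : y l = y' l by rewrite /y' ltn_ord.
  by apply: sub_row; rewrite r_phi ltn_addr.
rewrite -eq_row_base; apply/row_subP => j.
have -> : row j (row_base phi) = y' (r m + j)%N.
  by rewrite /y' ltnNge leq_addr /= addKn valK.
by apply: sub_row; rewrite r_phi ltn_add2l.
Qed.

Lemma adapted_basis m : (forall k l, (k <= l)%N -> (l <= m)%N ->
      e k *m e l = e k /\ e l *m e k = e k) ->
  e 0%N = 0 -> e m = 1%:M -> (forall k, (k <= m)%N -> \rank (e k) = r k) ->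
  exists2 y : 'M[L]_n, y \in unitmx &
    forall k, (k <= m)%N -> y *m e k = pid_mx (r k) *m y.
Proof.
move=> ech e0 e1 rk.
have r0 : r 0%N = 0%N by rewrite -rk // e0 mxrank0.
have rm : r m = n by rewrite -rk // e1 mxrank1.
have [y [yE emy]] := adapted_rows ech e0 r0 rk.
rewrite rm in yE emy; exists (\matrix_(l < n) y l).
  by rewrite -row_full_unit -sub1mx -e1.
move=> k km; apply/row_matrixP => l; rewrite !row_mul rowK yE //.
have -> : row l (pid_mx (r k)) = (if (l < r k)%N then delta_mx 0 l else 0) :> 'rV[L]_n.
  apply/rowP => j; rewrite !mxE; case: ltnP => _; rewrite !mxE ?andbF //.
  by rewrite andbT eqxx eq_sym.
by case: ltnP => _; rewrite ?mul0mx // -rowE rowK.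
Qed.
End DiagChain.

Section Intertwine.
Variables (A : comNzRingType) (n m : nat) (P e : nat -> 'M[A]_n) (G : 'M[A]_n).
Hypothesis Pch : forall k l, (k <= l)%N -> (l <= m)%N ->
  P k *m P l = P k /\ P l *m P k = P k.
Hypothesis ech : forall k l, (k <= l)%N -> (l <= m)%N ->
  e k *m e l = e k /\ e l *m e k = e k.

(** Keeps of [G] only the blocks between corresponding graded pieces of the two chains. Any [G] is
    thus turned into a map of chains, and one that is already such a map is unchanged if [e] runs
    from 0 to 1. *)
Definition intertwiner := \sum_(k < m) (P k.+1 - P k) *m G *m (e k.+1 - e k).

Lemma intertwinerP l : (l <= m)%N ->
  intertwiner *m e l = P l *m intertwiner.
Proof.
move=> lm; rewrite mulmx_suml mulmx_sumr; apply: eq_bigr => k _.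
rewrite -!mulmxA (mulmxA (P l)) (mulmxBl _ _ (e l)) (mulmxBr (P l)).
case: (leqP l k) => lk.
  have lk1 := leqW lk; have km : (k <= m)%N by apply: ltnW.
  have [_ ->] := ech lk1 (ltn_ord k); have [_ ->] := ech lk km.
  have [-> _] := Pch lk1 (ltn_ord k); have [-> _] := Pch lk km.
  by rewrite !subrr !mulmx0 mul0mx.
have [-> _] := ech lk lm; have [-> _] := ech (ltnW lk) lm.
by have [_ ->] := Pch lk lm; have [_ ->] := Pch (ltnW lk) lm.
Qed.

Lemma intertwiner_id : e 0%N = 0 -> e m = 1%:M ->
  (forall l, (l <= m)%N -> G *m e l = P l *m G) -> intertwiner = G.
Proof.
move=> e0 e1 Ge; rewrite /intertwiner.
transitivity (\sum_(k < m) G *m (e k.+1 - e k)); last first.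
  rewrite -mulmx_sumr -(big_mkord xpredT (fun k => e k.+1 - e k)).
  by rewrite telescope_sumr // e0 e1 subr0 mulmx1.
apply: eq_bigr => k _; have km : (k <= m)%N by apply: ltnW.
have -> : (P k.+1 - P k) *m G = G *m (e k.+1 - e k).
  by rewrite mulmxBl mulmxBr !Ge.
have [k1 k2] := ech (leqnSn k) (ltn_ord k).
have [k3 _] := ech (leqnn k) km; have [k4 _] := ech (leqnn k.+1) (ltn_ord k).
by rewrite -mulmxA mulmxBr !mulmxBl k1 k2 k3 k4 subrr subr0.
Qed.
End Intertwine.

(** * The standard flag, and local conjugacy of all flags to it *)

Section BlockForm.
Variables (Q : quiver) (d : filtration Q).
Local Notation nu := (flen d).
Local Notation n := (ftop d).

Definition flagproj (R : comNzRingType) (k : nat) i : 'M[R]_(n i) :=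
  pid_mx (d (inord k) i).

Lemma fdim_mono k l i : (k <= l)%N -> (l <= nu)%N ->
  (d (inord k) i <= d (inord l) i)%N.
Proof.
move=> /subnKC <-; elim: (l - k)%N => [|m IH]; first by rewrite addn0.
rewrite addnS => km; apply: leq_trans (IH (ltnW km)) _; apply: fdim_le.
by rewrite !inordK // ?ltnS // ltnW.
Qed.

Lemma flagproj_mul (R : comNzRingType) k l i : (k <= l)%N -> (l <= nu)%N ->
  flagproj R k i *m flagproj R l i = flagproj R k i /\
  flagproj R l i *m flagproj R k i = flagproj R k i.
Proof.
move=> kl lnu; have dkl := fdim_mono i kl lnu.
have dl : (d (inord l) i <= n i)%N.
  have -> : n i = d (inord nu) i by rewrite /ftop; congr (d _ i);
    apply/val_inj; rewrite /= inordK.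
  exact: fdim_mono.
rewrite /flagproj !mul_pid_mx (minn_idPl dkl) (minn_idPr dkl).
by rewrite (minn_idPr (leq_trans dkl dl)).
Qed.

Lemma flagproj0 (R : comNzRingType) i : flagproj R 0 i = 0.
Proof.
rewrite /flagproj (_ : inord 0 = ord0) ?fdim0 ?pid_mx_0 //.
by apply/val_inj; rewrite /= inordK.
Qed.

Lemma flagproj1 (R : comNzRingType) i : flagproj R nu i = 1%:M.
Proof.
rewrite /flagproj (_ : inord nu = ord_max) ?pid_mx_1 //.
by apply/val_inj; rewrite /= inordK.
Qed.

Lemma flagproj_map (R S : comNzRingType) (f : {rmorphism R -> S}) k i :
  map_mx f (flagproj R k i) = flagproj S k i.
Proof. exact: map_pid_mx. Qed.

(* The representations for which the standard flag is a flag of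
   subrepresentations. *)
Definition tri (R : comNzRingType) (T : rep R n) :=
  forall (k : nat) a, (k <= nu)%N ->
    flagproj R k (src a) *m T a *m flagproj R k (tgt a) =
    flagproj R k (src a) *m T a.

(* Up to the invertible factors [\det (g (src a))], the conjugate of [T] by
   [g]. *)
Definition par (R : comNzRingType) (g : forall i, 'M[R]_(n i)) (T : rep R n) :
    rep R n :=
  fun a => \adj (g (src a)) *m T a *m g (tgt a).

(** A basis adapted to the chain over the residue field is lifted entrywise and made compatible with
    both chains by [intertwiner]. This does not alter its reduction, so the determinant stays
    nonzero there. *)
Lemma chain_block (A : comNzRingType) (e : nat -> forall i, 'M[A]_(n i))
    (L : fieldType) (f : {rmorphism A -> L}) : chain (d := d) e ->
  (forall z, exists a, f a = z) ->
  exists g : forall i, 'M[A]_(n i), (forall i, f (\det (g i)) != 0) /\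
    forall k i, (k <= nu)%N -> g i *m e k i = flagproj A k i *m g i.
Proof.
move=> ce fsurj.
have h i : exists g : 'M[A]_(n i), f (\det g) != 0 /\
    forall k, (k <= nu)%N -> g *m e k i = flagproj A k i *m g; last first.
  exists (fun i => sval (boolp.cid (h i))).
  by split=> [i|k i]; case: boolp.cid => g /= [] // _; apply.
have ech k l : (k <= l)%N -> (l <= nu)%N ->
    e k i *m e l i = e k i /\ e l i *m e k i = e k i.
  by move=> kl lnu; rewrite (chain_mul ce) // (chain_mul' ce).
have fech k l : (k <= l)%N -> (l <= nu)%N ->
    map_mx f (e k i) *m map_mx f (e l i) = map_mx f (e k i) /\
    map_mx f (e l i) *m map_mx f (e k i) = map_mx f (e k i).
  by move=> kl lnu; rewrite -!map_mxM; case: (ech k l kl lnu) => -> ->.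
have [||k knu|y yu yE] := adapted_basis (r := fun k => d (inord k) i) fech.
- by rewrite (chain0 ce) map_mx0.
- by rewrite (chain1 ce) map_mx1.
- by rewrite -[k in LHS](@inordK nu k) ?ltnS // (chain_rank ce).
have [F FP] := boolp.choice fsurj.
pose G := map_mx F y.
have fG : map_mx f G = y by apply/matrixP => a b; rewrite !mxE FP.
pose g := intertwiner nu (fun k => flagproj A k i) (fun k => e k i) G.
have fg : map_mx f g = y.
  rewrite /g /intertwiner raddf_sum /=.
  under eq_bigr => k _ do rewrite !map_mxM !map_mxB !flagproj_map fG.
  rewrite -/(intertwiner nu (fun k => flagproj L k i)
    (fun k => map_mx f (e k i)) y).
  apply: intertwiner_id => //.
  - by rewrite (chain0 ce) map_mx0.
  - by rewrite (chain1 ce) map_mx1.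
exists g; split; first by rewrite -det_map_mx fg -unitfE -unitmxE.
move=> k knu; apply: intertwinerP => // u v uv vnu.
exact: flagproj_mul.
Qed.
End BlockForm.

(** * Growth of quotients of polynomial rings *)

Section BoundedMonomials.
Variables (N n : nat).
Local Notation s := #|{: 'X_{1..N < n}}|.

Definition bmon (j : 'I_s) : 'X_{1..N} := (enum_val j : 'X_{1..N < n}).

Definition mpoly_of (A : comNzRingType) (v : 'rV[A]_s) : {mpoly A[N]} :=
  \sum_j v 0 j *: 'X_[bmon j].

Lemma mpoly_ofE (A : comNzRingType) (p : {mpoly A[N]}) : (msize p <= n)%N ->
  p = mpoly_of (\row_j p@_(bmon j)).
Proof.
move=> pn; rewrite {1}(mpolywE pn) /mpoly_of.
rewrite (reindex (enum_val : 'I_s -> 'X_{1..N < n})) /=; last first.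
  by apply: onW_bij; exact: enum_val_bij.
by apply: eq_bigr => j _; rewrite mxE.
Qed.

(** Every exponent is less than [n]. The crude bound is enough because only the power of [n]
    matters. *)
Lemma card_bmultinom : (0 < n)%N -> (s <= n ^ N)%N.
Proof.
move=> n0; rewrite -[n in (n ^ _)%N]card_ord -[N in (_ ^ N)%N]card_ord -card_ffun.
have mi (m : 'X_{1..N < n}) i : (m i < n)%N.
  by apply: leq_ltn_trans (bmdeg m); rewrite mdegE (bigD1 i) //= leq_addr.
apply: (@leq_card _ _ (fun m : 'X_{1..N < n} => [ffun i => Ordinal (mi m i)])).
move=> m1 m2 /ffunP e; apply/val_inj/mnmP => i.
by have := e i; rewrite !ffunE => -[].
Qed.
End BoundedMonomials.

Section PolynomialPoint.
Variables (F : fieldType) (N m : nat) (y : 'I_N -> {mpoly F[m]}) (n : nat).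
Local Notation s := #|{: 'X_{1..N < n}}|.

(** Bounds the degrees of all the substituted monomials, so that [subst_mx] loses no coefficient. *)
Let D := \max_(j < s) msize (mmap1 y (bmon j)).
Local Notation s' := #|{: 'X_{1..m < D}}|.

(* The matrix of [q |-> q(y)] on the polynomials of degree less than [n]. *)
Definition subst_mx : 'M[F]_(s, s') :=
  \matrix_(i, j) (mmap1 y (bmon i))@_(bmon j).

(** The matrix is defined over [F]: relations over every [F]-algebra are the kernel of one and the
    same matrix. *)
Lemma subst_mxP (A : comNzRingType) (h : {rmorphism F -> A})
    (yA : 'I_N -> {mpoly A[m]}) (v : 'rV[A]_s) :
  (forall l, yA l = map_mpoly h (y l)) ->
  mmap (@mpolyC m A) yA (mpoly_of v) = 0 <-> v *m map_mx h subst_mx = 0.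
Proof.
move=> yAE.
have yAm b : mmap1 yA b = map_mpoly h (mmap1 y b).
  by rewrite /mmap1 rmorph_prod; apply: eq_bigr => l _; rewrite rmorphXn yAE.
have -> : mmap (@mpolyC m A) yA (mpoly_of v) =
    \sum_j v 0 j *: map_mpoly h (mmap1 y (bmon j)).
  rewrite /mpoly_of raddf_sum; apply: eq_bigr => j _ /=.
  by rewrite mmapZ mmapX yAm mul_mpolyC.
split=> [/mpolyP e|/rowP e].
  apply/rowP => k; rewrite !mxE -[RHS](mcoeff0 A (bmon k)) -(e (bmon k)).
  rewrite [RHS]raddf_sum; apply: eq_bigr => j _ /=.
  by rewrite mcoeffZ mcoeff_map_mpoly !mxE.
apply/mpolyP => mu; rewrite mcoeff0 raddf_sum /=.
case: (ltnP (mdeg mu) D) => muD.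
  have := e (enum_rank (BMultinom muD)); rewrite !mxE => e0.
  rewrite -[RHS]e0; apply: eq_bigr => j _.
  by rewrite mcoeffZ mcoeff_map_mpoly !mxE /bmon enum_rankK.
apply: big1 => j _; rewrite mcoeffZ mcoeff_map_mpoly.
suff -> : (mmap1 y (bmon j))@_mu = 0 by rewrite raddf0 mulr0.
apply: memN_msupp_eq0; apply: msize_mdeg_ge.
by apply: leq_trans muD; rewrite /D (bigD1 j) //= leq_maxl.
Qed.
End PolynomialPoint.

Lemma map_mpoly_idfun (A : comNzRingType) m (p : {mpoly A[m]}) :
  map_mpoly idfun p = p.
Proof. by apply/mpolyP => mu; rewrite mcoeff_map_mpoly. Qed.

(* Relations among the [y l] over an [F]-algebra [A] are combinations of
   relations over [F]: [1 - B B^+] projects onto the kernel of [B]. *)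
Lemma kernel_base_change (F : fieldType) (N m : nat) (y : 'I_N -> {mpoly F[m]})
    (A : comNzRingType) (h : {rmorphism F -> A}) (x : 'I_N -> A) :
  (forall q, mmap (@mpolyC m F) y q = 0 -> mmap h x q = 0) ->
  forall q : {mpoly A[N]},
    mmap (@mpolyC m A) (fun l => map_mpoly h (y l)) q = 0 ->
    mmap idfun x q = 0.
Proof.
move=> yx q; rewrite (mpoly_ofE (leqnn (msize q))).
set n := msize q; set v := \row_j _ => qy.
have {qy} vB := (subst_mxP v (fun l => erefl (map_mpoly h (y l)))).1 qy.
set B := subst_mx y n in vB.
pose C := 1%:M - B *m pinvmx B.
have CB : C *m B = 0 by rewrite mulmxBl mul1mx mulmxKpV ?submx_refl ?subrr.
have -> : v = v *m map_mx h C.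
  by rewrite map_mxB map_mx1 mulmxBr mulmx1 map_mxM mulmxA vB mul0mx subr0.
have Cx i : \sum_j h (C i j) * mmap1 x (bmon j) = 0.
  have := yx (mpoly_of (row i C)).
  have -> : mmap h x (mpoly_of (row i C)) = \sum_j h (C i j) * mmap1 x (bmon j).
    rewrite /mpoly_of raddf_sum; apply: eq_bigr => j _ /=.
    by rewrite mmapZ mmapX mxE.
  have idE l : y l = map_mpoly (idfun : {rmorphism F -> F}) (y l).
    by rewrite map_mpoly_idfun.
  apply; apply: (subst_mxP _ idE).2.
  have -> : map_mx (idfun : {rmorphism F -> F}) (subst_mx y n) = B.
    exact: map_mx_id.
  by rewrite -row_mul CB row0.
rewrite /mpoly_of raddf_sum /=.
transitivity (\sum_j \sum_i v 0 i * (h (C i j) * mmap1 x (bmon j))).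
  apply: eq_bigr => j _; rewrite mmapZ mmapX [(v *m _) _ _]mxE mulr_suml.
  by apply: eq_bigr => i _; rewrite [map_mx _ _ _ _]mxE mulrA.
rewrite exchange_big /=; apply: big1 => i _.
by rewrite -mulr_sumr Cx mulr0.
Qed.

Section Growth.
Variables (K : fieldType) (N : nat).
Implicit Types (I P : {mpoly K[N]} -> Prop).

(** For an ideal [I] this bounds its Hilbert function from below by [h], in degrees less than [n],
    since [msize] is the degree plus one. *)
Definition indep_mod I n h := exists u : 'I_h -> {mpoly K[N]},
  (forall j, (msize (u j) <= n)%N) /\
  forall c : 'I_h -> K, I (\sum_j c j *: u j) -> forall j, c j = 0.

Lemma indep_mod_sub I P n h : (forall q, P q -> I q) ->
  indep_mod I n h -> indep_mod P n h.
Proof. by move=> PI [u [un uI]]; exists u; split=> // c /PI /uI. Qed.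

Lemma indep_mod_mono I n n' h : (n <= n')%N ->
  indep_mod I n h -> indep_mod I n' h.
Proof.
by move=> nn' [u [un uI]]; exists u; split=> // j; apply: leq_trans (un j) nn'.
Qed.

Lemma indep_mod_le I n h h' : (h' <= h)%N ->
  indep_mod I n h -> indep_mod I n h'.
Proof.
move=> /subnKC <-; move: (h - h')%N => k [u [un uI]].
exists (fun j => u (lshift k j)); split=> // c Ic j.
pose c' (l : 'I_(h' + k)) := if split l is inl j then c j else 0.
have cE l : c' (lshift k l) = c l.
  by rewrite /c' (unsplitK (inl l) : split (lshift _ l) = _).
rewrite -cE; apply: uI; rewrite big_split_ord /= [X in _ + X]big1 => [|l _].
  by rewrite addr0; under eq_bigr => l _ do rewrite cE.
by rewrite /c' (unsplitK (inr l) : split (rshift _ l) = _) scale0r.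
Qed.

Lemma indep_mod_bound I n h : I 0 -> (0 < n)%N -> indep_mod I n h ->
  (h <= n ^ N)%N.
Proof.
move=> I0 n0 [u [un uI]]; apply: leq_trans (card_bmultinom N n0).
pose W := \matrix_(j < h, b < #|{: 'X_{1..N < n}}|) (u j)@_(bmon b).
have /eqP <- : row_free W; last exact: rank_leq_col.
apply: inj_row_free => v vW; apply/rowP => j; rewrite mxE; apply: (uI (v 0)).
rewrite (_ : \sum_j _ = 0) //.
transitivity (mpoly_of (v *m W)).
  rewrite /mpoly_of.
  under [RHS]eq_bigr => b _ do rewrite mxE scaler_suml.
  rewrite exchange_big; apply: eq_bigr => k _ /=.
  rewrite {1}(mpoly_ofE (un k)) scaler_sumr; apply: eq_bigr => b _.
  by rewrite !mxE scalerA.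
by rewrite vW /mpoly_of big1 // => b _; rewrite mxE scale0r.
Qed.

(* Multiplication by an element of [I] outside of the prime [P] embeds
   [K[x]/P] in the kernel of [K[x]/P -> K[x]/I]. *)
Lemma indep_mod_add I P u n a b : prime_ideal P -> is_ideal I ->
  (forall q, P q -> I q) -> I u -> ~ P u ->
  indep_mod I n a -> indep_mod P n b -> indep_mod P (n + msize u) (a + b).
Proof.
move=> [P0 PD PM P1 Pp] [I0 ID IM] PI Iu Pu [v [vn vI]] [w [wn wP]].
exists (fun j => match split j with inl j => v j | inr j => u * w j end).
split=> [j|c].
  case: splitP => k _; first exact: leq_trans (vn k) (leq_addr _ _).
  case: (eqVneq (w k) 0) => [->|wk0]; first by rewrite mulr0 mmeasure0.
  case: (eqVneq u 0) => [->|u0]; first by rewrite mul0r mmeasure0.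
  by rewrite msizeM // (leq_trans (leq_pred _)) // addnC leq_add2r.
rewrite big_split_ord /=.
under eq_bigr => j _ do rewrite (unsplitK (inl j) : split (lshift _ j) = _).
under [X in _ + X]eq_bigr => j _ do
  rewrite (unsplitK (inr j) : split (rshift _ j) = _) scalerAr.
rewrite -mulr_sumr; set S1 := \sum_i _; set S2 := \sum_i _ => PS.
(* Modulo [I] the second sum disappears, as it is a multiple of [u]; afterwards [u] can be cancelled
   modulo the prime [P]. *)
have c1 : forall j, c (lshift b j) = 0.
  apply: (vI (fun j => c (lshift b j))); 
  suff : I (S1 + u * S2 + (- S2) * u) by rewrite mulNr (mulrC S2) addrK.
  by apply: ID; [apply: PI | apply: IM].
have c2 : forall j, c (rshift a j) = 0.
  have S10 : S1 = 0 by rewrite /S1 big1 // => j _; rewrite c1 scale0r.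
  move: PS; rewrite S10 add0r => /Pp [] //.
  exact: (wP (fun j => c (rshift a j))).
by move=> j; case: (split_ordP j) => k ->.
Qed.

(** The form in which the quotient by [I] having dimension at least [t] is used; the factor [C]
    leaves room for linear changes of the degree. *)
Definition growth I t :=
  exists C, forall n, (0 < n)%N -> indep_mod I (C * n) (n ^ t).

Lemma growth_sub I P t : (forall q, P q -> I q) -> growth I t -> growth P t.
Proof.
by move=> PI [C IC]; exists C => n /IC; apply: indep_mod_sub.
Qed.

(** Iterating [indep_mod_add] with the same [u] stacks [n] families of [n ^ t] polynomials. Each new
    family costs [msize u] in degree, so the degree remains linear in [n]. *)
Lemma growth_step I P u t : prime_ideal P -> is_ideal I ->
  (forall q, P q -> I q) -> I u -> ~ P u -> growth I t -> growth P t.+1.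
Proof.
move=> pP idI PI Iu Pu [C IC]; exists (C + msize u)%N => n n0.
have step k : indep_mod P (C * n + k * msize u) (k.+1 * n ^ t).
  elim: k => [|k IH].
    by rewrite mul0n addn0 mul1n; apply: indep_mod_sub (IC n n0).
  have Ik : indep_mod I (C * n + k * msize u) (n ^ t).
    by apply: indep_mod_mono (IC n n0); apply: leq_addr.
  have := indep_mod_add pP idI PI Iu Pu Ik IH.
  by rewrite -addnA -mulSnr -mulSn.
move: (step n.-1); rewrite prednK // expnS; apply: indep_mod_mono.
by rewrite mulnDl leq_add2l mulnC leq_mul2l leq_pred orbT.
Qed.

Lemma prime_ideal_is_ideal P : prime_ideal P -> is_ideal P.
Proof. by case. Qed.

(** Each of the [c] strict inclusions raises the exponent by one, while the whole polynomial ring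
    only allows the exponent [N]. *)
Lemma growth_chain I c t : prime_chain I c -> growth I t -> (t + c <= N)%N.
Proof.
move=> [p [pp pch pI]] gI.
have gp j : (j <= c)%N -> growth (p (inord (c - j))) (t + j).
  elim: j => [|j IH] jc.
    rewrite subn0 addn0; apply: growth_sub gI => q.
    rewrite (_ : inord c = ord_max) ?pI //.
    by apply/val_inj; rewrite /= inordK.
  have [|sub [u [Iu Pu]]] := pch (inord (c - j.+1)) (inord (c - j)).
    by rewrite !inordK ?ltnS ?leq_subr // subnSK.
  rewrite addnS; apply: growth_step Iu Pu _ => //; last exact/IH/ltnW.
  exact: prime_ideal_is_ideal.
have [C PC] := gp c (leqnn c).
rewrite leqNgt; apply/negP => Nt.
(* Large enough for [n ^ N.+1] to exceed [(C * n) ^ N]. *)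
pose n := (C ^ N).+1.
have C0 : (0 < C * n)%N.
  (* With [C = 0] only the zero polynomial would be available, and it is not independent modulo an
     ideal. *)
  rewrite muln_gt0 andbT lt0n; apply/eqP => C0.
  have [u [un uI]] := PC 1%N isT.
  have u0 j : u j = 0.
    by apply/eqP; rewrite -(mmeasure_poly_eq0 mdeg) -leqn0 -[0%N]C0 -(muln1 C).
  rewrite exp1n in u un uI u0.
  have [P0 _ _ _ _] := pp (inord (c - c)).
  have := uI (fun=> 1) _ ord0; rewrite big1 => [/(_ P0)/eqP|j _].
    by rewrite oner_eq0.
  by rewrite u0 scaler0.
have [P0 _ _ _ _] := pp (inord (c - c)).
have := indep_mod_bound P0 C0 (PC n isT); rewrite expnMn leqNgt => /negP; apply.
have : (n ^ N.+1 <= n ^ (t + c))%N by rewrite leq_pexp2l.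
apply: leq_trans; rewrite expnS ltn_pmul2r ?expn_gt0 //.
Qed.
End Growth.

(** An independent family has at most as many members as the rank of [subst_mx], which does not
    depend on the field. Over [K] the monomials of a maximal set of independent rows attain this
    rank. *)
Lemma indep_mod_descent (K F : fieldType) (iota : {rmorphism K -> F}) N m
    (y : 'I_N -> {mpoly K[m]}) n h :
  indep_mod (fun q : {mpoly F[N]} =>
    mmap (@mpolyC m F) (fun l => map_mpoly iota (y l)) q = 0) n h ->
  indep_mod (fun q => mmap (@mpolyC m K) y q = 0) n h.
Proof.
case=> u [un uI]; pose s := #|{: 'X_{1..N < n}}|.
pose B := subst_mx y n.
pose W := \matrix_(j < h, b < s) (u j)@_(bmon b).
have hr : (h <= \rank B)%N.
  have /eqP <- : row_free (W *m map_mx iota B); last first.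
    by rewrite -(mxrank_map iota); exact: mxrankM_maxr.
  apply: inj_row_free => v vWB; apply/rowP => j; rewrite mxE.
  apply: (uI (v 0)); rewrite (_ : \sum_j _ = mpoly_of (v *m W)).
    apply: (subst_mxP _ (fun l => erefl (map_mpoly iota (y l)))).2.
    by rewrite -mulmxA.
  rewrite /mpoly_of; under [RHS]eq_bigr => b _ do rewrite mxE scaler_suml.
  rewrite exchange_big; apply: eq_bigr => k _ /=.
  rewrite {1}(mpoly_ofE (un k)) scaler_sumr; apply: eq_bigr => b _.
  by rewrite !mxE scalerA.
apply: indep_mod_le hr _; exists (fun j => 'X_[bmon (maxrankfun B j)]).
split=> [j|c]; first by rewrite msizeX; exact: bmdeg.
pose c' := \row_j c j; move=> cX j; have <- : c' 0 j = c j by rewrite mxE.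
suff -> : c' = 0 by rewrite mxE.
apply: (row_free_inj (maxrowsub_free B)); rewrite mul0mx.
pose v := \sum_j c j *: delta_mx 0 (maxrankfun B j) : 'rV[K]_s.
have -> : c' *m rowsub (maxrankfun B) B = v *m B.
  rewrite mulmx_sum_row mulmx_suml; apply: eq_bigr => k _.
  by rewrite mxE row_rowsub -scalemxAl -rowE.
have idE l : y l = map_mpoly (idfun : {rmorphism K -> K}) (y l).
  by rewrite map_mpoly_idfun.
have -> : B = map_mx (idfun : {rmorphism K -> K}) B by rewrite map_mx_id.
apply: (subst_mxP _ idE).1.
rewrite (_ : mpoly_of v = \sum_j c j *: 'X_[bmon (maxrankfun B j)]) //.
rewrite /mpoly_of; under eq_bigr => b _ do rewrite summxE scaler_suml.
rewrite exchange_big; apply: eq_bigr => k _ /=.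
move: (maxrankfun B k) => b0.
rewrite (bigD1 b0) //= big1 ?addr0 => [|b bk].
  by rewrite !mxE !eqxx mulr1.
by rewrite !mxE (negPf bk) andbF mulr0 scale0r.
Qed.

(** * The generic block triangular representation *)

Section Evaluation.
Variables (F : fieldType) (Q : quiver).

Definition repev (A : kalg F) (n : dimvec Q) (x : rep A n)
    (q : {mpoly F[ncoord n]}) : A :=
  mmap (kstr A) (rep_coords x) q.

Lemma eq_rep_coords (R : Type) (n : dimvec Q) (x y : rep R n) :
  (forall a, x a = y a) -> rep_coords x = rep_coords y.
Proof. by move=> xy; apply: functional_extensionality => l; rewrite /rep_coords xy. Qed.

Lemma rep_coords_map (R S : Type) (f : R -> S) (n : dimvec Q) (x : rep R n) l :
  rep_coords (map_rep f x) l = f (rep_coords x l).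
Proof. by rewrite /rep_coords mxE. Qed.

Lemma repev_map (A B : kalg F) (f : kalg_hom A B) (n : dimvec Q) (x : rep A n) q :
  f (repev x q) = repev (map_rep f x) q.
Proof.
rewrite /repev mmap_hom; congr (mmap _ _ _).
by apply: functional_extensionality => l; rewrite rep_coords_map.
Qed.

Lemma eq_repev (A : kalg F) (n : dimvec Q) (x y : rep A n) q :
  (forall a, x a = y a) -> repev x q = repev y q.
Proof. by move=> /eq_rep_coords xy; rewrite /repev xy. Qed.
End Evaluation.

Lemma flagproj_chain (Q : quiver) (d : filtration Q) (A : comNzRingType) :
  chain (d := d) (flagproj d A).
Proof.
split=> [k l i kl lnu|k l i kl lnu|i|i|L f k i].
- by have [] := flagproj_mul A i kl lnu.
- by have [] := flagproj_mul A i kl lnu.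
- exact: flagproj0.
- exact: flagproj1.
rewrite flagproj_map /flagproj inord_val rank_pid_mx //.
all: have -> : k = inord k by rewrite inord_val.
all: have -> : ftop d i = d (inord (flen d)) i by
  rewrite /ftop; congr (d _ i); apply/val_inj; rewrite /= inordK.
all: by rewrite fdim_mono // -ltnS.
Qed.

Section Conjugates.
Variables (Q : quiver) (d : filtration Q) (A : comNzRingType).
Local Notation n := (ftop d).
Variables (g h : forall i, 'M[A]_(n i)).
Hypotheses (gh : forall i, g i *m h i = 1%:M) (hg : forall i, h i *m g i = 1%:M).

Lemma chain_conj e : chain (d := d) e ->
  chain (d := d) (fun k i => h i *m e k i *m g i).
Proof.
have mul k l i (E : nat -> forall i, 'M[A]_(n i)) :
    (h i *m E k i *m g i) *m (h i *m E l i *m g i) =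
    h i *m (E k i *m E l i) *m g i.
  by rewrite -!mulmxA (mulmxA (g i)) gh mul1mx.
move=> ce; split=> [k l i kl lnu|k l i kl lnu|i|i|L f k i].
- by rewrite mul (chain_mul ce).
- by rewrite mul (chain_mul' ce).
- by rewrite (chain0 ce) mulmx0 mul0mx.
- by rewrite (chain1 ce) mulmx1 hg.
have fu (U V : 'M[A]_(n i)) : U *m V = 1%:M -> map_mx f U \in unitmx.
  by move=> UV; have /mulmx1_unit [] // : map_mx f U *m map_mx f V = 1%:M;
    rewrite -map_mxM UV map_mx1.
rewrite !map_mxM mxrankMfree ?row_free_unit ?(fu _ _ (gh i)) //.
by rewrite eqmxMfull ?row_full_unit ?(fu _ _ (hg i)) // (chain_rank ce).
Qed.

Definition conj_proj (k : nat) i := h i *m flagproj d A k i *m g i.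

Lemma conj_chain : chain (d := d) conj_proj.
Proof. exact: chain_conj (@flagproj_chain Q d A). Qed.

Lemma conj_subrep (N : rep A n) :
  tri (d := d) (fun a => g (src a) *m N a *m h (tgt a)) <->
  forall k a, (k <= flen d)%N -> conj_proj k (src a) *m N a *m
    conj_proj k (tgt a) = conj_proj k (src a) *m N a.
Proof.
split=> E k a knu.
  have e := E k a knu; rewrite /conj_proj.
  transitivity (h (src a) *m (flagproj d A k (src a) *m
    (g (src a) *m N a *m h (tgt a)) *m flagproj d A k (tgt a)) *m g (tgt a)).
    by rewrite !mulmxA.
  by rewrite e -!mulmxA hg mulmx1.
transitivity (g (src a) *m (conj_proj k (src a) *m N a *m
  conj_proj k (tgt a)) *m h (tgt a)).
  rewrite /conj_proj !mulmxA gh mul1mx -!mulmxA gh mulmx1 //.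
by rewrite E // /conj_proj !mulmxA gh mul1mx.
Qed.
End Conjugates.

Lemma triZ (Q : quiver) (d : filtration Q) (A : comNzRingType)
    (T : rep A (ftop d)) (c : arr Q -> A) :
  tri T -> tri (d := d) (fun a => c a *: T a).
Proof.
by move=> tT k a knu; rewrite -scalemxAr -scalemxAl tT.
Qed.

Lemma tri_map (Q : quiver) (d : filtration Q) (A B : comNzRingType)
    (f : {rmorphism A -> B}) (T : rep A (ftop d)) :
  tri T -> tri (d := d) (map_rep f T).
Proof.
move=> tT k a knu; rewrite /map_rep -!(flagproj_map d f) -!map_mxM.
by rewrite tT.
Qed.

Lemma par_map (Q : quiver) (d : filtration Q) (A B : comNzRingType)
    (f : {rmorphism A -> B}) (g : forall i, 'M[A]_(ftop d i))
    (T : rep A (ftop d)) a :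
  map_rep f (par g T) a = par (fun i => map_mx f (g i)) (map_rep f T) a.
Proof. by rewrite /map_rep /par !map_mxM map_mx_adj. Qed.

Section Generic.
Variables (Q : quiver) (d : filtration Q).
Local Notation n := (ftop d).

Definition gvar :=
  ({i : vert Q & ('I_(n i) * 'I_(n i))%type} + Defs.coord n)%type.
Definition ngvar := #|{: gvar}|.

Definition in_block a (l : 'I_(n (src a))) (j : 'I_(n (tgt a))) :=
  [forall k : 'I_(flen d).+1, (l < d k (src a))%N ==> (j < d k (tgt a))%N].

Definition gen_g (R : comNzRingType) i : 'M[{mpoly R[ngvar]}]_(n i) :=
  \matrix_(l, j) 'X_(enum_rank
    (inl (Tagged (fun i => 'I_(n i) * 'I_(n i))%type (l, j)) : gvar)).

Definition gen_T (R : comNzRingType) : rep {mpoly R[ngvar]} n :=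
  fun a => \matrix_(l, j) if in_block l j then
    'X_(enum_rank (inr (Tagged
      (fun a => 'I_(n (src a)) * 'I_(n (tgt a)))%type (l, j)) : gvar)) else 0.

Definition gen_pt (R : comNzRingType) : 'I_(ncoord n) -> {mpoly R[ngvar]} :=
  rep_coords (par (gen_g R) (gen_T R)).

Definition gval (A : Type) (g : forall i, 'M[A]_(n i)) (T : rep A n) :
    'I_ngvar -> A :=
  fun l => match enum_val l with
    | inl c => g (tag c) (tagged c).1 (tagged c).2
    | inr c => T (tag c) (tagged c).1 (tagged c).2
  end.

Lemma flagproj_mulE (R : comNzRingType) m k i (X : 'M[R]_(n i, m)) l j :
  (flagproj d R k i *m X) l j = if (l < d (inord k) i)%N then X l j else 0.
Proof.
rewrite mxE (bigD1 l) //= big1 ?addr0 => [|t tl].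
  by rewrite mxE eqxx; case: ltnP => _; rewrite ?mul1r ?mul0r.
by rewrite mxE (inj_eq val_inj) eq_sym (negPf tl) mul0r.
Qed.

Lemma mul_flagprojE (R : comNzRingType) m k i (X : 'M[R]_(m, n i)) l j :
  (X *m flagproj d R k i) l j = if (j < d (inord k) i)%N then X l j else 0.
Proof.
rewrite mxE (bigD1 j) //= big1 ?addr0 => [|t tl].
  by rewrite mxE eqxx; case: ltnP => _; rewrite ?mulr1 ?mulr0.
rewrite mxE (inj_eq val_inj) (negPf tl) mulr0 //.
Qed.

Lemma triP (R : comNzRingType) (T : rep R n) :
  tri T <-> forall a l j, ~~ in_block l j -> T a l j = 0.
Proof.
split=> [tT a l j|T0 k a knu].
  rewrite negb_forall => /existsP [k]; rewrite negb_imply => /andP [lk jk].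
  have := tT k a; rewrite -ltnS => /(_ (ltn_ord k)) /matrixP /(_ l j).
  by rewrite mul_flagprojE !flagproj_mulE inord_val lk (negPf jk).
apply/matrixP => l j; rewrite mul_flagprojE !flagproj_mulE.
case: ltnP => // jk; case: ltnP => // lk; rewrite T0 //.
rewrite negb_forall; apply/existsP; exists (inord k).
by rewrite negb_imply lk -leqNgt.
Qed.

Lemma gen_tri (R : comNzRingType) : tri (gen_T R).
Proof. by apply/triP => a l j lj; rewrite mxE (negPf lj). Qed.

Lemma gen_g_map (R A : comNzRingType) (f : {rmorphism R -> A}) g T i :
  map_mx (mmap f (gval g T)) (gen_g R i) = g i.
Proof.
by apply/matrixP => l j; rewrite !mxE mmapX mmap1U /gval enum_rankK.
Qed.

Lemma gen_T_map (R A : comNzRingType) (f : {rmorphism R -> A}) g T a :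
  tri T -> map_mx (mmap f (gval g T)) (gen_T R a) = T a.
Proof.
move=> /triP T0; apply/matrixP => l j; rewrite !mxE.
case: ifPn => lj; last by rewrite mmap0 T0.
by rewrite mmapX mmap1U /gval enum_rankK.
Qed.

Lemma gen_par_map (R A : comNzRingType) (f : {rmorphism R -> A}) g T a :
  tri T -> map_mx (mmap f (gval g T)) (par (gen_g R) (gen_T R) a) = par g T a.
Proof.
move=> tT; rewrite -/(map_rep _ _ a) par_map /par /map_rep gen_T_map //.
by rewrite !gen_g_map.
Qed.

Lemma gen_pt_map (R A : comNzRingType) (f : {rmorphism R -> A}) l :
  map_mpoly f (gen_pt R l) = gen_pt A l.
Proof.
pose phi : {rmorphism {mpoly R[ngvar]} -> {mpoly A[ngvar]}} := map_mpoly f.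
have eg i : map_mx phi (gen_g R i) = gen_g A i.
  by apply/matrixP => u v; rewrite !mxE; exact: map_mpolyX.
have eT a : map_mx phi (gen_T R a) = gen_T A a.
  apply/matrixP => u v; rewrite !mxE; case: ifP => _; first exact: map_mpolyX.
  exact: rmorph0.
transitivity (rep_coords (map_rep phi (par (gen_g R) (gen_T R))) l).
  by rewrite rep_coords_map.
rewrite /gen_pt; suff /eq_rep_coords -> : forall a,
    map_rep phi (par (gen_g R) (gen_T R)) a = par (gen_g A) (gen_T A) a.
  reflexivity.
by move=> a; rewrite par_map /par /map_rep eT !eg.
Qed.
End Generic.
Arguments gen_g {Q} d R i.
Arguments gen_T {Q} d R a.

Section ParIdeal.
Variables (Q : quiver) (d : filtration Q).
Local Notation n := (ftop d).

(* The ideal of the closure of the image of [par]. *)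
Definition Par_ideal (F : fieldType) (q : {mpoly F[ncoord n]}) :=
  forall (A : kalg F) (g : forall i, 'M[A]_(n i)) (T : rep A n),
    tri T -> repev (par g T) q = 0.

Definition gen_alg (F : fieldType) :=
  KAlg (@mpolyC (ngvar d) F : {rmorphism F -> {mpoly F[ngvar d]}}).

Definition gen_hom (F : fieldType) (A : kalg F) (g : forall i, 'M[A]_(n i))
    (T : rep A n) : kalg_hom (gen_alg F) A :=
  @KAlgHom F (gen_alg F) A (mmap (kstr A) (gval g T)) (fun c => mmapC _ _ c).

(** Every pair [(g, T)] with [tri T] is a specialization of the generic one. This makes [Par_ideal]
    the kernel of a map into a domain. *)
Lemma Par_idealP (F : fieldType) (q : {mpoly F[ncoord n]}) :
  Par_ideal q <-> mmap (@mpolyC (ngvar d) F) (@gen_pt Q d F) q = 0.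
Proof.
split=> [/(_ (gen_alg F) (gen_g d F) (gen_T d F) (@gen_tri _ d F)) //|q0].
move=> A g T tT.
have -> : repev (par g T) q = repev (A := A)
    (map_rep (gen_hom g T) (par (gen_g d F) (gen_T d F))) q.
  by apply: eq_repev => a; rewrite -(gen_par_map (kstr A) g a tT).
by rewrite -repev_map /repev q0 rmorph0.
Qed.

Lemma Par_ideal_prime (F : fieldType) : prime_ideal (@Par_ideal F).
Proof.
split.
- by apply/Par_idealP; rewrite rmorph0.
- by move=> p q /Par_idealP p0 /Par_idealP q0; apply/Par_idealP;
    rewrite mmapD p0 q0 addr0.
- by move=> p q /Par_idealP q0; apply/Par_idealP; rewrite rmorphM /= q0 mulr0.
- by move/Par_idealP/eqP; rewrite rmorph1 oner_eq0.
- move=> p q /Par_idealP; rewrite rmorphM => /eqP.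
  by rewrite mulf_eq0 => /orP [] /eqP e; [left|right]; apply/Par_idealP.
Qed.

(** The scheme-theoretic image commutes with the flat base change from [F] to [A]. It is needed for
    functions whose coefficients lie in [A], such as those composed with a conjugation over [A]. *)
Lemma Par_base_change (F : fieldType) (A : kalg F) (x : rep A n) :
  (forall q, Par_ideal q -> repev x q = 0) ->
  forall q : {mpoly A[ncoord n]},
  (forall (B : comNzRingType) (f : {rmorphism A -> B})
     (g : forall i, 'M[B]_(n i)) (T : rep B n),
     tri T -> mmap f (rep_coords (par g T)) q = 0) ->
  mmap idfun (rep_coords x) q = 0.
Proof.
move=> xI q q0; apply: (kernel_base_change (h := kstr A) (y := @gen_pt Q d F)).
  by move=> p /Par_idealP /xI.
rewrite (_ : (fun l => _) = gen_pt (d := d) A).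
  exact: (q0 _ (@mpolyC (ngvar d) A) _ _ (@gen_tri _ d A)).
by apply: functional_extensionality => l; rewrite gen_pt_map.
Qed.

Lemma Par_ideal_descent (K F : fieldType) (iota : {rmorphism K -> F}) m h :
  indep_mod (@Par_ideal F) m h -> indep_mod (@Par_ideal K) m h.
Proof.
move=> IF; have : indep_mod (fun q : {mpoly F[ncoord n]} =>
    mmap (@mpolyC (ngvar d) F)
      (fun l => map_mpoly iota (gen_pt (d := d) K l)) q = 0) m h.
  apply: indep_mod_sub IF => q q0; apply/Par_idealP.
  rewrite -{}[RHS]q0; congr (mmap _ _ _).
  by apply: functional_extensionality => l; rewrite gen_pt_map.
move/indep_mod_descent; apply: indep_mod_sub => q.
by move/Par_idealP.
Qed.

(** Read with coefficients in [A], the function [q] falls under the base change from [K] to [A]; its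
    coefficients in [F] need not be treated separately. *)
Lemma Par_ideal_map (K F : fieldType) (iota : {rmorphism K -> F})
    (A : kalg F) (x : rep A n) :
  (forall q : {mpoly K[ncoord n]}, Par_ideal q ->
     mmap (kstr A \o iota) (rep_coords x) q = 0) ->
  forall q : {mpoly F[ncoord n]}, Par_ideal q -> repev x q = 0.
Proof.
move=> xI q q0; pose A' := restr iota A.
have := @Par_base_change K A' x xI (map_mpoly (kstr A) q).
have mE (B : comNzRingType) (f : {rmorphism A -> B}) (y : 'I_(ncoord n) -> B) :
    mmap f y (map_mpoly (kstr A) q) = mmap (f \o kstr A) y q.
  rewrite (mpolyE q) [map_mpoly _ _]raddf_sum ![mmap _ _ _]raddf_sum /=.
  apply: eq_bigr => m _.
  by rewrite map_mpolyZ map_mpolyX !mmapZ !mmapX.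
have e1 := mE A idfun (rep_coords x).
rewrite e1; apply => B f g T tT.
have e2 := mE B f (rep_coords (par g T)); rewrite e2.
exact: (q0 (KAlg (f \o kstr A : {rmorphism F -> B})) g T tT).
Qed.
End ParIdeal.

(** * The ideal of [A_d] *)

Section PolyAlg.
Variables (F : fieldType) (A : kalg F).

Definition palg : kalg F := KAlg (@polyC A \o kstr A : {rmorphism F -> {poly A}}).

Definition peval1 : kalg_hom palg A :=
  @KAlgHom F palg A (horner_eval 1) (fun c => hornerC _ _).

Definition pscale (c : A) : kalg_hom palg palg :=
  @KAlgHom F palg palg (comp_poly (c *: 'X)) (fun b => comp_polyC _ _).

Lemma pscale_eq0 (c : A) (p : {poly A}) : pscale c p = 0 ->
  c ^+ size p * peval1 p = 0.
Proof.
move=> e; have ci i : c ^+ i * p`_i = 0.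
  rewrite -[RHS](coef0 _ i) -e /= comp_polyE coef_sum.
  case: (ltnP i (size p)) => ip; last first.
    rewrite nth_default // mulr0 big1 // => j _.
    rewrite exprZn coefZ coefZ coefXn.
    by rewrite (gtn_eqF (leq_trans (ltn_ord j) ip)) !mulr0.
  rewrite (bigD1 (Ordinal ip)) //= big1 => [|j ji].
    by rewrite exprZn !coefZ coefXn eqxx mulr1 addr0 mulrC.
  rewrite exprZn !coefZ coefXn (_ : (i == j) = false) ?mulr0 //.
  by apply: contraNF ji => /eqP ij; apply/eqP/val_inj.
rewrite /= /horner_eval horner_coef mulr_sumr big1 // => i _.
have /subnK {1}<- := ltnW (ltn_ord i).
by rewrite expr1n mulr1 exprD -mulrA ci mulr0.
Qed.
End PolyAlg.

Section FlagsInClosure.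
Variables (F : fieldType) (Q : quiver) (d : filtration Q).
Local Notation n := (ftop d).
Local Notation nu := (flen d).

(** The relation between [g], [e] and [flagproj] passes to the adjugate only after multiplication by
    the determinant, hence the factor [\det (g (tgt a))]. *)
Lemma tri_conj_adj (A : comNzRingType) (e : nat -> forall i, 'M[A]_(n i))
    (N : rep A n) (g : forall i, 'M[A]_(n i)) :
  (forall k a, (k <= nu)%N ->
     e k (src a) *m N a *m e k (tgt a) = e k (src a) *m N a) ->
  (forall k i, (k <= nu)%N -> g i *m e k i = flagproj d A k i *m g i) ->
  tri (fun a => \det (g (tgt a)) *: (g (src a) *m N a *m \adj (g (tgt a)))).
Proof.
move=> eN ge k a knu; set s := src a; set t := tgt a.
have eadj : \det (g t) *: (e k t *m \adj (g t)) =
    \det (g t) *: (\adj (g t) *m flagproj d A k t).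
  rewrite -mul_scalar_mx -mul_adj_mx -!mulmxA (mulmxA (g t)) ge //.
  by rewrite -!mulmxA mul_mx_adj -mul_mx_scalar !mulmxA.
have Psg : flagproj d A k s *m (g s *m N a *m \adj (g t)) =
    g s *m (e k s *m N a) *m \adj (g t) by rewrite !mulmxA ge.
rewrite -!scalemxAr -!scalemxAl Psg.
transitivity (g s *m (e k s *m N a) *m (\det (g t) *: (e k t *m \adj (g t)))).
  by rewrite eadj -!scalemxAr !mulmxA.
by rewrite -!scalemxAr -{2}(eN k a knu) !mulmxA.
Qed.

(** Were the annihilator of [repev N q] proper, it would vanish in some residue field. A matrix
    tuple [g] over [A], invertible in that field, brings the flag to standard form, and this puts a
    power of its determinants in the annihilator: a contradiction. *)
Lemma Par_ideal_flag (A : kalg F) (N : rep A n)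
    (e : nat -> forall i, 'M[A]_(n i)) :
  chain (d := d) e ->
  (forall k a, (k <= nu)%N ->
     e k (src a) *m N a *m e k (tgt a) = e k (src a) *m N a) ->
  forall q, Par_ideal q -> repev N q = 0.
Proof.
move=> ce eN q qI; apply: boolp.contrapT => qN.
have [||L [f [fI fs]]] := @ideal_to_field A (fun b => b * repev N q = 0).
- split; first by rewrite mul0r.
  + by move=> x y x0 y0; rewrite mulrDl x0 y0 addr0.
  + by move=> b x x0; rewrite -mulrA x0 mulr0.
- by rewrite mul1r.
have [g [fg ge]] := chain_block ce fs.
pose D i := \det (g i); pose cof i := \prod_(j | j != i) D j.
(* The adjugates produce [D (src a)] once and [D (tgt a)] twice; the factors [cof] complete this to
   a scalar that is the same for all arrows. *)
pose c := (\prod_i D i) ^+ 3.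
have Dc i : D i * cof i = \prod_i D i by rewrite [RHS](bigD1 i).
pose T0 : rep A n := fun a => (cof (src a) * cof (tgt a) ^+ 2) *:
  (D (tgt a) *: (g (src a) *m N a *m \adj (g (tgt a)))).
have tT0 : tri T0 by apply: triZ; apply: tri_conj_adj eN ge.
have parT0 a : par g T0 a = c *: N a.
  rewrite /par /T0 -scalemxAr -scalemxAl -scalemxAr -scalemxAl.
  rewrite !mulmxA mul_adj_mx -(mulmxA _ (\adj _)) mul_adj_mx.
  rewrite mul_scalar_mx mul_mx_scalar !scalerA; congr (_ *: _).
  rewrite /c -/(D (src a)) -/(D (tgt a)) !exprS expr0 mulr1.
  by rewrite -{1}(Dc (src a)) -(Dc (tgt a)); ring.
(* The line through [N]: at ['X = 1] it gives [N], and after the rescaling by [c] it is a value of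
   [par], where [q] vanishes. *)
pose N' : rep (palg A) n := fun a => 'X *: map_mx polyC (N a).
have e1 : peval1 A (repev N' q) = repev N q.
  rewrite repev_map; apply: eq_repev => a; apply/matrixP => i j.
  by rewrite !mxE /= /horner_eval hornerM hornerX hornerC mul1r.
have e2 : pscale c (repev N' q) = 0.
  pose T' : rep (palg A) n := fun a => 'X *: map_mx polyC (T0 a).
  have tT' : tri T'.
    apply: (@triZ _ d (palg A) (map_rep polyC T0) (fun=> 'X)).
    exact: (tri_map (@polyC A) tT0).
  rewrite -(qI (palg A) (fun i => map_mx polyC (g i)) T' tT') repev_map.
  apply: eq_repev => a.
  have -> : par (fun i => map_mx polyC (g i)) T' a =
      'X *: map_rep polyC (par g T0) a.
    rewrite (par_map (@polyC A)) /par /T' /map_rep.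
    by rewrite -scalemxAr -scalemxAl.
  rewrite /map_rep parT0; apply/matrixP => i j.
  rewrite !mxE /= comp_polyM comp_polyX comp_polyC polyCM.
  by rewrite -mul_polyC mulrCA mulrA.
have := pscale_eq0 e2; rewrite e1 => /fI /eqP.
rewrite rmorphXn expf_eq0 /c rmorphXn rmorph_prod expf_eq0 /=.
by case/andP=> _ /prodf_eq0 [i _]; apply/negP; exact: fg.
Qed.

Lemma gen_det_neq0 i : \det (gen_g d F i) != 0.
Proof.
apply/eqP => D0; pose T : rep F n := fun a => 0.
have := gen_g_map (idfun : {rmorphism F -> F}) (fun i => 1%:M : 'M[F]_(n i)) T i.
move/(congr1 determinant); rewrite det1.
have -> : \det (map_mx (mmap idfun (gval (fun i => 1%:M) T)) (gen_g d F i)) = 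
  mmap (idfun : {rmorphism F -> F}) (gval (fun i => 1%:M) T) (\det (gen_g d F i)).
  exact: (det_map_mx (mmap (idfun : {rmorphism F -> F}) _)).
by rewrite D0 rmorph0 => /esym /eqP; rewrite oner_eq0.
Qed.

(** Over the fraction field the generic [g] is invertible, so the generic conjugate carries a flag
    there; the polynomial ring embeds in this field, and vanishing at the generic pair follows. *)
Lemma Ad_ideal_Par (q : {mpoly F[ncoord n]}) : Ad_ideal q <-> Par_ideal q.
Proof.
split=> [qAd|qI A N U flU subU]; last first.
  have [e [ce eU]] := flag_chain flU; rewrite eU in subU.
  apply: (Par_ideal_flag (A := A) ce) => // k a knu.
  by have /(_ (inord k) a) := (chain_subrep N ce).1 subU; rewrite inordK.
pose E : fieldType := {fraction {mpoly F[ngvar d]}}.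
pose fr : {rmorphism {mpoly F[ngvar d]} -> E} := @tofrac {mpoly F[ngvar d]}.
pose A : kalg F := KAlg (fr \o @mpolyC (ngvar d) F : {rmorphism F -> E}).
pose g i := map_mx fr (gen_g d F i); pose T := map_rep fr (gen_T d F).
have g0 i : \det (g i) \in GRing.unit.
  by rewrite unitfE det_map_mx /fr tofrac_eq0 gen_det_neq0.
pose h i := (\det (g i))^-1 *: \adj (g i).
have hg i : h i *m g i = 1%:M by apply: (mulmx_det_unit (mulVr (g0 i))).2.
have gh i : g i *m h i = 1%:M by apply: (mulmx_det_unit (mulVr (g0 i))).1.
have ce := conj_chain gh hg.
have sub : is_subrep_flag (par g T) (fun k i => prj (conj_proj (d := d) g h k i)).
  have e b : g (src b) *m par g T b *m h (tgt b) = \det (g (src b)) *: T b.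
    by rewrite /par -!mulmxA gh mulmx1 mulmxA mul_mx_adj mul_scalar_mx.
  have tN : tri (fun b => g (src b) *m par g T b *m h (tgt b)).
    have tT : tri T := tri_map fr (@gen_tri _ d F).
    move=> k b knu; rewrite e.
    exact: (triZ (fun b => \det (g (src b))) tT _ knu).
  apply/(chain_subrep (par g T) ce) => k a.
  by apply: ((conj_subrep gh hg (par g T)).1 tN); rewrite -ltnS.
have := qAd A _ _ (chain_flag ce) sub.
have e : repev (A := A) (par g T) q = fr (mmap (@mpolyC (ngvar d) F) (@gen_pt Q d F) q).
  pose ff : kalg_hom (gen_alg d F) A := @KAlgHom F (gen_alg d F) A fr (fun c => erefl).
  rewrite -[RHS]/(ff (repev (A := gen_alg d F) (par (gen_g d F) (gen_T d F)) q)).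
  by rewrite repev_map; apply: eq_repev => a; rewrite par_map.
rewrite -/(repev (A := A) (par g T) q) e => /eqP.
by rewrite tofrac_eq0 => /eqP /Par_idealP.
Qed.
End FlagsInClosure.

(** * The rank of the adjoint action and Ext *)

Section Vectors.
Variables (Q : quiver) (n : dimvec Q).

Definition ngl := #|{: {i : vert Q & ('I_(n i) * 'I_(n i))%type}}|.

Definition gmat (R : nzRingType) (X : 'rV[R]_ngl) i : 'M[R]_(n i) :=
  \matrix_(l, j) X 0 (enum_rank
    (Tagged (fun i => 'I_(n i) * 'I_(n i))%type (l, j))).

Definition gvec (R : nzRingType) (g : forall i, 'M[R]_(n i)) : 'rV[R]_ngl :=
  \row_l let c := enum_val l in g (tag c) (tagged c).1 (tagged c).2.

Definition rvec (R : nzRingType) (x : rep R n) : 'rV[R]_(ncoord n) :=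
  \row_l rep_coords x l.

Definition rmat (R : nzRingType) (v : 'rV[R]_(ncoord n)) : rep R n :=
  fun a => \matrix_(l, j) v 0 (enum_rank
    (Tagged (fun a => 'I_(n (src a)) * 'I_(n (tgt a)))%type (l, j))).

Lemma gvecK (R : nzRingType) g i : gmat (@gvec R g) i = g i.
Proof. by apply/matrixP => l j; rewrite !mxE enum_rankK. Qed.

Lemma rvecK (R : nzRingType) x a : rmat (@rvec R x) a = x a.
Proof. by apply/matrixP => l j; rewrite !mxE /rep_coords enum_rankK. Qed.

Lemma rmatK (R : nzRingType) (v : 'rV[R]_(ncoord n)) : rvec (rmat v) = v.
Proof.
apply/rowP => l; rewrite mxE /rep_coords /= mxE -[in RHS](enum_valK l).
by case: (enum_val l) => i [].
Qed.

Lemma eq_rvec (R : nzRingType) (x y : rep R n) :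
  (forall a, x a = y a) -> rvec x = rvec y.
Proof. by move=> xy; apply/rowP => l; rewrite !mxE /rep_coords xy. Qed.

Lemma gmat_is_linear (R : comNzRingType) i : linear (@gmat R ^~ i).
Proof. by move=> c X Y; apply/matrixP => l j; rewrite !mxE. Qed.

(** The kernel is the space of homomorphisms from [M] to [x], acting on row vectors from the right;
    for [x = M] the image is the space of coboundaries. *)
Definition adv (R : comNzRingType) (M x : rep R n) (X : 'rV[R]_ngl) :
    'rV[R]_(ncoord n) :=
  rvec (fun a => gmat X (src a) *m x a - M a *m gmat X (tgt a)).

Lemma adv_is_linear (R : comNzRingType) (M x : rep R n) : linear (adv M x).
Proof.
move=> c X Y; rewrite /adv; apply/rowP => l; rewrite !mxE /rep_coords.
rewrite !gmat_is_linear mulmxDl mulmxDr -scalemxAl -scalemxAr !mxE.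
by rewrite mulrBr opprD addrACA.
Qed.

HB.instance Definition _ (R : comNzRingType) (M x : rep R n) :=
  GRing.isLinear.Build R _ _ _ (adv M x) (adv_is_linear M x).

Definition ad_mx (R : comNzRingType) (M x : rep R n) : 'M[R]_(ngl, ncoord n) :=
  lin1_mx (adv M x).

Lemma mul_ad_mx (R : comNzRingType) (M x : rep R n) X :
  X *m ad_mx M x = adv M x X.
Proof. exact: mul_rV_lin1. Qed.

Lemma gmat_map (R S : comNzRingType) (f : {rmorphism R -> S}) (X : 'rV[R]_ngl) i :
  map_mx f (gmat X i) = gmat (map_mx f X) i.
Proof. by apply/matrixP => l j; rewrite !mxE. Qed.

Lemma adv_map (R S : comNzRingType) (f : {rmorphism R -> S}) (M x : rep R n) X :
  map_mx f (adv M x X) = adv (map_rep f M) (map_rep f x) (map_mx f X).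
Proof.
apply/rowP => l; rewrite !mxE /rep_coords; set c := enum_val l.
by rewrite /map_rep -!gmat_map -!map_mxM -map_mxB [RHS]mxE.
Qed.

Lemma ad_mx_map (R S : comNzRingType) (f : {rmorphism R -> S}) (M x : rep R n) :
  map_mx f (ad_mx M x) = ad_mx (map_rep f M) (map_rep f x).
Proof.
apply/row_matrixP => l; rewrite -map_row !rowE !mul_ad_mx adv_map.
by rewrite map_delta_mx.
Qed.
End Vectors.

Section ExtRank.
Variables (F : fieldType) (Q : quiver) (n : dimvec Q) (M : rep F n).
Local Notation MM := (qmod_of_rep M).

Section Lift.
Variables (O P : qmod F Q) (f : qhom O P) (g : qhom P MM).
Hypotheses (Pproj : qprojective P) (Ex : short_exact f g).
Variable eta : rep F n.

Let extension : qmod F Q :=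
  qmod_of_rep (d := fun i => (n i + n i)%N)
    (fun a => block_mx (M a) 0 (eta a) (M a)).

Let quotP (a : arr Q) (x : extension (src a)) :
  mulmxr (col_mx 0 1%:M) (qact extension a x) =
  qact MM a (mulmxr (col_mx 0 1%:M) x : MM (src a)).
Proof.
rewrite /= -!mulmxA; congr (_ *m _).
by rewrite mul_block_col mul_col_mx !mul0mx !mulmx0 !mulmx1 mul1mx !add0r.
Qed.

Let quot : qhom extension MM :=
  @QHom F Q extension MM (fun i => mulmxr (col_mx 0 1%:M)) quotP.

(** The map [g] lifts to the self-extension of [M] defined by [eta], and [al] is the component of
    the lift in the submodule. On [O], where [g] vanishes, the defect disappears and [al] becomes a
    homomorphism. *)
Lemma ext_lift : exists al : forall i, {linear P i -> 'rV[F]_(n i)},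
  forall a (p : P (src a)), al (tgt a) (qact P a p) =
    al (src a) p *m M a + (g (src a) p : 'rV_(n (src a))) *m eta a.
Proof.
have [|h hP] := Pproj (g := quot) g.
  move=> i w; exists (row_mx 0 w : extension i).
  by rewrite /= mul_row_col mul0mx mulmx1 add0r.
exists (fun i => mulmxr (col_mx 1%:M 0) \o h i) => a p.
rewrite -hP /= qfunP /=; set u := h _ p.
rewrite -!mulmxA -mulmxDr; congr (_ *m _).
rewrite mul_block_col !mul_col_mx !mulmx1 !mulmx0 !mul0mx !mul1mx !addr0.
by rewrite add_col_mx add0r addr0.
Qed.

Lemma ext_cocycle : exists (al : forall i, {linear P i -> 'rV[F]_(n i)})
    (phi : qhom O MM),
  (forall a (p : P (src a)), al (tgt a) (qact P a p) =
    al (src a) p *m M a + (g (src a) p : 'rV_(n (src a))) *m eta a) /\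
  forall i x, phi i x = al i (f i x).
Proof.
have [al alP] := ext_lift; have [_ _ gf] := Ex.
have phiP (a : arr Q) (x : O (src a)) :
    (al (tgt a) \o f (tgt a)) (qact O a x) =
    qact MM a ((al (src a) \o f (src a)) x : MM (src a)).
  rewrite /= qfunP alP (_ : g _ _ = 0) ?mul0mx ?addr0 //.
  by apply/gf; exists x.
by exists al, (@QHom F Q O MM (fun i => al i \o f i) phiP).
Qed.
End Lift.

(** Row [l] of [B] holds the coordinates of the class of the self-extension given by the [l]-th
    coordinate vector. If a combination [v] has class zero, the lifts corrected by [H] combine to a
    map that vanishes on [O]; it descends along [g] to some [X], which exhibits [v] as a coboundary.
    So the kernel of [B], of dimension at least [ncoord n - c], lies in the image of [ad_mx M M]. *)
Lemma ext1_dim_rank c : ext1_dim MM MM c -> (ncoord n <= \rank (ad_mx M M) + c)%N.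
Proof.
case=> O [P [f [g [Pproj Ex [psi psiP]]]]].
have [_ gsurj gf] := Ex.
have h l : exists (al : forall i, {linear P i -> 'rV[F]_(n i)}) (H : qhom P MM)
    (b : 'rV[F]_c),
    (forall a (p : P (src a)), al (tgt a) (qact P a p) = al (src a) p *m M a +
      (g (src a) p : 'rV_(n (src a))) *m rmat (delta_mx 0 l) a) /\
    forall i x, al i (f i x) =
      \sum_(j < c) b 0 j *: psi j i x + H i (f i x) :> 'rV_(n i).
  have [al [phi [alP phiE]]] := ext_cocycle Pproj Ex (rmat (delta_mx 0 l)).
  have [b [[H HP] _]] := psiP phi; exists al, H, b; split=> // i x.
  by rewrite -phiE HP.
have {h} [al /boolp.choice [H /boolp.choice [b alHb]]] := boolp.choice h.
pose B := \matrix_(l < ncoord n) b l.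
suff kerB : (kermx B <= ad_mx M M)%MS.
  have := mxrankS kerB; rewrite mxrank_ker leq_subLR => /leq_trans; apply.
  by rewrite addnC leq_add2l rank_leq_col.
apply/rV_subP => v /sub_kermxP vB.
pose be i (p : P i) : 'rV[F]_(n i) :=
  \sum_l v 0 l *: (al l i p - (H l i p : 'rV_(n i))).
have beD i p q : be i (p + q) = be i p + be i q.
  rewrite -big_split; apply: eq_bigr => l _ /=.
  by rewrite (raddfD (al l i)) (raddfD (H l i)) opprD addrACA scalerDr.
have beZ i x p : be i (x *: p) = x *: be i p.
  rewrite /be scaler_sumr; apply: eq_bigr => l _.
  by rewrite [al l i _]linearZ [H l i _]linearZ -scalerBr scalerA mulrC -scalerA.
have be0 i p : g i p = 0 -> be i p = 0.
  move=> /gf [x <-]; rewrite /be.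
  transitivity (\sum_l \sum_j (v 0 l * b l 0 j) *: (psi j i x : 'rV_(n i))).
    apply: eq_bigr => l _; have [_ ->] := alHb l.
    by rewrite addrK scaler_sumr; apply: eq_bigr => j _; rewrite scalerA.
  rewrite exchange_big big1 // => j _; rewrite -scaler_suml.
  have /rowP /(_ j) := vB; rewrite !mxE => e.
  by rewrite (_ : \sum_l _ = 0) ?scale0r // -[RHS]e; apply: eq_bigr => l _; rewrite !mxE.
have bea (a : arr Q) (p : P (src a)) : be (tgt a) (qact P a p) =
    be (src a) p *m M a + (g (src a) p : 'rV_(n (src a))) *m rmat v a.
  have -> : rmat v a = \sum_l v 0 l *: rmat (delta_mx 0 l) a.
    apply/matrixP => i j; rewrite summxE !mxE.
    set k := enum_rank _; rewrite (bigD1 k) //= big1 ?addr0 => [|l lk].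
      by rewrite !mxE !eqxx mulr1.
    by rewrite !mxE eq_sym (negPf lk) andbF mulr0.
  rewrite mulmx_suml mulmx_sumr -big_split; apply: eq_bigr => l _ /=.
  have [-> _] := alHb l; rewrite qfunP /= -scalemxAl mulmxBl -scalemxAr -scalerDr.
  by rewrite addrAC.
have lift i : exists p : 'I_(n i) -> P i, forall j, g i (p j) = delta_mx 0 j.
  have h j : exists q, g i q = delta_mx 0 j := gsurj i _.
  by have [q qP] := boolp.choice h; exists q.
pose p i := sval (boolp.cid (lift i)).
have pP i j : g i (p i j) = delta_mx 0 j by rewrite /p; case: boolp.cid.
pose X i := \matrix_(j < n i) be i (p i j).
have beX i q : be i q = (g i q : 'rV_(n i)) *m X i.
  pose q' := \sum_j (g i q : 'rV_(n i)) 0 j *: p i j.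
  have gq' : g i q' = g i q.
    rewrite raddf_sum [RHS]row_sum_delta; apply: eq_bigr => j _.
    by rewrite -(pP i j); exact: linearZ_LR.
  have -> : be i q = be i q'.
    apply/eqP; rewrite -subr_eq0; apply/eqP.
    rewrite -(be0 i (q - q')); last by rewrite raddfB /= gq' subrr.
    by rewrite beD -scaleN1r beZ scaleN1r.
  rewrite mulmx_sum_row /q' (big_morph (be i) (beD i) (_ : be i 0 = 0)); last first.
    by apply: be0; rewrite raddf0.
  by apply: eq_bigr => j _; rewrite beZ rowK.
have etaX a : rmat v a = M a *m X (tgt a) - X (src a) *m M a.
  apply/row_matrixP => j; rewrite !rowE -(pP (src a) j).
  have := bea a (p (src a) j); rewrite !beX qfunP /= => e.
  by rewrite mulmxBr !mulmxA e addrAC subrr add0r.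
apply/submxP; exists (- gvec X); rewrite mulNmx mul_ad_mx /adv.
rewrite -[v]rmatK; apply/rowP => l; rewrite !mxE /rep_coords.
by rewrite !gvecK etaX !mxE opprB.
Qed.
End ExtRank.

(** * Algebraic independence along a curve *)

(** Each matrix [C] is deformed to ['X + C], whose determinant is monic and therefore regular. There
    the identity follows by cancellation, and ['X = 0] brings it back. *)
Lemma adj_mulmx (R : comNzRingType) n (A B : 'M[R]_n) :
  \adj (A *m B) = \adj B *m \adj A.
Proof.
pose lift (C : 'M[R]_n) := char_poly_mx (- C).
have lift0 C : map_mx (horner_eval 0) (lift C) = C.
  apply/matrixP => i j; rewrite !mxE /horner_eval hornerD hornerN hornerC.
  by rewrite hornerMn hornerX mul0rn sub0r opprK.
have reg C : GRing.lreg (\det (lift C)) by apply/monic_lreg/char_poly_monic.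
have cancel C (X : 'M_n) : lift C *m X = 0 -> X = 0.
  move=> CX; have := congr1 (mulmx (\adj (lift C))) CX.
  rewrite mulmxA mul_adj_mx mulmx0 mul_scalar_mx => /matrixP e.
  apply/matrixP => i j; apply: (reg C); have := e i j.
  by rewrite !mxE mulr0.
have e : \adj (lift A *m lift B) = \adj (lift B) *m \adj (lift A).
  apply/eqP; rewrite -subr_eq0; apply/eqP/(cancel B)/(cancel A).
  rewrite mulmxA mulmxBr mul_mx_adj mulmxA -(mulmxA (lift A)) mul_mx_adj.
  by rewrite mul_mx_scalar -scalemxAl mul_mx_adj det_mulmx scale_scalar_mx mulrC subrr.
have := congr1 (map_mx (horner_eval 0)) e.
by rewrite map_mxM !map_mx_adj map_mxM !lift0.
Qed.

Section TangentIndep.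
Variables (F : fieldType) (r n : nat).
Local Notation R := {mpoly F[r]}.
Local Notation E := {fraction {poly R}}.
Variables (D : {poly R}) (Y : 'I_r -> {poly R}) (c : {ffun 'I_r -> 'I_n} -> F).
Hypotheses (D0 : D`_0 = 1) (Y0 : forall i, (Y i)`_0 = 0)
  (Y1 : forall i, (Y i)`_1 = - 'X_i).

Let wt (al : {ffun 'I_r -> 'I_n}) := (\sum_i al i)%N.
(** Bounds all weights, so that [D ^+ B] clears the denominators. *)
Let B := (r * n)%N.

Let wtB al : (wt al <= B)%N.
Proof.
rewrite /wt /B -[r in (r * n)%N]card_ord -sum_nat_const.
by apply: leq_sum => i _; apply: ltnW.
Qed.

(* The form of lowest degree of a vanishing combination of monomials in
   [- t_i z + O(z^2)] vanishes. *)
Lemma tangent_indep_poly :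
  \sum_al ((c al)%:MP)%:P * D ^+ (B - wt al) * \prod_i Y i ^+ al i = 0 ->
  forall al, c al = 0.
Proof.
pose W i := drop_poly 1 (Y i) => sum0.
have YW i : Y i = W i * 'X.
  rewrite -{1}(poly_take_drop 1 (Y i)) expr1.
  rewrite (_ : take_poly 1 (Y i) = 0) ?add0r //.
  by apply/polyP => -[|k]; rewrite coef_take_poly //= coef0 ?Y0.
have W0 i : (W i).[0] = - 'X_i by rewrite horner_coef0 coef_drop_poly Y1.
have YWal (al : {ffun 'I_r -> 'I_n}) :
    \prod_i Y i ^+ al i = (\prod_i W i ^+ al i) * 'X ^+ wt al.
  under eq_bigr => i _ do rewrite YW exprMn.
  by rewrite big_split /= expr_sum.
move=> al; apply/eqP; apply: contraT => cal.
have [al0 cal0 minal0] := @arg_minnP _ al (fun al => c al != 0) wt cal.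
(* The terms after division by ['X ^+ wt al0]; the truncated subtraction is harmless, since terms of
   smaller weight have coefficient 0. *)
pose T be := ((c be)%:MP)%:P * D ^+ (B - wt be) * (\prod_i W i ^+ be i) *
  'X ^+ (wt be - wt al0).
have sumT : \sum_be T be = 0.
  apply: (mulIf (_ : 'X ^+ wt al0 != 0)); first by rewrite expf_neq0 ?polyX_eq0.
  rewrite mul0r -[RHS]sum0 mulr_suml; apply: eq_bigr => be _.
  rewrite /T YWal; case: (eqVneq (c be) 0) => [->|/minal0 wbe].
    by rewrite mpolyC0 polyC0 !mul0r.
  by rewrite -!mulrA -exprD subnK.
have T0 be : (T be).[0] =
    if wt be == wt al0 then (c be * (-1) ^+ wt be) *: 'X_[[multinom (be i : nat) | i < r]]
    else 0.
  have WT : (\prod_i W i ^+ be i).[0] =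
      (-1) ^+ wt be * 'X_[[multinom (be i : nat) | i < r]].
    rewrite horner_prod mpolyXE_id expr_sum -big_split /=.
    by apply: eq_bigr => i _; rewrite horner_exp W0 mnmE [in LHS]exprNn.
  rewrite /T !hornerM !horner_exp hornerC hornerX horner_coef0 D0 expr1n mulr1 WT.
  case: (ltngtP (wt be) (wt al0)) => [lt|gt|->].
  - have -> : c be = 0 by apply/eqP; apply: contraTT lt => /minal0; rewrite -leqNgt.
    by rewrite mpolyC0 !mul0r.
  - by rewrite expr0n subn_eq0 leqNgt gt mulr0.
  - rewrite subnn expr0 mulr1 mul_mpolyC -scalerA; congr (_ *: _).
    by rewrite -mul_mpolyC rmorphXn /= rmorphN1.
have := congr1 (fun p => p.[0]@_[multinom (al0 i : nat) | i < r]) sumT.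
rewrite /= horner0 mcoeff0 horner_sum raddf_sum (bigD1 al0) //= big1 ?addr0.
  rewrite T0 eqxx mcoeffZ mcoeffX eqxx mulr1 => /eqP.
  by rewrite mulf_eq0 (negPf cal0) signr_eq0.
move=> be beal; rewrite T0; case: ifP => _; last exact: mcoeff0.
rewrite mcoeffZ mcoeffX; case: eqP => [e|_]; last by rewrite mulr0.
case/eqP: beal; apply/ffunP => i; apply/val_inj.
by move/mnmP/(_ i): e; rewrite !mnmE.
Qed.

Lemma tangent_indep :
  \sum_al tofrac (((c al)%:MP)%:P : {poly R}) *
    \prod_i (tofrac (Y i) / tofrac D) ^+ al i = 0 :> E ->
  forall al, c al = 0.
Proof.
move=> sum0; apply: tangent_indep_poly.
have Dn0 : tofrac D != 0.
  rewrite tofrac_eq0; apply/eqP => DD; move/eqP: D0.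
  by rewrite DD coef0 eq_sym oner_eq0.
have := congr1 (fun x => x * tofrac D ^+ B) sum0; rewrite mul0r mulr_suml => e.
apply/eqP; rewrite -tofrac_eq0 rmorph_sum /= -[X in _ == X]e.
apply/eqP; apply: eq_bigr => al _.
under [in RHS]eq_bigr => i _ do rewrite expr_div_n.
rewrite big_split /= prodfV -[\prod_i tofrac D ^+ _]expr_sum -[in RHS](subnK (wtB al)) exprD.
rewrite -/(wt al) !tofracM tofracXn rmorph_prod /=.
under eq_bigr => i _ do rewrite tofracXn.
have := expf_neq0 (wt al) Dn0; set w := _ ^+ wt al => w0.
set u := tofrac D ^+ _; set z := \prod_i _.
by rewrite -!mulrA; congr (_ * _); rewrite [u * w]mulrC mulKf // mulrC.
Qed.
End TangentIndep.

(** * The orbit of [M] *)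

Definition selfalg (F : fieldType) : kalg F := KAlg (idfun : {rmorphism F -> F}).

Lemma msize_prod_le (F : fieldType) N (I : finType) (u : I -> {mpoly F[N]})
    (k : I -> nat) :
  (forall i, (msize (u i) <= 2)%N) ->
  (msize (\prod_i u i ^+ k i) <= (\sum_i k i).+1)%N.
Proof.
move=> u2; have bM a b (p q : {mpoly F[N]}) : (msize p <= a.+1)%N ->
    (msize q <= b.+1)%N -> (msize (p * q) <= (a + b).+1)%N.
  move=> pa qb; case: (eqVneq p 0) => [->|p0]; first by rewrite mul0r mmeasure0.
  case: (eqVneq q 0) => [->|q0]; first by rewrite mulr0 mmeasure0.
  rewrite msizeM //; move: pa qb; set s := mmeasure _ p; set t := mmeasure _ q.
  by move: s t => s t; rewrite -ltnS => sa tb; case: s sa => [|s] sa; lia.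
elim/big_ind2: _ => [|p a q b|i _]; first by rewrite mmeasureC oner_eq0.
  exact: bM.
elim: (k i) => [|m IH]; first by rewrite mmeasureC oner_eq0.
by rewrite exprS; apply: (bM 1%N m).
Qed.

(** * Conjugation of a representation by a curve through the identity *)

Section Curve.
Variable R : comNzRingType.

Lemma coefp0_mulmx m1 m2 m3 (U : 'M[{poly R}]_(m1, m2)) (V : 'M_(m2, m3)) :
  map_mx (coefp 0) (U *m V) = map_mx (coefp 0) U *m map_mx (coefp 0) V.
Proof.
apply/matrixP => u v; rewrite !mxE /= coef_sum; apply: eq_bigr => k _.
by rewrite !mxE /= coef0M.
Qed.

Lemma coefp1_mulmx m1 m2 m3 (U : 'M[{poly R}]_(m1, m2)) (V : 'M_(m2, m3)) :
  map_mx (coefp 1) (U *m V) = map_mx (coefp 0) U *m map_mx (coefp 1) V +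
    map_mx (coefp 1) U *m map_mx (coefp 0) V.
Proof.
apply/matrixP => u v; rewrite !mxE /= coef_sum -big_split; apply: eq_bigr => k _.
by rewrite !mxE /= coefM !big_ord_recl big_ord0 /= addr0.
Qed.

Lemma coefp0_scalemx m1 m2 p (U : 'M[{poly R}]_(m1, m2)) :
  map_mx (coefp 0) (p *: U) = p`_0 *: map_mx (coefp 0) U.
Proof. by apply/matrixP => u v; rewrite !mxE /= coef0M. Qed.

Lemma coefp1_scalemx m1 m2 p (U : 'M[{poly R}]_(m1, m2)) :
  map_mx (coefp 1) (p *: U) =
    p`_0 *: map_mx (coefp 1) U + p`_1 *: map_mx (coefp 0) U.
Proof.
apply/matrixP => u v; rewrite !mxE /= coefM.
by rewrite !big_ord_recl big_ord0 /= addr0.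
Qed.

Variables (Q : quiver) (n : dimvec Q) (M : rep R n) (X : forall i, 'M[R]_(n i)).

Definition curve_g i : 'M[{poly R}]_(n i) := 1%:M + 'X *: map_mx polyC (X i).
Definition curve_D := \prod_i \det (curve_g i).
(* [curve_D] times the conjugate of [M] by [1 + z X]. *)
Definition curve_x : rep {poly R} n := fun a =>
  (\prod_(i | i != src a) \det (curve_g i)) *:
    (\adj (curve_g (src a)) *m map_mx polyC (M a) *m curve_g (tgt a)).

Lemma curve_gx a : curve_g (src a) *m curve_x a =
  curve_D *: (map_mx polyC (M a) *m curve_g (tgt a)).
Proof.
rewrite /curve_x -scalemxAr !mulmxA mul_mx_adj mul_scalar_mx -scalemxAl scalerA.
by congr (_ *: _); rewrite /curve_D [RHS](bigD1 (src a)) //= mulrC.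
Qed.

Lemma curve_g0 i : map_mx (coefp 0) (curve_g i) = 1%:M.
Proof.
apply/matrixP => u v; rewrite !mxE /= coefD coefXM /= addr0.
by rewrite coefMn coef1.
Qed.

Lemma curve_g1 i : map_mx (coefp 1) (curve_g i) = X i.
Proof.
apply/matrixP => u v; rewrite !mxE /= coefD coefXM /= coefMn coef1 mul0rn.
by rewrite add0r coefC.
Qed.

Lemma curve_D0 : curve_D`_0 = 1.
Proof.
rewrite /curve_D -horner_coef0 horner_prod big1 // => i _.
rewrite -[LHS]/(horner_eval 0 (\det (curve_g i))) -det_map_mx.
rewrite -(det1 R (n i)) -(curve_g0 i); congr (\det _).
apply/matrixP => u v; rewrite [LHS]mxE [RHS]mxE.
by rewrite /= /horner_eval horner_coef0.
Qed.

Lemma curve_x0 a : map_mx (coefp 0) (curve_x a) = M a.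
Proof.
move: (curve_gx a); move: (curve_x a) => y /(congr1 (map_mx (coefp 0))).
rewrite coefp0_mulmx curve_g0 mul1mx coefp0_scalemx curve_D0 scale1r.
rewrite coefp0_mulmx curve_g0 mulmx1 => ->.
by apply/matrixP => u v; rewrite !mxE /= coefC.
Qed.

(** The first-order term of the conjugate of [M], after removal of the contribution of the
    denominator [curve_D]. *)
Lemma curve_x1 a : map_mx (coefp 1) (curve_x a) - curve_D`_1 *: M a =
  - (X (src a) *m M a - M a *m X (tgt a)).
Proof.
move: (curve_gx a) (curve_x0 a).
move: (curve_x a) => y /(congr1 (map_mx (coefp 1))) + y0.
have M0 : map_mx (coefp 0) (map_mx polyC (M a)) = M a.
  by apply/matrixP => u v; rewrite !mxE /= coefC.
have M1 : map_mx (coefp 1) (map_mx polyC (M a)) = 0.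
  by apply/matrixP => u v; rewrite !mxE /= coefC.
rewrite coefp1_scalemx !coefp1_mulmx coefp0_mulmx !curve_g0 !curve_g1 y0.
rewrite curve_D0 M0 M1 mul1mx !mulmx1 addr0 scale1r => /eqP.
by rewrite -subr_eq => /eqP <-; rewrite opprB addrAC addrK.
Qed.
End Curve.

Section OrbitIdeal.
Variables (F : fieldType) (Q : quiver) (n : dimvec Q) (M : rep F n).

(* The ideal of the closure of the orbit of [M]. *)
Definition Orb_ideal (q : {mpoly F[ncoord n]}) :=
  forall (A : kalg F) (g h : forall i, 'M[A]_(n i)) (x : rep A n),
    (forall i, g i *m h i = 1%:M) -> (forall i, h i *m g i = 1%:M) ->
    (forall a, g (src a) *m x a = map_mx (kstr A) (M a) *m g (tgt a)) ->
    repev x q = 0.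

Lemma Orb_ideal_ideal : is_ideal Orb_ideal.
Proof.
split.
- by move=> A g h x _ _ _; rewrite /repev rmorph0.
- move=> p q pI qI A g h x gh hg gx.
  by rewrite /repev mmapD -!/(repev x _) (pI A g h) ?(qI A g h) ?addr0.
- move=> p q qI A g h x gh hg gx.
  by rewrite /repev rmorphM /= -!/(repev x _) (qI A g h) ?mulr0.
Qed.

Local Notation r := (\rank (ad_mx M M)).

(** One-sided inverses of the two factors of a rank factorization; they stand for the choice of a
    nonvanishing minor, normalized to the identity. *)
Lemma ad_mx_section : exists (Rm : 'M[F]_(r, ngl n)) (Cm : 'M[F]_(ncoord n, r)),
  Rm *m ad_mx M M *m Cm = 1%:M.
Proof.
have /row_fullP [Rm RmP] := col_base_full (ad_mx M M).
have /row_freeP [Cm CmP] := row_base_free (ad_mx M M).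
exists Rm, Cm.
have /= <- := congr1 (fun Z => Rm *m Z *m Cm) (mulmx_base (ad_mx M M)).
by rewrite mulmxA RmP mul1mx CmP.
Qed.

End OrbitIdeal.

Section CurveCoordinates.
Variables (R : comNzRingType) (Q : quiver) (n : dimvec Q) (M : rep R n).
Variables (r : nat) (X : 'rV[R]_(ngl n)) (C : 'M[R]_(ncoord n, r)).

Definition curve_Y : 'rV[{poly R}]_r :=
  (rvec (curve_x M (gmat X)) - curve_D (gmat X) *: rvec (map_rep polyC M))
    *m map_mx polyC C.

Let map0C : map_mx (coefp 0) (map_mx polyC C) = C.
Proof. by apply/matrixP => u v; rewrite !mxE /= coefC. Qed.

Let map1C : map_mx (coefp 1) (map_mx polyC C) = 0.
Proof. by apply/matrixP => u v; rewrite !mxE /= coefC. Qed.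

Lemma curve_Y0 : map_mx (coefp 0) curve_Y = 0.
Proof.
rewrite /curve_Y coefp0_mulmx map0C [X in X *m _](_ : _ = 0) ?mul0mx //.
apply/rowP => l; rewrite !mxE /= coefB coef0M curve_D0 mul1r.
rewrite /rep_coords; case: (enum_val l) => a [u v] /=.
by have /matrixP /(_ u v) := curve_x0 M (gmat X) a; rewrite !mxE /= coefC => ->;
  rewrite subrr.
Qed.

Lemma curve_Y1 : map_mx (coefp 1) curve_Y = - (X *m ad_mx M M *m C).
Proof.
rewrite /curve_Y coefp1_mulmx map0C map1C mulmx0 add0r mul_ad_mx -mulNmx.
congr (_ *m _); apply/rowP => l; rewrite !mxE /= coefB.
rewrite coefM !big_ord_recl big_ord0 /= addr0 curve_D0 mul1r.
rewrite /rep_coords; case: (enum_val l) => a [u v] /=.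
have /matrixP /(_ u v) := curve_x1 M (gmat X) a; rewrite !mxE /= => <-.
by rewrite !coefC add0r.
Qed.
End CurveCoordinates.

Section OrbitGrowth.
Variables (F : fieldType) (Q : quiver) (n : dimvec Q) (M : rep F n).
Local Notation r := (\rank (ad_mx M M)).
Local Notation C := (@mpolyC r F).
Local Notation E := {fraction {poly {mpoly F[r]}}}.

Definition frac_alg : kalg F := KAlg (@tofrac {poly {mpoly F[r]}} \o
  (@polyC {mpoly F[r]} \o C) : {rmorphism F -> E}).

(** The direction [X] is the combination of the rows of [Rm] with indeterminate coefficients. By the
    hypothesis on [Rm] and [Cm], the coordinates selected by [Cm] then start with exactly [- 'X_i]
    in first order. *)
Lemma orbit_curve (Rm : 'M[F]_(r, ngl n)) (Cm : 'M[F]_(ncoord n, r)) :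
  Rm *m ad_mx M M *m Cm = 1%:M ->
  exists (D : {poly {mpoly F[r]}}) (Y : 'I_r -> {poly {mpoly F[r]}}),
  [/\ D`_0 = 1, forall i, (Y i)`_0 = 0, forall i, (Y i)`_1 = - 'X_i &
  exists x : rep frac_alg n,
  (forall q, Orb_ideal M q -> repev x q = 0) /\
  forall i, \sum_l kstr frac_alg (Cm l i) *
      (rep_coords x l - kstr frac_alg (rep_coords M l)) =
    tofrac (Y i) / tofrac D].
Proof.
move=> RC; pose X : 'rV[{mpoly F[r]}]_(ngl n) := (\row_j 'X_j) *m map_mx C Rm.
pose MR : rep {mpoly F[r]} n := map_rep C M.
pose D := curve_D (gmat X).
pose Y := curve_Y MR X (map_mx C Cm).
have D0 : D`_0 = 1 := curve_D0 _.
exists D, (Y 0); split=> //.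
- move=> i; have /rowP /(_ i) := curve_Y0 MR X (map_mx C Cm).
  by rewrite [LHS]mxE [RHS]mxE.
- move=> i; have /rowP /(_ i) := curve_Y1 MR X (map_mx C Cm).
  have -> : X *m ad_mx MR MR *m map_mx C Cm = \row_j 'X_j.
    by rewrite /MR -ad_mx_map -!mulmxA -!map_mxM mulmxA RC map_mx1 mulmx1.
  by rewrite [LHS]mxE /= => e; rewrite [LHS]e !mxE.
pose A := frac_alg; pose fr : {rmorphism {poly {mpoly F[r]}} -> E} := @tofrac _.
have Dn0 : fr D != 0.
  rewrite tofrac_eq0; apply/eqP => DD; move/eqP: D0.
  by rewrite DD coef0 eq_sym oner_eq0.
pose g i : 'M[E]_(n i) := map_mx fr (curve_g (gmat X) i).
have gu i : \det (g i) \in GRing.unit.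
  rewrite unitfE; apply: contraNneq Dn0 => e.
  by rewrite /D /curve_D (bigD1 i) //= rmorphM /= -det_map_mx e mul0r.
pose h i := (\det (g i))^-1 *: \adj (g i).
have hg i : h i *m g i = 1%:M by apply: (mulmx_det_unit (mulVr (gu i))).2.
have gh i : g i *m h i = 1%:M by apply: (mulmx_det_unit (mulVr (gu i))).1.
pose x : rep A n := fun a => (fr D)^-1 *: map_mx fr (curve_x MR (gmat X) a).
exists x; split.
  move=> q qO; apply: (qO A g h x gh hg) => a.
  rewrite /x -scalemxAr -map_mxM curve_gx map_mxZ scalerA mulVf // scale1r.
  by rewrite map_mxM; congr (_ *m _); apply/matrixP => u v; rewrite !mxE.
move=> i; rewrite /Y /curve_Y mxE rmorph_sum mulr_suml /=; apply: eq_bigr => l _.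
rewrite tofracM [RHS]mulrAC [LHS]mulrC; congr (_ * _); last by rewrite !mxE.
rewrite -/(fr _) !mxE rmorphB rmorphM /= mulrBl; congr (_ - _).
  rewrite /rep_coords /x [LHS]mxE [LHS]mulrC; congr (_ * _).
  by rewrite [LHS]mxE.
by rewrite mulrAC mulfV // mul1r /rep_coords !mxE.
Qed.

(** The witnesses are the monomials with exponents below [m] in the [r] affine functions [l i],
    whose values on the curve are [Y i / D]. Their degree is at most [r * m] and [msize] adds one,
    hence the constant [r.+1]. *)
Lemma Orb_growth : growth (Orb_ideal M) r.
Proof.
have [Rm [Cm RC]] := ad_mx_section M.
have [D [Y [D0 Y0 Y1 [x [xO xY]]]]] := orbit_curve RC.
exists r.+1 => m m0.
pose l i : {mpoly F[ncoord n]} :=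
  \sum_k Cm k i *: ('X_k - (rep_coords M k)%:MP).
have l2 i : (msize (l i) <= 2)%N.
  apply: leq_trans (mmeasure_sum _ _ _ _) _; apply/bigmax_leqP => k _.
  apply: leq_trans (msizeZ_le _ _) _; apply: leq_trans (mmeasureD_le _ _ _) _.
  by rewrite geq_max mmeasureN msizeX mdeg1 mmeasureC; case: eqP.
pose u (al : {ffun 'I_r -> 'I_m}) := \prod_i l i ^+ al i.
have -> : (m ^ r)%N = #|{: {ffun 'I_r -> 'I_m}}| by rewrite card_ffun !card_ord.
exists (fun j => u (enum_val j)); split=> [j|c /xO].
  apply: leq_trans (msize_prod_le _ l2) _; rewrite mulSn -add1n leq_add //.
  rewrite -[r in (r * m)%N]card_ord -sum_nat_const.
  by apply: leq_sum => i _; apply: ltnW.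
rewrite /repev raddf_sum /= => e j; rewrite -(enum_valK j).
pose c' al := c (enum_rank al); rewrite -/(c' (enum_val j)).
apply: (tangent_indep D0 Y0 Y1); rewrite -[RHS]e.
rewrite (reindex (enum_val : 'I_#|{: {ffun 'I_r -> 'I_m}}| -> _)) /=; last first.
  by apply: onW_bij; exact: enum_val_bij.
apply: eq_bigr => k _; rewrite mmapZ /c' enum_valK; congr (_ * _).
rewrite /u rmorph_prod; apply: eq_bigr => i _; rewrite rmorphXn -xY /=.
congr (_ ^+ _); rewrite /l raddf_sum /=; apply: eq_bigr => k' _.
by rewrite mmapZ mmapB mmapX mmap1U mmapC.
Qed.
End OrbitGrowth.

(** * Conjugating [A_d] to [M] near [M] *)

Section ParOrb.
Variables (F : fieldType) (Q : quiver) (d : filtration Q).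
Local Notation n := (ftop d).
Variable M : rep F n.
Hypothesis MPar : forall q, Par_ideal q -> repev (A := selfalg F) M q = 0.

(* Conjugation by an invertible [g] over [A] preserves [Par_ideal]; so [q]
   composed with it is an [A]-combination of elements of [Par_ideal]. *)
Lemma Par_sub_Orb q : Par_ideal q -> Orb_ideal M q.
Proof.
move=> qI A g h x gh hg gx.
pose SA : kalg F := KAlg (@mpolyC (ncoord n) A \o kstr A :
  {rmorphism F -> {mpoly A[ncoord n]}}).
pose Cp : {rmorphism A -> {mpoly A[ncoord n]}} := @mpolyC (ncoord n) A.
pose z : rep {mpoly A[ncoord n]} n := rmat (\row_l 'X_l).
pose y : rep SA n :=
  fun a => map_mx Cp (h (src a)) *m z a *m map_mx Cp (g (tgt a)).
pose q' : {mpoly A[ncoord n]} := repev y q.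
have ev_q' (B : comNzRingType) (f : {rmorphism A -> B}) (w : rep B n) :
    mmap f (rep_coords w) q' =
    repev (A := KAlg (f \o kstr A : {rmorphism F -> B}))
      (fun a => map_mx f (h (src a)) *m w a *m map_mx f (g (tgt a))) q.
  pose B' := KAlg (f \o kstr A : {rmorphism F -> B}).
  have ek c : mmap f (rep_coords w) (kstr SA c) = kstr B' c by exact: mmapC.
  pose phi : kalg_hom SA B' := @KAlgHom F SA B' (mmap f (rep_coords w)) ek.
  rewrite -[LHS]/(phi q') repev_map; apply: (eq_repev (A := B')) => a.
  rewrite /map_rep !map_mxM; congr (_ *m _ *m _).
  - by apply/matrixP => u v; rewrite !mxE /=; exact: mmapC.
  - apply/matrixP => u v; rewrite !mxE /= mmapX mmap1U.
    by rewrite /rep_coords enum_rankK.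
  - by apply/matrixP => u v; rewrite !mxE /=; exact: mmapC.
have MA p : Par_ideal p -> repev (A := A) (map_rep (kstr A) M) p = 0.
  move=> /MPar Mp; pose k : kalg_hom (selfalg F) A :=
    @KAlgHom F (selfalg F) A (kstr A) (fun c => erefl).
  by rewrite -[LHS]/(repev (map_rep k M) p) -repev_map Mp rmorph0.
have := Par_base_change MA (q := q').
rewrite ev_q' => e; rewrite -[RHS]e.
  have e1 a : x a = map_mx idfun (h (src a)) *m map_rep (kstr A) M a *m
      map_mx idfun (g (tgt a)).
    by rewrite !map_mx_id // -mulmxA -gx mulmxA hg mul1mx.
  rewrite /repev; congr (mmap _ _ q); exact: eq_rep_coords.
move=> B f g' T tT; rewrite ev_q'.
pose B' := KAlg (f \o kstr A : {rmorphism F -> B}).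
have hE i : map_mx f (h i) = \det (map_mx f (h i)) *: \adj (map_mx f (g i)).
  have hg1 : map_mx f (h i) *m map_mx f (g i) = 1%:M by rewrite -map_mxM hg map_mx1.
  have dd : \det (map_mx f (h i)) * \det (map_mx f (g i)) = 1.
    by rewrite -det_mulmx hg1 det1.
  have gh1 : map_mx f (g i) *m map_mx f (h i) = 1%:M by rewrite -map_mxM gh map_mx1.
  rewrite -[\adj _]mulmx1 -gh1 mulmxA mul_adj_mx mul_scalar_mx scalerA dd.
  by rewrite scale1r.
(* The inverse [h] is [\adj g] up to this scalar. With the scalar absorbed in [T], the conjugate of
   a value of [par] is again one, for the product [g' *m g]. *)
pose c a := \det (map_mx f (h (src a))).
rewrite -(qI B' (fun i => g' i *m map_mx f (g i)) (fun a => c a *: T a) (triZ c tT)).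
apply: (eq_repev (A := B')) => a; rewrite /par adj_mulmx hE.
by rewrite -!scalemxAl -!scalemxAr -!scalemxAl !mulmxA.
Qed.
End ParOrb.

Section KeyPolynomials.
Variables (F : fieldType) (Q : quiver) (d : filtration Q).
Local Notation n := (ftop d).
Variable M : rep F n.
Local Notation r := (\rank (ad_mx M M)).

(* [Rm] and [Cm] select a minor of [ad_mx M x] which is [1] at [x = M]; the
   entries of [delta *: L - L *m Cm *m \adj (Rm *m L *m Cm) *m Rm *m L] vanish when
   [L] has a factorization of inner dimension [r]. *)
Definition minor_proj (R : comNzRingType) (Rm : 'M[R]_(r, ngl n))
    (Cm : 'M[R]_(ncoord n, r)) (L : 'M[R]_(ngl n, ncoord n)) : 'M[R]_(ngl n) :=
  (\det (Rm *m L *m Cm))%:M - L *m Cm *m \adj (Rm *m L *m Cm) *m Rm.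

Lemma minor_proj_map (R S : comNzRingType) (f : {rmorphism R -> S}) Rm Cm L :
  map_mx f (@minor_proj R Rm Cm L) =
  minor_proj (map_mx f Rm) (map_mx f Cm) (map_mx f L).
Proof.
by rewrite /minor_proj map_mxB map_scalar_mx -det_map_mx !map_mxM map_mx_adj !map_mxM.
Qed.

(** The minor is a product of two square matrices of size [r], so its adjugate splits and each
    factor meets its own matrix. *)
Lemma minor_proj_mul (R : comNzRingType) Rm Cm (U : 'M[R]_(ngl n, r))
    (V : 'M_(r, ncoord n)) :
  minor_proj Rm Cm (U *m V) *m (U *m V) = 0.
Proof.
rewrite /minor_proj.
have -> : Rm *m (U *m V) *m Cm = (Rm *m U) *m (V *m Cm) by rewrite !mulmxA.
rewrite adj_mulmx det_mulmx mulmxBl mul_scalar_mx.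
have -> : U *m V *m Cm *m (\adj (V *m Cm) *m \adj (Rm *m U)) *m Rm *m (U *m V) =
    U *m ((V *m Cm) *m \adj (V *m Cm)) *m (\adj (Rm *m U) *m (Rm *m U)) *m V.
  by rewrite !mulmxA.
rewrite mul_mx_adj mul_adj_mx mul_mx_scalar -!scalemxAl mul_mx_scalar -!scalemxAl.
by rewrite scalerA mulrC subrr.
Qed.

(* For [x] in the orbit of [M], the map [X |-> X x - M X] is equivalent to its value
   at [x = M]. *)
Lemma ad_mx_orbit (R : comNzRingType) (f : {rmorphism F -> R}) (x : rep R n)
    (g h : forall i, 'M[R]_(n i)) :
  (forall i, g i *m h i = 1%:M) -> (forall i, h i *m g i = 1%:M) ->
  (forall a, g (src a) *m x a = map_mx f (M a) *m g (tgt a)) ->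
  exists (U : 'M[R]_(ngl n, r)) (V : 'M_(r, ncoord n)),
    ad_mx (map_rep f M) x = U *m V.
Proof.
move=> gh hg gx.
pose G1 (X : 'rV[R]_(ngl n)) := gvec (fun i => gmat X i *m h i).
pose G2 (v : 'rV[R]_(ncoord n)) := rvec (fun a => rmat v a *m g (tgt a)).
have lin1 : linear G1.
  move=> c X Y; apply/rowP => l; rewrite !mxE /= gmat_is_linear mulmxDl.
  by rewrite -scalemxAl !mxE.
have lin2 : linear G2.
  move=> c X Y; apply/rowP => l; rewrite !mxE /rep_coords.
  set a := enum_val l; have -> : rmat (c *: X + Y) (tag a) =
      c *: rmat X (tag a) + rmat Y (tag a).
    by apply/matrixP => u v; rewrite !mxE.
  by rewrite mulmxDl -scalemxAl !mxE.
pose L1 : {linear _ -> _} := HB.pack G1 (GRing.isLinear.Build R _ _ _ G1 lin1).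
pose L2 : {linear _ -> _} := HB.pack G2 (GRing.isLinear.Build R _ _ _ G2 lin2).
have E : ad_mx (map_rep f M) x =
    lin1_mx L1 *m ad_mx (map_rep f M) (map_rep f M) *m lin1_mx L2.
  apply/row_matrixP => l; rewrite !rowE !mulmxA (mul_rV_lin1 L1) !mul_ad_mx.
  rewrite (mul_rV_lin1 L2) /= /G2 /adv; set X := delta_mx 0 l.
  apply: eq_rvec => a; rewrite rvecK /G1 !gvecK mulmxBl -!mulmxA hg mulmx1.
  by congr (_ - _); rewrite /map_rep -gx (mulmxA (h _)) hg mul1mx.
have := mulmx_base (ad_mx M M) => /(congr1 (map_mx f)).
rewrite map_mxM ad_mx_map => e.
exists (lin1_mx L1 *m map_mx f (col_base (ad_mx M M))),
  (map_mx f (row_base (ad_mx M M)) *m lin1_mx L2).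
by rewrite E -e !mulmxA.
Qed.

Hypothesis MPar : forall q, Par_ideal q -> repev (A := selfalg F) M q = 0.
Hypothesis dimPar : ~ growth (@Par_ideal Q d F) r.+1.

(** A function in [Orb_ideal M] but outside the prime [Par_ideal] would raise the growth of the
    latter to [r.+1]. *)
Lemma Orb_sub_Par q : Orb_ideal M q -> Par_ideal q.
Proof.
move=> qO; apply: boolp.contrapT => qP; apply: dimPar.
apply: (growth_step (@Par_ideal_prime Q d F) (Orb_ideal_ideal M) _ qO qP).
  exact: Par_sub_Orb.
exact: Orb_growth.
Qed.

(** The tuple [X] is the identity tuple [w] multiplied by [minor_proj] at the generic [x]. The
    product of [minor_proj] and [ad_mx] vanishes on the orbit, hence on all points of the closure,
    which puts [X] in the kernel of [ad_mx]. At [x = M] the identity commutes with [M], and [w] is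
    left unchanged. *)
Lemma key_polynomials :
  exists X : forall i, 'M[{mpoly F[ncoord n]}]_(n i),
    (forall i, map_mx (mmap idfun (rep_coords M)) (X i) = 1%:M) /\
    forall (A : kalg F) (x : rep A n),
      (forall q, Par_ideal q -> repev x q = 0) -> forall a,
      map_mx (mmap (kstr A) (rep_coords x)) (X (src a)) *m x a =
      map_mx (kstr A) (M a) *m map_mx (mmap (kstr A) (rep_coords x)) (X (tgt a)).
Proof.
have [Rm [Cm RC]] := ad_mx_section M.
pose C : {rmorphism F -> {mpoly F[ncoord n]}} := @mpolyC (ncoord n) F.
pose z : rep {mpoly F[ncoord n]} n := rmat (\row_l 'X_l).
pose P := minor_proj (map_mx C Rm) (map_mx C Cm) (ad_mx (map_rep C M) z).
pose w : 'rV[F]_(ngl n) := gvec (fun i => 1%:M).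
pose X := gmat (map_mx C w *m P).
have evz (A : kalg F) (x : rep A n) a :
    map_mx (mmap (kstr A) (rep_coords x)) (z a) = x a.
  apply/matrixP => u v; rewrite !mxE /= mmapX mmap1U.
  by rewrite /rep_coords enum_rankK.
have evC (A : kalg F) (x : rep A n) m1 m2 (U : 'M[F]_(m1, m2)) :
    map_mx (mmap (kstr A) (rep_coords x)) (map_mx C U) = map_mx (kstr A) U.
  by apply/matrixP => u v; rewrite !mxE /=; exact: mmapC.
have adE (A : kalg F) (x : rep A n) :
    map_mx (mmap (kstr A) (rep_coords x)) (ad_mx (map_rep C M) z) =
    ad_mx (map_rep (kstr A) M) x.
  rewrite ad_mx_map; congr lin1_mx; apply: functional_extensionality => Y.
  by rewrite /adv; apply: eq_rvec => a; rewrite /map_rep evz !evC.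
have evP (A : kalg F) (x : rep A n) :
    map_mx (mmap (kstr A) (rep_coords x)) P =
    minor_proj (map_mx (kstr A) Rm) (map_mx (kstr A) Cm) (ad_mx (map_rep (kstr A) M) x).
  by rewrite minor_proj_map adE !evC.
have evX (A : kalg F) (x : rep A n) i :
    map_mx (mmap (kstr A) (rep_coords x)) (X i) =
    gmat (map_mx (kstr A) w *m map_mx (mmap (kstr A) (rep_coords x)) P) i.
  by rewrite /X gmat_map map_mxM evC.
exists X; split=> [i|A x xP a].
  have := evX (selfalg F) M i; rewrite evP /= => ->.
  rewrite !map_mx_id // /minor_proj.
  have -> : ad_mx (map_rep idfun M) M = ad_mx M M.
    congr lin1_mx; apply: functional_extensionality => Y; apply: eq_rvec => a.
    by rewrite /map_rep map_mx_id.
  rewrite RC det1 mulmxBr mulmx1 !mulmxA mul_ad_mx.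
  have -> : adv M M w = 0.
    apply/rowP => l; rewrite !mxE /rep_coords /w !gvecK mul1mx mulmx1 subrr.
    by rewrite mxE.
  by rewrite !mul0mx subr0 gvecK.
have PL0 : map_mx (mmap (kstr A) (rep_coords x)) P *m ad_mx (map_rep (kstr A) M) x = 0.
  rewrite -adE -map_mxM; apply/matrixP => u v; rewrite mxE [RHS]mxE.
  apply: xP; apply: Orb_sub_Par => B g h y gh hg gy.
  have [U [V UV]] := ad_mx_orbit gh hg gy.
  have : map_mx (mmap (kstr B) (rep_coords y)) (P *m ad_mx (map_rep C M) z) = 0.
    by rewrite map_mxM evP adE UV minor_proj_mul.
  by move/matrixP/(_ u v); rewrite mxE [RHS]mxE.
have := congr1 (mulmx (map_mx (kstr A) w)) PL0; rewrite mulmxA mulmx0 mul_ad_mx.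
move=> e; have : rmat (adv (map_rep (kstr A) M) x
    (map_mx (kstr A) w *m map_mx (mmap (kstr A) (rep_coords x)) P)) a = 0.
  by rewrite e; apply/matrixP => u v; rewrite !mxE.
rewrite rvecK -!evX => /eqP; rewrite subr_eq0 => /eqP; exact.
Qed.
End KeyPolynomials.

(** * Formal smoothness *)

(** Here [e] is divisible by [x ^+ N] and [1 - e] by [(1 - x) ^+ N], so [e * (1 - e)] vanishes. As
    [x] divides [e] on either side, [e] stays in any corner containing [x]. The ring may be zero,
    since matrices of size 0 occur. *)
Lemma idempotent_of (S : pzRingType) (x : S) N (e := 1 - (1 - x ^+ N) ^+ N) :
  (0 < N)%N -> (x * (1 - x)) ^+ N = 0 ->
  [/\ e * e = e, forall z, z * x = x -> z * e = e
    & forall z, x * z = x -> e * z = e].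
Proof.
move=> N0 xN; pose y := 1 - x ^+ N.
pose S1 := \sum_(i < N) y ^+ i; pose S2 := \sum_(i < N) x ^+ i.
have comm_sum (a b : S) : GRing.comm a b -> GRing.comm a (\sum_(i < N) b ^+ i).
  by move=> ab; apply: commr_sum => i _; apply: commrX.
have xy : GRing.comm x y by apply: commrB; [exact: commr1 | exact: commrX].
have eS1 : e = x ^+ N * S1.
  have := subrX1 y N; rewrite -/S1 => h.
  by rewrite /e -/y -opprB h -mulNr opprB /y opprB addrC subrK.
have yS2 : y = (1 - x) * S2 by rewrite /y -opprB subrX1 -mulNr opprB.
have x1S2 : GRing.comm (1 - x) S2.
  apply: comm_sum; apply: commr_sym; apply: commrB; first exact: commr1.
  exact: commr_refl.
have xS1 : GRing.comm x S1 by apply: comm_sum.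
have xNS1 : GRing.comm (x ^+ N) S1.
  by apply: commr_sym; apply: commrX; apply: commr_sym.
have x1x : GRing.comm x (1 - x).
  by apply: commrB; [exact: commr1 | exact: commr_refl].
have ee : e * (1 - e) = 0.
  have -> : 1 - e = y ^+ N by rewrite /e -/y opprB addrC subrK.
  rewrite eS1 xNS1 yS2 exprMn_comm // -!mulrA (mulrA (x ^+ N)).
  by rewrite -exprMn_comm // xN mul0r mulr0.
split.
- by apply/esym/eqP; rewrite -subr_eq0 -{1}[e]mulr1 -mulrBr ee.
- move=> z zx; rewrite eS1 mulrA -(prednK N0) exprS.
  by rewrite (mulrA z) zx.
- move=> z xz; rewrite eS1 xNS1 -mulrA -(prednK N0) exprSr.
  by rewrite -(mulrA _ x z) xz.
Qed.

Lemma idempotent_of_id (S : pzRingType) (x : S) N : (0 < N)%N -> x * x = x ->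
  1 - (1 - x ^+ N) ^+ N = x.
Proof.
move=> N0 xx; have id (y : S) : y * y = y -> y ^+ N = y.
  move=> yy; rewrite -(prednK N0); elim: (N.-1) => [|k IH]; first exact: expr1.
  by rewrite exprS IH.
have yy : (1 - x) * (1 - x) = 1 - x.
  by rewrite mulrBr mulr1 mulrBl mul1r xx subrr subr0.
by rewrite (id x xx) (id _ yy) opprB addrC subrK.
Qed.

Section Lifting.
Variables (A B : comNzRingType) (f : {rmorphism A -> B}).
Hypothesis fsurj : forall b, exists a, f a = b.
Variable N : nat.
Hypothesis fnil : forall a : 'I_N -> A, (forall j, f (a j) = 0) ->
  \prod_(j < N) a j = 0.

Lemma nil_order_gt0 : (0 < N)%N.
Proof.
rewrite lt0n; apply/eqP => N0; move: fnil; rewrite N0 => /(_ (fun=> 0)) h.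
by have := h (fun j => rmorph0 f); rewrite big_ord0 => /eqP; rewrite oner_eq0.
Qed.

Lemma nil_mx n (U : 'M[A]_n) : map_mx f U = 0 -> U ^+ N = 0.
Proof.
move=> U0; have fU i j : f (U i j) = 0 by have /matrixP/(_ i j) := U0; rewrite !mxE.
(* Entries of [U ^+ k] kill all products of [N - k] elements of the kernel. *)
pose P k (a : A) := forall s : seq A, (size s + k = N)%N ->
  (forall x, x \in s -> f x = 0) -> a * \prod_(x <- s) x = 0.
have Pk k : (k <= N)%N -> forall i j, P k ((U ^+ k) i j).
  elim: k => [_ i j s|k IH kN i j s sN s0].
    rewrite addn0 => sN s0; suff -> : \prod_(x <- s) x = 0 by rewrite mulr0.
    rewrite (big_nth 0) sN big_mkord; apply: fnil => l; apply: s0.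
    by rewrite mem_nth // sN.
  rewrite exprS mxE mulr_suml big1 // => l _.
  have /(_ (U i l :: s)) := IH (ltnW kN) l j; rewrite big_cons mulrCA mulrA.
  apply; first by rewrite /= addSnnS.
  by move=> x; rewrite inE => /orP [/eqP ->|/s0].
apply/matrixP => i j; rewrite [RHS]mxE.
have /(_ [::]) := Pk N (leqnn N) i j; rewrite big_nil mulr1; apply => //.
Qed.

Lemma ker_field (L : fieldType) (g : {rmorphism A -> L}) a : f a = 0 -> g a = 0.
Proof.
move=> fa; have := fnil (a := fun=> a) (fun=> fa).
rewrite prodr_const card_ord => /(congr1 g) /eqP.
by rewrite rmorphXn rmorph0 expf_eq0 => /andP [_ /eqP].
Qed.

(** Fields do not see the nilpotent kernel; ranks and units over [A] can therefore be checked over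
    [B]. *)
Lemma factor_field (L : fieldType) (g : {rmorphism A -> L}) :
  exists h : {rmorphism B -> L}, forall a, h (f a) = g a.
Proof.
have [s sP] := boolp.choice fsurj; pose h b := g (s b).
have hf a : h (f a) = g a.
  apply/eqP; rewrite -subr_eq0 -rmorphB; apply/eqP/ker_field.
  by rewrite rmorphB sP subrr.
have hB : zmod_morphism h by move=> x y; rewrite -{1}(sP x) -{1}(sP y) -rmorphB hf rmorphB.
have hM : monoid_morphism h.
  split; first by rewrite -(rmorph1 f) hf rmorph1.
  by move=> x y; rewrite -{1}(sP x) -{1}(sP y) -rmorphM hf rmorphM.
pose H : {rmorphism B -> L} := HB.pack h (GRing.isZmodMorphism.Build B L h hB)
  (GRing.isMonoidMorphism.Build B L h hM).
by exists H.
Qed.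

Lemma lift_mx m n (V : 'M[B]_(m, n)) : exists U, map_mx f U = V.
Proof.
have [s sP] := boolp.choice fsurj; exists (map_mx s V).
by apply/matrixP => i j; rewrite !mxE sP.
Qed.

Lemma map_mxX n (U : 'M[A]_n) k : map_mx f (U ^+ k) = (map_mx f U) ^+ k.
Proof.
elim: k => [|k IH]; first by rewrite !expr0 map_mx1.
by rewrite !exprS map_mxM IH.
Qed.

(** An arbitrary lift is cut down to the corner of [E], then corrected by [idempotent_of], which
    does not leave the corner. *)
Lemma idempotent_lift n (E : 'M[A]_n) (eb : 'M[B]_n) : E *m E = E ->
  eb *m eb = eb -> map_mx f E *m eb = eb -> eb *m map_mx f E = eb ->
  exists e, [/\ e *m e = e, E *m e = e, e *m E = e & map_mx f e = eb].
Proof.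
move=> EE ee Ee eE; have [x0 fx0] := lift_mx eb; pose x := E *m x0 *m E.
have fx : map_mx f x = eb by rewrite !map_mxM fx0 Ee eE.
have xnil : (x * (1 - x)) ^+ N = 0.
  by apply: nil_mx; rewrite map_mxM map_mxB map_mx1 fx mulmxBr mulmx1 ee subrr.
have [e1 e2 e3] := idempotent_of nil_order_gt0 xnil.
exists (1 - (1 - x ^+ N) ^+ N); split => //.
- by apply: e2; rewrite /x -mulmxE !mulmxA EE.
- by apply: e3; rewrite /x -mulmxE -!mulmxA EE.
rewrite map_mxB map_mx1 map_mxX map_mxB map_mx1 map_mxX fx.
exact: (idempotent_of_id nil_order_gt0).
Qed.

(** The lift descends from the largest projector: each next one is lifted inside the corner of its
    predecessor, which secures both product relations. *)
Lemma commuting_chain_lift n m (eb : nat -> 'M[B]_n) (E : 'M[A]_n) :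
  (forall k l, (k <= l)%N -> (l <= m)%N ->
    eb k *m eb l = eb k /\ eb l *m eb k = eb k) ->
  E *m E = E -> map_mx f E = eb m ->
  exists e : nat -> 'M[A]_n, [/\ forall k l, (k <= l)%N -> (l <= m)%N ->
      e k *m e l = e k /\ e l *m e k = e k, e m = E
    & forall k, (k <= m)%N -> map_mx f (e k) = eb k].
Proof.
elim: m E => [|m IH] E ech EE fE.
  exists (fun=> E); split=> // k; rewrite leqn0 => /eqP ->; exact: fE.
have [e1 e2] := ech m m.+1 (leqnSn m) (leqnn _).
have [emm _] := ech m m (leqnn m) (leqnSn m).
have Ee : map_mx f E *m eb m = eb m by rewrite fE.
have eE : eb m *m map_mx f E = eb m by rewrite fE.
have [E' [E'E' EE' E'E fE']] := idempotent_lift EE emm Ee eE.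
have [|e [ech' em fe]] := IH E' _ E'E' fE'.
  by move=> k l kl lm; apply: ech => //; apply: leqW.
exists (fun k => if (k <= m)%N then e k else E); split.
- move=> k l kl lm1; case: (leqP l m) => lm.
    by rewrite (leq_trans kl lm); apply: ech'.
  case: (leqP k m) => km; last by rewrite EE.
  have [k1 k2] := ech' k m km (leqnn m); rewrite em in k1 k2.
  by rewrite -k1 -mulmxA E'E k1; split=> //; rewrite -{1}k2 mulmxA EE' k2.
- by rewrite ltnn.
- move=> k km1; case: (leqP k m) => km; first exact: fe.
  by rewrite (_ : k = m.+1) //; apply/eqP; rewrite eqn_leq km1.
Qed.
End Lifting.

Section RepLift.
Variables (Q : quiver) (d : filtration Q).
Local Notation n := (ftop d).
Local Notation nu := (flen d).

(* For a flag of subrepresentations this is [M] itself; in general it makes the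
   flag one of subrepresentations. *)
Definition flag_part (R : comNzRingType) (e : nat -> forall i, 'M[R]_(n i))
    (M : rep R n) : rep R n :=
  fun a => \sum_(k < nu) (e k.+1 (src a) - e k (src a)) *m M a *m e k.+1 (tgt a).

Lemma flag_part_sub (R : comNzRingType) (e : nat -> forall i, 'M[R]_(n i))
    (M : rep R n) : chain (d := d) e -> forall k a, (k <= nu)%N ->
  e k (src a) *m flag_part e M a *m e k (tgt a) = e k (src a) *m flag_part e M a.
Proof.
move=> ce k a knu; rewrite /flag_part mulmx_sumr mulmx_suml.
apply: eq_bigr => l _; rewrite !mulmxA mulmxBr.
(* Terms with [l < k] end in [e l.+1], which absorbs [e k]; the others are killed by [e k] on the
   left. *)
case: (ltnP l k) => lk.
  by rewrite -[LHS]mulmxA (chain_mul ce).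
rewrite !(chain_mul ce) //; last exact: leqW.
  by rewrite subrr !mul0mx.
exact: ltnW.
Qed.

Lemma flag_part_id (R : comNzRingType) (e : nat -> forall i, 'M[R]_(n i))
    (M : rep R n) : chain (d := d) e ->
  (forall k a, (k <= nu)%N ->
    e k (src a) *m M a *m e k (tgt a) = e k (src a) *m M a) ->
  forall a, flag_part e M a = M a.
Proof.
move=> ce eM a; rewrite /flag_part.
transitivity ((\sum_(k < nu) (e k.+1 (src a) - e k (src a))) *m M a).
  rewrite mulmx_suml; apply: eq_bigr => k _.
  have -> : e k.+1 (src a) - e k (src a) =
      (e k.+1 (src a) - e k (src a)) *m e k.+1 (src a).
    by rewrite mulmxBl !(chain_mul ce).
  by rewrite -!mulmxA (mulmxA (e _ _)) eM.
rewrite -(big_mkord xpredT (fun k => e k.+1 (src a) - e k (src a))).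
by rewrite telescope_sumr // (chain0 ce) (chain1 ce) subr0 mul1mx.
Qed.

Lemma flag_part_map (R S : comNzRingType) (f : {rmorphism R -> S})
    (e : nat -> forall i, 'M[R]_(n i)) (M : rep R n) a :
  map_mx f (flag_part e M a) =
  flag_part (fun k i => map_mx f (e k i)) (map_rep f M) a.
Proof.
rewrite /flag_part raddf_sum; apply: eq_bigr => k _ /=.
by rewrite !map_mxM map_mxB.
Qed.
End RepLift.

Section FormalSmoothness.
Variables (F : fieldType) (Q : quiver) (d : filtration Q).
Local Notation n := (ftop d).
Local Notation nu := (flen d).
Variable M : rep F n.
Variable X : forall i, 'M[{mpoly F[ncoord n]}]_(n i).
Hypothesis XM : forall i, map_mx (mmap idfun (rep_coords M)) (X i) = 1%:M.
Hypothesis XP : forall (A : kalg F) (x : rep A n),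
  (forall q, Par_ideal q -> repev x q = 0) -> forall a,
  map_mx (mmap (kstr A) (rep_coords x)) (X (src a)) *m x a =
  map_mx (kstr A) (M a) *m map_mx (mmap (kstr A) (rep_coords x)) (X (tgt a)).

Lemma chain_FlQ_pt (A : kalg F) e : chain (d := d) e ->
  (forall k a, (k <= nu)%N -> e k (src a) *m map_mx (kstr A) (M a) *m e k (tgt a) =
     e k (src a) *m map_mx (kstr A) (M a)) ->
  FlQ_pt M (fun (k : 'I_nu.+1) i => prj (e k i)).
Proof.
move=> ce eM; split; first exact: chain_flag.
apply/(chain_subrep (map_rep (kstr A) M) ce) => k a.
by apply: eM; rewrite -ltnS.
Qed.

Lemma FlQ_pt_chain (A : kalg F) (U : graded_flag d A) : FlQ_pt M U ->
  exists e, [/\ chain (d := d) e, U = fun k i => prj (e k i) &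
    forall k a, (k <= nu)%N -> e k (src a) *m map_mx (kstr A) (M a) *m e k (tgt a) =
     e k (src a) *m map_mx (kstr A) (M a)].
Proof.
case=> flU subU; have [e [ce eU]] := flag_chain flU; rewrite eU in subU.
exists e; split=> // k a knu.
have := (chain_subrep (map_rep (kstr A) M) ce).1 subU (inord k) a.
by rewrite inordK.
Qed.

Lemma FlQ_pt_conj (A : kalg F) (x : rep A n) (e : nat -> forall i, 'M[A]_(n i))
    (g h : forall i, 'M[A]_(n i)) : chain (d := d) e ->
  (forall k a, (k <= nu)%N ->
     e k (src a) *m x a *m e k (tgt a) = e k (src a) *m x a) ->
  (forall i, g i *m h i = 1%:M) -> (forall i, h i *m g i = 1%:M) ->
  (forall a, h (src a) *m x a = map_mx (kstr A) (M a) *m h (tgt a)) ->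
  FlQ_pt M (fun (k : 'I_nu.+1) i => prj (h i *m e k i *m g i)).
Proof.
move=> ce ex gh hg hx; apply: (chain_FlQ_pt (chain_conj gh hg ce)) => k a knu.
have gM : g (src a) *m map_mx (kstr A) (M a) = x a *m g (tgt a).
  rewrite -[LHS]mulmx1 -(hg (tgt a)) -!mulmxA (mulmxA (map_mx _ _)) -hx.
  by rewrite !mulmxA gh mul1mx.
rewrite -!mulmxA (mulmxA (g (src a))) gM -!mulmxA (mulmxA (g (tgt a))) gh mul1mx.
by rewrite !mulmxA -(mulmxA (h (src a))) -(mulmxA (h _)) ex // !mulmxA.
Qed.

Lemma FlQ_eq (A : kalg F) (u v : FlQ M A) :
  (forall (k : 'I_nu.+1) i, sval u k i = sval v k i) -> u = v.
Proof.
move=> uv; apply: eq_sig_hprop => [x|]; first exact: proof_irrelevance.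
apply: functional_extensionality_dep => k.
apply: functional_extensionality_dep => i; exact: uv.
Qed.

Lemma FlQ_formally_smooth : formally_smooth (FlQ M).
Proof.
move=> A B f fsurj [N fnil] [U UP].
have [eb [ceb eU ebM]] := FlQ_pt_chain UP.
have h i : exists e : nat -> 'M[A]_(n i), [/\ forall k l, (k <= l)%N ->
      (l <= nu)%N -> e k *m e l = e k /\ e l *m e k = e k, e nu = 1%:M
    & forall k, (k <= nu)%N -> map_mx f (e k) = eb k i].
  apply: (commuting_chain_lift fsurj fnil) => [k l kl lnu||].
  - by rewrite (chain_mul ceb) // (chain_mul' ceb).
  - by rewrite mulmx1.
  - by rewrite map_mx1 (chain1 ceb).
pose e k i := sval (boolp.cid (h i)) k.
have eP i : [/\ forall k l, (k <= l)%N -> (l <= nu)%N ->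
      e k i *m e l i = e k i /\ e l i *m e k i = e k i, e nu i = 1%:M
    & forall k, (k <= nu)%N -> map_mx f (e k i) = eb k i].
  by rewrite /e; case: boolp.cid.
have fe k i : (k <= nu)%N -> map_mx f (e k i) = eb k i by case: (eP i) => _ _; apply.
have rk (L : fieldType) (g : {rmorphism A -> L}) (k : 'I_nu.+1) i :
    \rank (map_mx g (e k i)) = d k i.
  have [g' g'f] := factor_field fsurj fnil g.
  have knu : (k <= nu)%N by rewrite -ltnS.
  rewrite -(chain_rank ceb g' k i) -(fe k i knu) -map_mx_comp.
  by congr (\rank _); apply/matrixP => u v; rewrite !mxE /= g'f.
have ce : chain (d := d) e.
  split=> // [k l i kl lnu|k l i kl lnu|i|i].
  - by have [/(_ k l kl lnu) []] := eP i.
  - by have [/(_ k l kl lnu) []] := eP i.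
  - apply: idempotent_eq0; first by have [/(_ 0%N 0%N) []] := eP i.
    move=> L g; apply/eqP; rewrite -mxrank_eq0.
    by rewrite (rk L g ord0) fdim0.
  - by have [] := eP i.
pose MA : rep A n := map_rep (kstr A) M.
pose x := flag_part e MA.
have ex := flag_part_sub MA ce.
(* Over [B] the flag already consists of subrepresentations, so [flag_part] changes nothing
   there. *)
have fx a : map_mx f (x a) = map_mx (kstr B) (M a).
  rewrite flag_part_map -[RHS](flag_part_id ceb ebM).
  have fMA : map_rep f MA a = map_mx (kstr B) (M a).
    by apply/matrixP => u v; rewrite !mxE kalg_funP.
  apply: eq_bigr => k _; rewrite fMA.
  by rewrite (fe k.+1) // (fe k.+1) // (fe k) // ltnW.
have xV : forall q, Par_ideal q -> repev x q = 0 := Par_ideal_flag ce ex.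
(* As [x] reduces to [M], this reduces to the identity: it is invertible, and conjugating by it does
   not disturb the lift. *)
pose H i := map_mx (mmap (kstr A) (rep_coords x)) (X i).
have fH i : map_mx f (H i) = 1%:M.
  rewrite -(map_mx1 (kstr B)) -(XM i).
  apply/matrixP => u v; rewrite !mxE mmap_hom.
  have k : forall c, kstr B (kstr (selfalg F) c) = kstr B c by [].
  pose phi : kalg_hom (selfalg F) B := @KAlgHom F (selfalg F) B (kstr B) k.
  transitivity (phi (mmap (kstr (selfalg F)) (rep_coords M) (X i u v))).
    rewrite mmap_hom; congr (mmap _ _ _).
    apply: functional_extensionality => l.
    rewrite -[LHS](rep_coords_map f x l) -[RHS](rep_coords_map phi M l).
    by rewrite (eq_rep_coords fx).
  by [].
have unitH i : exists b, b * \det (H i) = 1.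
  apply: unit_of_fields => L g; have [g' g'f] := factor_field fsurj fnil g.
  by rewrite -g'f -det_map_mx fH det1 rmorph1 oner_eq0.
pose G i := sval (boolp.cid (unitH i)) *: \adj (H i).
have HG i : H i *m G i = 1%:M.
  by rewrite /G; case: boolp.cid => b /= /mulmx_det_unit [].
have GH i : G i *m H i = 1%:M.
  by rewrite /G; case: boolp.cid => b /= /mulmx_det_unit [].
have ptH := FlQ_pt_conj ce ex GH HG (XP xV).
exists (exist _ _ ptH); apply: FlQ_eq => k i /=.
rewrite /extend_flag; have := extend_chain f (chain_conj GH HG ce).
move/(congr1 (fun U => U k i)); rewrite /extend_flag => ->.
have fG : map_mx f (G i) = 1%:M.
  by rewrite -[LHS]mul1mx -(fH i) -map_mxM HG map_mx1.
by rewrite eU !map_mxM fH fG mul1mx mulmx1 fe // -ltnS.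
Qed.
End FormalSmoothness.

(** * Irreducibility *)

Section LocalRing.
Variables (D : idomainType) (k : fieldType) (ev : {rmorphism D -> k}).
Local Notation E := {fraction D}.

(* The local ring of [D] at the kernel of [ev], inside the fraction field. *)
Definition loc_pred : {pred E} := fun z =>
  boolp.asbool (exists a b, ev b != 0 /\ z * tofrac b = tofrac a).

Lemma loc_predP z : reflect (exists a b, ev b != 0 /\ z * tofrac b = tofrac a)
  (z \in loc_pred).
Proof. exact: boolp.asboolP. Qed.

Lemma loc_pred_subring : subring_closed loc_pred.
Proof.
split.
- by apply/loc_predP; exists 1, 1; rewrite !rmorph1 oner_eq0 mulr1.
- move=> x y /loc_predP [a [b [b0 xb]]] /loc_predP [a' [b' [b'0 yb]]].
  apply/loc_predP; exists (a * b' - a' * b), (b * b').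
  rewrite rmorphM mulf_neq0 //; split=> //.
  rewrite rmorphB !rmorphM /= mulrBl -xb -yb mulrA; congr (_ - _).
  by rewrite [tofrac b * _]mulrC mulrA.
- move=> x y /loc_predP [a [b [b0 xb]]] /loc_predP [a' [b' [b'0 yb]]].
  apply/loc_predP; exists (a * a'), (b * b').
  by rewrite rmorphM mulf_neq0 // !rmorphM /= mulrACA xb yb.
Qed.

HB.instance Definition _ := GRing.isSubringClosed.Build E loc_pred loc_pred_subring.

Record loc := Loc { loc_val :> E; loc_valP : loc_val \in loc_pred }.
HB.instance Definition _ := [isSub for loc_val].
HB.instance Definition _ := [Choice of loc by <:].
HB.instance Definition _ := [SubChoice_isSubComNzRing of loc by <:].

Definition loc_incl : {rmorphism loc -> E} := val.

Lemma loc_inP a : tofrac a \in loc_pred.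
Proof. by apply/loc_predP; exists a, 1; rewrite !rmorph1 oner_eq0 mulr1. Qed.

Definition loc_in_fun a : loc := Loc (loc_inP a).

Lemma loc_in_additive : zmod_morphism loc_in_fun.
Proof. by move=> a b; apply: val_inj; rewrite /= !rmorphB. Qed.

Lemma loc_in_multiplicative : monoid_morphism loc_in_fun.
Proof.
split; first by apply: val_inj; rewrite /= !rmorph1.
by move=> a b; apply: val_inj; rewrite /= !rmorphM.
Qed.

HB.instance Definition _ :=
  GRing.isZmodMorphism.Build D loc loc_in_fun loc_in_additive.
HB.instance Definition _ :=
  GRing.isMonoidMorphism.Build D loc loc_in_fun loc_in_multiplicative.

Definition loc_in : {rmorphism D -> loc} := loc_in_fun.

Lemma loc_ev_ex (z : loc) : exists t : k, exists a b,
  [/\ ev b != 0, val z * tofrac b = tofrac a & t = ev a / ev b].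
Proof.
by have /loc_predP [a [b [b0 zb]]] := loc_valP z; exists (ev a / ev b), a, b.
Qed.

Definition loc_ev_fun z := sval (boolp.cid (loc_ev_ex z)).

Lemma loc_evE (z : loc) a b : ev b != 0 -> val z * tofrac b = tofrac a ->
  loc_ev_fun z = ev a / ev b.
Proof.
move=> b0 zb; rewrite /loc_ev_fun; case: boolp.cid => t /= [a' [b' [b'0 zb' ->]]].
apply/eqP; rewrite eqr_div // -!rmorphM; apply/eqP; congr (ev _).
apply/eqP; rewrite -tofrac_eq !rmorphM /= -zb -zb'.
by rewrite mulrAC.
Qed.

Lemma loc_ev_additive : zmod_morphism loc_ev_fun.
Proof.
move=> x y; have [_ [a [b [b0 xb _]]]] := loc_ev_ex x.
have [_ [a' [b' [b'0 yb _]]]] := loc_ev_ex y.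
have bb0 : ev (b * b') != 0 by rewrite rmorphM mulf_neq0.
rewrite (loc_evE b0 xb) (loc_evE b'0 yb) (loc_evE (a := a * b' - a' * b) bb0).
  by rewrite rmorphB !rmorphM /=; field; rewrite b0 b'0.
rewrite /= rmorphB !rmorphM /= mulrBl -xb -yb mulrA; congr (_ - _).
by rewrite [tofrac b * _]mulrC mulrA.
Qed.

Lemma loc_ev_multiplicative : monoid_morphism loc_ev_fun.
Proof.
split.
  rewrite (loc_evE (a := 1) (b := 1)) ?rmorph1 ?oner_eq0 //.
    by rewrite divr1.
  by rewrite /= mul1r.
move=> x y; have [_ [a [b [b0 xb _]]]] := loc_ev_ex x.
have [_ [a' [b' [b'0 yb _]]]] := loc_ev_ex y.
have bb0 : ev (b * b') != 0 by rewrite rmorphM mulf_neq0.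
rewrite (loc_evE b0 xb) (loc_evE b'0 yb) (loc_evE (a := a * a') bb0).
  by rewrite !rmorphM mulf_div.
by rewrite /= !rmorphM /= mulrACA xb yb.
Qed.

HB.instance Definition _ :=
  GRing.isZmodMorphism.Build loc k loc_ev_fun loc_ev_additive.
HB.instance Definition _ :=
  GRing.isMonoidMorphism.Build loc k loc_ev_fun loc_ev_multiplicative.

Definition loc_ev : {rmorphism loc -> k} := loc_ev_fun.

Lemma loc_ev_in a : loc_ev (loc_in a) = ev a.
Proof.
by rewrite [LHS](loc_evE (a := a) (b := 1)) ?rmorph1 ?oner_eq0 ?divr1 ?mulr1.
Qed.

Lemma loc_unit (z : loc) : loc_ev z != 0 -> exists y, y * z = 1.
Proof.
have [_ [a [b [b0 zb _]]]] := loc_ev_ex z.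
rewrite [loc_ev z](loc_evE b0 zb) mulf_eq0 invr_eq0 (negPf b0) orbF => a0.
have fa : tofrac a != 0.
  by rewrite tofrac_eq0; apply: contraNneq a0 => ->; rewrite rmorph0.
have yP : tofrac b / tofrac a \in loc_pred.
  by apply/loc_predP; exists b, a; rewrite mulfVK.
exists (Loc yP); apply: val_inj; rewrite /= mulrC mulrA zb mulfV //.
Qed.
End LocalRing.

Lemma inverse_unique (R : comNzRingType) n (A B C : 'M[R]_n) :
  B *m A = 1%:M -> A *m C = 1%:M -> B = C.
Proof. by move=> eBA eAC; rewrite -[B]mulmx1 -eAC mulmxA eBA mul1mx. Qed.

(** * The generic flag of subrepresentations *)

Section Irreducibility.
Variables (F : fieldType) (Q : quiver) (d : filtration Q).
Local Notation n := (ftop d).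
Local Notation nu := (flen d).
Variables (M : rep F n) (L : fieldType) (i : {rmorphism F -> L}).
Let ML : rep L n := map_rep i M.
Variable X : forall v, 'M[{mpoly L[ncoord n]}]_(n v).
Hypothesis XM : forall v, map_mx (mmap idfun (rep_coords ML)) (X v) = 1%:M.
Hypothesis XP : forall (A : kalg L) (x : rep A n),
  (forall q, Par_ideal q -> repev x q = 0) -> forall a,
  map_mx (mmap (kstr A) (rep_coords x)) (X (src a)) *m x a =
  map_mx (kstr A) (ML a) *m map_mx (mmap (kstr A) (rep_coords x)) (X (tgt a)).
Hypothesis MPar : forall q, Par_ideal q -> repev (A := selfalg L) ML q = 0.

Let Xv (A : kalg L) (x : rep A n) v := map_mx (mmap (kstr A) (rep_coords x)) (X v).

Let Xv_map (A B : kalg L) (f : kalg_hom A B) (x : rep A n) (y : rep B n) v :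
  (forall a, map_mx f (x a) = y a) -> map_mx f (Xv x v) = Xv y v.
Proof.
move=> xy; rewrite /Xv; apply/matrixP => s t; rewrite !mxE mmap_hom.
congr (mmap _ _ _); apply: functional_extensionality => l.
by rewrite -[LHS](rep_coords_map f x l) (eq_rep_coords xy).
Qed.

Let Xv_M (A : kalg L) (x : rep A n) v :
  (forall a, x a = map_mx (kstr A) (ML a)) -> Xv x v = 1%:M.
Proof.
move=> xM; pose phi : kalg_hom (selfalg L) A :=
  @KAlgHom L (selfalg L) A (kstr A) (fun c => erefl).
rewrite -(Xv_map (f := phi) (x := (ML : rep (selfalg L) n)) v); last first.
  by move=> a; rewrite xM.
have XM' : Xv (ML : rep (selfalg L) n) v = 1%:M by exact: XM.
by rewrite XM' map_mx1.
Qed.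

Section Theta.
Variables (A : kalg L) (g h Y : forall v, 'M[A]_(n v)) (T : rep A n).
Hypothesis tT : tri T.
Hypotheses (gh : forall v, g v *m h v = 1%:M) (hg : forall v, h v *m g v = 1%:M).
Hypotheses (YX : forall v, Y v *m Xv (par g T) v = 1%:M)
  (XY : forall v, Xv (par g T) v *m Y v = 1%:M).

Let proj k v := Xv (par g T) v *m conj_proj (d := d) g h k v *m Y v.

Let proj_pt : @FlQ_pt Q d F M (restr i A) (fun (k : 'I_nu.+1) v => prj (proj k v)).
Proof.
apply: (@FlQ_pt_conj F Q d M (restr i A) (par g T) _ Y (Xv (par g T))
  (conj_chain gh hg) _ YX XY).
- apply: (conj_subrep gh hg (par g T)).1 => k a knu.
  have -> : g (src a) *m par g T a *m h (tgt a) = \det (g (src a)) *: T a.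
    by rewrite /par -!mulmxA gh mulmx1 mulmxA mul_mx_adj mul_scalar_mx.
  exact: (triZ (fun a => \det (g (src a))) tT).
- move=> a; rewrite (XP (x := par g T)) => [|q qI]; last exact: qI.
  by congr (_ *m _); apply/matrixP => s t; rewrite !mxE.
Qed.

(* The flag of subrepresentations of [M] obtained from the standard flag of [T]
   by conjugating with [g], to a flag for [par g T], and then with [X]. *)
Definition theta : base_change i (FlQ M) A := exist _ _ proj_pt.
End Theta.

(** Only [g] and [T] have to correspond; the inverses [h] and [Y] then do by uniqueness. *)
Lemma theta_map (A B : kalg L) (f : kalg_hom A B)
    (g h Y : forall v, 'M[A]_(n v)) (T : rep A n) tT gh hg YX XY
    (g' h' Y' : forall v, 'M[B]_(n v)) (T' : rep B n) tT' gh' hg' YX' XY' :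
  (forall v, map_mx f (g v) = g' v) -> (forall a, map_mx f (T a) = T' a) ->
  Defs.pmap (base_change i (FlQ M)) f (@theta A g h Y T tT gh hg YX XY) =
  @theta B g' h' Y' T' tT' gh' hg' YX' XY'.
Proof.
move=> fg fT; apply: (@FlQ_eq F Q d M (restr i B)) => k v.
have fpar a : map_mx f (par g T a) = par g' T' a.
  by rewrite /par !map_mxM map_mx_adj !fg fT.
have fX w := Xv_map w fpar.
have fh w : map_mx f (h w) = h' w.
  apply: (inverse_unique (A := g' w)) => //.
  by rewrite -fg -map_mxM hg map_mx1.
have fY w : map_mx f (Y w) = Y' w.
  apply: (inverse_unique (A := Xv (par g' T') w)) => //.
  by rewrite -fX -map_mxM YX map_mx1.
rewrite /= /extend_flag.
have := extend_chain f (chain_conj YX XY (conj_chain (d := d) gh hg)).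
move/(congr1 (fun U => U k v)); rewrite /extend_flag => ->.
by rewrite /conj_proj !map_mxM fX fY fh fg flagproj_map.
Qed.

Local Notation P := {mpoly L[ngvar d]}.
Local Notation E := {fraction P}.
Let fr : {rmorphism P -> E} := @tofrac P.
Let Ealg : kalg L := KAlg (fr \o @mpolyC (ngvar d) L : {rmorphism L -> E}).
Let gE v : 'M[Ealg]_(n v) := map_mx fr (gen_g d L v).
Let TE : rep Ealg n := map_rep fr (gen_T d L).

Let field_inv (K : fieldType) m (U : 'M[K]_m) : \det U != 0 ->
  exists V, V *m U = 1%:M /\ U *m V = 1%:M.
Proof.
move=> U0; have Uu : U \in unitmx by rewrite unitmxE unitfE.
by exists (invmx U); rewrite mulVmx // mulmxV.
Qed.

Let gE_inv : exists h, forall v, h v *m gE v = 1%:M /\ gE v *m h v = 1%:M.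
Proof.
have h v : exists h, h *m gE v = 1%:M /\ gE v *m h = 1%:M.
  by apply: field_inv; rewrite det_map_mx tofrac_eq0 gen_det_neq0.
exists (fun v => sval (boolp.cid (h v))) => v; exact: (svalP (boolp.cid (h v))).
Qed.

(** If [\det (X v)] vanished at the generic conjugate, it would lie in [Par_ideal] and vanish at
    [ML], where it is 1. *)
Let XE_inv : exists Y, forall v, Y v *m Xv (par gE TE) v = 1%:M /\
  Xv (par gE TE) v *m Y v = 1%:M.
Proof.
have h v : exists Y, Y *m Xv (par gE TE) v = 1%:M /\ Xv (par gE TE) v *m Y = 1%:M.
  apply: field_inv.
  pose phi : kalg_hom (gen_alg d L) Ealg :=
    @KAlgHom L (gen_alg d L) Ealg fr (fun c => erefl).
  rewrite -(Xv_map (f := phi) (x := (par (gen_g d L) (gen_T d L)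
    : rep (gen_alg d L) n))) => [|a]; last exact: par_map.
  rewrite det_map_mx tofrac_eq0; apply/eqP => D0.
  have XD0 : Par_ideal (\det (X v)).
    apply/Par_idealP; rewrite -[RHS]D0.
    exact: (esym (det_map_mx (mmap (@mpolyC (ngvar d) L) (@gen_pt Q d L)) (X v))).
  have := MPar XD0; have := det_map_mx (mmap idfun (rep_coords ML)) (X v).
  rewrite XM det1 /repev /= => <- /eqP; by rewrite oner_eq0.
exists (fun v => sval (boolp.cid (h v))) => v; exact: (svalP (boolp.cid (h v))).
Qed.

Lemma FlQ_irreducible : irreducible (base_change i (FlQ M)).
Proof.
have [hE hEP] := gE_inv; have [YE YEP] := XE_inv.
have tTE : tri TE := tri_map fr (@gen_tri _ d L).
pose eta := theta tTE (fun v => (hEP v).2) (fun v => (hEP v).1)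
  (fun v => (YEP v).1) (fun v => (YEP v).2).
(* It suffices that every nonempty open subfunctor contains [eta]. *)
have generic (U : forall A : kalg L, base_change i (FlQ M) A -> Prop) :
    open_sub U -> nonempty_sub U -> U Ealg eta.
  move=> oU [k [j [u Uu]]].
  have [e [ce eu ek]] := FlQ_pt_chain (svalP u).
  pose kA : kalg L := KAlg j.
  have hy v : exists y : 'M[kA]_(n v), (y : 'M[k]_(n v)) \in unitmx /\
      forall l, (l <= nu)%N -> y *m e l v = flagproj d kA l v *m y.
    have [||||y yu yE] := @adapted_basis k (n v) (fun l => e l v)
      (fun l => d (inord l) v) nu.
    - by move=> l m lm mnu; rewrite (chain_mul ce) // (chain_mul' ce).
    - exact: (chain0 ce).
    - exact: (chain1 ce).
    - move=> l lnu; have := chain_rank ce (idfun : {rmorphism k -> k}) (inord l) v.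
      by rewrite map_mx_id // inordK.
    by exists y.
  pose y v := sval (boolp.cid (hy v)).
  have yu v : (y v : 'M[k]_(n v)) \in unitmx by rewrite /y; case: boolp.cid => ? [].
  have ye l v : (l <= nu)%N -> y v *m e l v = flagproj d kA l v *m y v.
    by rewrite /y; case: boolp.cid => ? [] /= _; apply.
  pose z v : 'M[kA]_(n v) := invmx (y v : 'M[k]_(n v)).
  have yz v : y v *m z v = 1%:M by exact: mulmxV.
  have zy v : z v *m y v = 1%:M by exact: mulVmx.
  have eE l v : (l <= nu)%N -> e l v = conj_proj (d := d) y z l v.
    by move=> lnu; rewrite /conj_proj -mulmxA -ye // mulmxA zy mul1mx.
  pose Mk : rep kA n := map_rep j ML.
  (* Division by the determinant compensates the adjugate in [par], so that [par y T1] is [M]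
     itself. *)
  pose T1 : rep kA n := fun a => ((\det (y (src a)) : k)^-1 : kA) *:
    (y (src a) *m Mk a *m z (tgt a)).
  have tT1 : tri T1.
    apply: triZ; apply/(conj_subrep yz zy) => l a lnu; rewrite -!eE //.
    have <- : map_mx (kstr (restr i kA)) (M a) = Mk a.
      by apply/matrixP => s t; rewrite !mxE.
    exact: ek.
  have parT1 a : par y T1 a = Mk a.
    rewrite /par /T1 -scalemxAr -scalemxAl !mulmxA mul_adj_mx mul_scalar_mx.
    rewrite -!scalemxAl scalerA mulVf; last by rewrite -unitfE -unitmxE.
    by rewrite scale1r -mulmxA zy mulmx1.
  pose ev : {rmorphism P -> k} := mmap j (gval y T1).
  have evC c : ev c%:MP = j c by exact: mmapC.
  (* Over this local ring the generic [g] and the value of [X] are invertible, because they are at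
     the closed point. The resulting [th] maps to [u] at the closed point and to [eta] at the
     generic one. *)
  pose Rl := loc ev.
  pose lin : {rmorphism P -> Rl} := loc_in ev.
  pose lA : kalg L := KAlg (lin \o @mpolyC (ngvar d) L : {rmorphism L -> Rl}).
  have f0P c : loc_ev ev (kstr lA c) = kstr kA c.
    by rewrite -[RHS]evC; exact: loc_ev_in.
  pose f0 : kalg_hom lA kA := @KAlgHom L lA kA (loc_ev ev) f0P.
  pose f1 : kalg_hom lA Ealg := @KAlgHom L lA Ealg (loc_incl ev) (fun c => erefl).
  pose gl v : 'M[lA]_(n v) := map_mx lin (gen_g d L v).
  pose Tl : rep lA n := map_rep lin (gen_T d L).
  have tTl : tri Tl := tri_map lin (@gen_tri _ d L).
  have f0l m1 m2 (U0 : 'M[P]_(m1, m2)) : map_mx f0 (map_mx lin U0) = map_mx ev U0.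
    by apply/matrixP => s t; rewrite !mxE /=; exact: loc_ev_in.
  have f0g v : map_mx f0 (gl v) = y v by rewrite f0l; exact: gen_g_map.
  have f0T a : map_mx f0 (Tl a) = T1 a by rewrite f0l; exact: gen_T_map.
  have f0par a : map_mx f0 (par gl Tl a) = par y T1 a.
    by rewrite /par !map_mxM map_mx_adj !f0g f0T.
  have loc_inv m (U0 : 'M[lA]_m) : \det (map_mx f0 U0) != 0 ->
      exists V, V *m U0 = 1%:M /\ U0 *m V = 1%:M.
    rewrite det_map_mx => /loc_unit [b bU].
    by have [] := mulmx_det_unit bU; exists (b *: \adj U0).
  have hgl v : exists h, h *m gl v = 1%:M /\ gl v *m h = 1%:M.
    by apply: loc_inv; rewrite f0g -unitfE -unitmxE.
  have hXl v : exists Y, Y *m Xv (par gl Tl) v = 1%:M /\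
      Xv (par gl Tl) v *m Y = 1%:M.
    apply: loc_inv; rewrite (Xv_map v f0par) Xv_M ?det1 ?oner_eq0 //.
  have XkE v : Xv (par y T1) v = 1%:M by apply: Xv_M.
  pose hl v := sval (boolp.cid (hgl v)); pose Yl v := sval (boolp.cid (hXl v)).
  have hlP v : hl v *m gl v = 1%:M /\ gl v *m hl v = 1%:M := svalP (boolp.cid (hgl v)).
  have YlP v : Yl v *m Xv (par gl Tl) v = 1%:M /\ Xv (par gl Tl) v *m Yl v = 1%:M :=
    svalP (boolp.cid (hXl v)).
  pose th := theta tTl (fun v => (hlP v).2) (fun v => (hlP v).1)
    (fun v => (YlP v).1) (fun v => (YlP v).2).
  have one1 v : (1%:M : 'M[kA]_(n v)) *m Xv (par y T1) v = 1%:M.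
    by rewrite XkE mulmx1.
  have one2 v : Xv (par y T1) v *m (1%:M : 'M[kA]_(n v)) = 1%:M.
    by rewrite XkE mulmx1.
  have th0 : Defs.pmap (base_change i (FlQ M)) f0 th = u.
    rewrite (theta_map _ _ _ _ _ tT1 yz zy one1 one2 f0g f0T).
    apply: (@FlQ_eq F Q d M (restr i kA)) => l v.
    by rewrite eu /= XkE mul1mx mulmx1 eE // -ltnS.
  have th1 : Defs.pmap (base_change i (FlQ M)) f1 th = eta.
    apply: theta_map => [v|a]; apply/matrixP => s t; rewrite !mxE //.
  have [I IP] := oU lA th.
  have [m [a [b [Ia ab]]]] := (IP kA f0).1 (eq_ind_r (U kA) Uu th0).
  (* Membership of [u] gives an element of the defining ideal that is nonzero at the closed point;
     it is then nonzero, hence a unit, in the fraction field, so [eta] is in [U]. *)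
  have [l fa0] : exists l, f0 (a l) != 0.
    apply: boolp.contrapT => nol; move/eqP: ab; rewrite big1 => [|l _].
      by rewrite eq_sym oner_eq0.
    have [->|al] := eqVneq (f0 (a l)) 0; first exact: mulr0.
    by case: nol; exists l.
  have a0 : f1 (a l) != 0 :> E.
    apply: contraNneq fa0 => e0; apply/eqP.
    have -> : a l = 0 by apply: val_inj.
    exact: rmorph0.
  rewrite -th1; apply/IP; exists 1%N, (fun=> a l), (fun=> (f1 (a l) : E)^-1).
  by split=> //; rewrite big_ord1; exact: (mulVf a0).
split; first by exists E, (fr \o @mpolyC (ngvar d) L : {rmorphism L -> E}), eta.
move=> U V oU oV nU nV.
exists E, (fr \o @mpolyC (ngvar d) L : {rmorphism L -> E}), eta.
by split; apply: generic.
Qed.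
End Irreducibility.

(** * Charts *)

Lemma generates_unit_fields (A B : comNzRingType) (f : A -> B) (I : A -> Prop) :
  generates_unit f I <->
  forall (L : fieldType) (h : {rmorphism B -> L}), exists a, I a /\ h (f a) != 0.
Proof.
split=> [[m [a [b [Ia ab]]]] L h|fI].
  apply: boolp.contrapT => noa; have /eqP := rmorph1 h.
  rewrite -ab rmorph_sum big1 ?(eq_sym 0) ?oner_eq0 // => l _.
  rewrite rmorphM; case: (eqVneq (h (f (a l))) 0) => [->|al].
    by rewrite mulr0.
  by case: noa; exists (a l).
pose J y := exists (m : nat) (a : 'I_m -> A) (b : 'I_m -> B),
  (forall j, I (a j)) /\ y = \sum_(j < m) b j * f (a j).
apply: boolp.contrapT => nf.
have [||L [h [hJ _]]] := @ideal_to_field B J.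
- split.
  + exists 0%N, (fun=> 0), (fun=> 0); split; first by case.
    by rewrite big_ord0.
  + move=> _ _ [m1 [a1 [b1 [I1 ->]]]] [m2 [a2 [b2 [I2 ->]]]].
    exists (m1 + m2)%N, (fun j => match split j with inl j => a1 j | inr j => a2 j end),
      (fun j => match split j with inl j => b1 j | inr j => b2 j end).
    split; first by move=> j; case: (split j).
    rewrite big_split_ord /=; congr (_ + _); apply: eq_bigr => j _.
      by rewrite (unsplitK (inl j) : split (lshift _ j) = _).
    by rewrite (unsplitK (inr j) : split (rshift _ j) = _).
  + move=> c _ [m [a [b [Ia ->]]]]; exists m, a, (fun j => c * b j).
    by split=> //; rewrite mulr_sumr; apply: eq_bigr => j _; rewrite mulrA.
- by case=> m [a [b [Ia e]]]; apply: nf; exists m, a, b.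
have [a [Ia ha]] := fI L h.
case/eqP: ha; apply: hJ; exists 1%N, (fun=> a), (fun=> 1).
by split=> //; rewrite big_ord1 mul1r.
Qed.

(** The defect [e - e *m E] is idempotent, and it vanishes in every field, where nested subspaces of
    equal dimension coincide. *)
Lemma idempotent_sub_eq (A : comNzRingType) n (E e : 'M[A]_n) :
  E *m E = E -> e *m e = e -> E *m e = E ->
  (forall (L : fieldType) (f : {rmorphism A -> L}),
     \rank (map_mx f E) = \rank (map_mx f e)) -> e *m E = e.
Proof.
move=> EE ee Ee rk; apply/eqP; rewrite -subr_eq0; apply/eqP.
have h : e - e *m E = 0; last by rewrite -opprB h oppr0.
apply: idempotent_eq0.
  have e1 : e *m E *m e = e *m E by rewrite -mulmxA Ee.
  rewrite mulmxBr !mulmxBl ee e1 (mulmxA e e E) ee (mulmxA (e *m E) e E) e1.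
  by rewrite -(mulmxA e E E) EE subrr subr0.
move=> L f; rewrite map_mxB map_mxM; apply/eqP; rewrite subr_eq0 eq_sym; apply/eqP.
have sub : (map_mx f E <= map_mx f e)%MS by rewrite -Ee map_mxM submxMl.
have /submxP [w ->] : (map_mx f e <= map_mx f E)%MS.
  by rewrite -(geq_leqif (mxrank_leqif_sup sub)) rk.
by rewrite -mulmxA -map_mxM EE.
Qed.

Section Chart.
Variables (F : fieldType) (Q : quiver) (d : filtration Q).
Local Notation n := (ftop d).
Local Notation nu := (flen d).
Variable M : rep F n.
Variable phi : forall (k : 'I_nu.+1) i, 'I_(d k i) -> 'I_(n i).
Hypothesis phi_inj : forall k i, injective (@phi k i).

Definition coord_sel (R : nzRingType) k i : 'M[R]_(d k i, n i) :=
  rowsub (@phi k i) 1%:M.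

(* The projector onto a coordinate subspace; the chart consists of the flags that
   are transversal to its kernels, in the form of projectors with the same kernels. *)
Definition coord_proj (R : nzRingType) k i : 'M[R]_(n i) :=
  (coord_sel R k i)^T *m coord_sel R k i.

Lemma coord_selK (R : comNzRingType) k i :
  coord_sel R k i *m (coord_sel R k i)^T = 1%:M.
Proof.
apply/matrixP => u v; rewrite mxE (bigD1 (phi u)) //= big1 ?addr0 => [|j ju].
  by rewrite !mxE eqxx mul1r (inj_eq (@phi_inj k i)) eq_sym.
by rewrite !mxE eq_sym (negPf ju) mul0r.
Qed.

Lemma coord_projK (R : comNzRingType) k i :
  coord_proj R k i *m coord_proj R k i = coord_proj R k i.
Proof.
by rewrite /coord_proj -mulmxA (mulmxA (coord_sel R k i)) coord_selK mul1mx.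
Qed.

Lemma coord_sel_map (R S : comNzRingType) (f : {rmorphism R -> S}) k i :
  map_mx f (coord_sel R k i) = coord_sel S k i.
Proof. by apply/matrixP => u v; rewrite !mxE rmorph_nat. Qed.

Lemma coord_proj_map (R S : comNzRingType) (f : {rmorphism R -> S}) k i :
  map_mx f (coord_proj R k i) = coord_proj S k i.
Proof. by rewrite map_mxM -map_trmx coord_sel_map. Qed.

Lemma coord_proj_rank (L : fieldType) k i : \rank (coord_proj L k i) = d k i.
Proof.
apply/eqP; rewrite eqn_leq; apply/andP; split.
  by apply: leq_trans (mxrankM_maxr _ _) (rank_leq_row _).
have e : coord_sel L k i *m coord_proj L k i *m (coord_sel L k i)^T = 1%:M.
  by rewrite /coord_proj !mulmxA coord_selK mul1mx coord_selK.
rewrite -{1}(mxrank1 L (d k i)) -e.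
exact: leq_trans (mxrankM_maxl _ _) (mxrankM_maxr _ _).
Qed.

Definition cvar_ty (ki : 'I_nu.+1 * vert Q) := ('I_(n ki.2) * 'I_(n ki.2))%type.
Definition cvar := {ki : 'I_nu.+1 * vert Q & cvar_ty ki}.
Definition sub_ty (ka : 'I_nu.+1 * arr Q) :=
  ('I_(n (src ka.2)) * 'I_(n (tgt ka.2)))%type.
Definition ceqn := ((cvar + cvar) + (cvar + {ka : 'I_nu.+1 * arr Q & sub_ty ka}))%type.

Definition chart_mx (R : Type) (t : 'rV[R]_#|{: cvar}|) (k : 'I_nu.+1) i :
    'M[R]_(n i) :=
  \matrix_(u, v) t 0 (enum_rank (Tagged cvar_ty (i := (k, i)) (u, v) : cvar)).

Definition chart_vec (R : Type) (E : forall (k : 'I_nu.+1) i, 'M[R]_(n i)) :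
    'rV[R]_#|{: cvar}| :=
  \row_l let c := enum_val l in E (tag c).1 (tag c).2 (tagged c).1 (tagged c).2.

Lemma chart_vecK (R : Type) E k i : chart_mx (@chart_vec R E) k i = E k i.
Proof. by apply/matrixP => u v; rewrite !mxE enum_rankK. Qed.

Lemma chart_mxK (R : Type) (t : 'rV[R]_#|{: cvar}|) : chart_vec (chart_mx t) = t.
Proof.
apply/rowP => l; rewrite mxE /= mxE -[in RHS](enum_valK l).
by case: (enum_val l) => [[k i] [u v]].
Qed.

Section Equations.
Variables (R : comNzRingType) (N : rep R n).
Variable E : forall (k : 'I_nu.+1) i, 'M[R]_(n i).

(** The top index has no successor, and [inord] would return its default value there; the equation
    is made void. *)
Definition nest_defect (k : 'I_nu.+1) i : 'M[R]_(n i) :=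
  if (k < nu)%N then E k i *m E (inord k.+1) i - E k i else 0.

Definition chart_eqn (c : ceqn) : R :=
  match c with
  | inl (inl c) => let: (u, v) := tagged c in
    (coord_proj R (tag c).1 (tag c).2 *m E (tag c).1 (tag c).2
      - E (tag c).1 (tag c).2) u v
  | inl (inr c) => let: (u, v) := tagged c in
    (E (tag c).1 (tag c).2 *m coord_proj R (tag c).1 (tag c).2
      - coord_proj R (tag c).1 (tag c).2) u v
  | inr (inl c) => let: (u, v) := tagged c in
    nest_defect (tag c).1 (tag c).2 u v
  | inr (inr c) => let: (u, v) := tagged c in
    (E (tag c).1 (src (tag c).2) *m N (tag c).2 *m E (tag c).1 (tgt (tag c).2)
      - E (tag c).1 (src (tag c).2) *m N (tag c).2) u v
  end.

(** The first two relations together say that [E k i] is idempotent with the same kernel as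
    [coord_proj]. *)
Definition in_chart : Prop :=
  [/\ forall k i, coord_proj R k i *m E k i = E k i,
      forall k i, E k i *m coord_proj R k i = coord_proj R k i,
      forall (k l : 'I_nu.+1) i, l = k.+1 :> nat -> E k i *m E l i = E k i
    & forall k a, E k (src a) *m N a *m E k (tgt a) = E k (src a) *m N a].

Lemma chart_eqnP : (forall c, chart_eqn c = 0) <-> in_chart.
Proof.
split=> [E0|[E1 E2 E3 E4]].
  split.
  - move=> k i; apply/eqP; rewrite -subr_eq0; apply/eqP/matrixP => u v.
    by rewrite [RHS]mxE -(E0 (inl (inl (Tagged cvar_ty (i := (k, i)) (u, v))))).
  - move=> k i; apply/eqP; rewrite -subr_eq0; apply/eqP/matrixP => u v.
    by rewrite [RHS]mxE -(E0 (inl (inr (Tagged cvar_ty (i := (k, i)) (u, v))))).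
  - move=> k l i lk; apply/eqP; rewrite -subr_eq0; apply/eqP/matrixP => u v.
    rewrite [RHS]mxE -(E0 (inr (inl (Tagged cvar_ty (i := (k, i)) (u, v))))) /=.
    by rewrite /nest_defect /= -lk -ltnS ltn_ord inord_val.
  - move=> k a; apply/eqP; rewrite -subr_eq0; apply/eqP/matrixP => u v.
    by rewrite [RHS]mxE -(E0 (inr (inr (Tagged sub_ty (i := (k, a)) (u, v))))).
case=> [] [] [[k i] [u v]] /=.
- by rewrite E1 subrr mxE.
- by rewrite E2 subrr mxE.
- rewrite /nest_defect; case: ifP => [knu|_]; last by rewrite mxE.
  by rewrite E3 ?subrr ?mxE // inordK // ltnS.
- by rewrite E4 subrr mxE.
Qed.
End Equations.

Lemma chart_eqn_map (R S : comNzRingType) (f : {rmorphism R -> S})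
    (N : rep R n) (E : forall (k : 'I_nu.+1) i, 'M[R]_(n i))
    (N' : rep S n) (E' : forall (k : 'I_nu.+1) i, 'M[S]_(n i)) c :
  (forall k i, map_mx f (E k i) = E' k i) -> (forall a, map_mx f (N a) = N' a) ->
  f (chart_eqn N E c) = chart_eqn N' E' c.
Proof.
move=> fE fN.
have entry m1 m2 (U : 'M[R]_(m1, m2)) u v : f (U u v) = map_mx f U u v by rewrite mxE.
case: c => [] [] [[k i] [u v]] /=; rewrite entry.
- by rewrite map_mxB map_mxM coord_proj_map !fE.
- by rewrite map_mxB map_mxM coord_proj_map !fE.
- congr (fun_of_matrix _ u v); rewrite /nest_defect; case: ifP => _.
    by rewrite map_mxB map_mxM !fE.
  exact: map_mx0.
- by rewrite map_mxB !map_mxM !fE fN.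
Qed.

Definition chart_poly (l : 'I_#|{: ceqn}|) : {mpoly F[#|{: cvar}|]} :=
  chart_eqn (map_rep (@mpolyC _ F) M) (chart_mx (\row_l 'X_l)) (enum_val l).

Lemma chart_solP (A : kalg F) (t : 'rV[A]_#|{: cvar}|) :
  is_sol chart_poly t <-> in_chart (map_rep (kstr A) M) (chart_mx t).
Proof.
pose ev : {rmorphism {mpoly F[#|{: cvar}|]} -> A} := mmap (kstr A) (fun l => t 0 l).
have evE c : ev (chart_eqn (map_rep (@mpolyC _ F) M) (chart_mx (\row_l 'X_l)) c) =
    chart_eqn (map_rep (kstr A) M) (chart_mx t) c.
  apply: chart_eqn_map => [k i|a]; apply/matrixP => u v; rewrite !mxE /ev /=.
    by rewrite mmapX mmap1U.
  exact: mmapC.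
split=> [sol|/chart_eqnP E0 l]; last by rewrite -[LHS]/(ev (chart_poly l)) evE E0.
by apply/chart_eqnP => c; rewrite -evE -(enum_rankK c); exact: (sol (enum_rank c)).
Qed.

Lemma in_chart_pt (A : kalg F) (E : forall (k : 'I_nu.+1) i, 'M[A]_(n i)) :
  in_chart (map_rep (kstr A) M) E -> FlQ_pt M (fun k i => prj (E k i)).
Proof.
move=> [E1 E2 E3 E4].
have EE k i : E k i *m E k i = E k i by rewrite -{2}(E1 k i) mulmxA E2 E1.
split; first split=> [k i|k l i x lk].
- split; first exact: summand_prj.
  apply/(has_rank_prj _ (EE k i)) => L f.
  rewrite -(coord_proj_rank L k i) -(coord_proj_map f).
  apply/eqP; rewrite eqn_leq; apply/andP; split.
    by rewrite -{1}(E1 k i) map_mxM mxrankM_maxl.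
  by rewrite -{1}(E2 k i) map_mxM mxrankM_maxl.
- by rewrite /prj => <-; rewrite -mulmxA E3.
- move=> k a x; rewrite /prj => <-.
  by rewrite -!mulmxA (mulmxA (E k (src a))) E4.
Qed.

Definition chart_pt (A : kalg F) (t : Sol chart_poly A) : FlQ M A :=
  exist _ _ (in_chart_pt ((chart_solP (sval t)).1 (svalP t))).

Lemma chart_natural (A B : kalg F) (f : kalg_hom A B) (t : Sol chart_poly A) :
  chart_pt (Defs.pmap (Sol chart_poly) f t) = Defs.pmap (FlQ M) f (chart_pt t).
Proof.
apply: FlQ_eq => k i /=; rewrite /extend_flag extend_prj.
  by congr prj; apply/matrixP => u v; rewrite !mxE.
have [E1 E2 _ _] := (chart_solP (sval t)).1 (svalP t).
by rewrite -{2}E1 mulmxA E2 E1.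
Qed.

(** A projector is determined by its image and its kernel, and the kernel is prescribed by the
    chart. *)
Lemma chart_inj (A : kalg F) : injective (@chart_pt A).
Proof.
move=> t t' tt'; apply: eq_sig_hprop => [x|]; first exact: proof_irrelevance.
rewrite -(chart_mxK (sval t)) -(chart_mxK (sval t')).
suff e k i : chart_mx (sval t) k i = chart_mx (sval t') k i.
  by apply/rowP => l; rewrite !mxE /= e.
have [E1 E2 _ _] := (chart_solP (sval t)).1 (svalP t).
have [E1' E2' _ _] := (chart_solP (sval t')).1 (svalP t').
have pe : prj (chart_mx (sval t) k i) = prj (chart_mx (sval t') k i).
  by move/(congr1 sval)/(congr1 (fun U : graded_flag d A => U k i)): tt'.
move: (E1 k i) (E2 k i) (E1' k i) pe; move: (chart_mx _ k i) => E.
move: (chart_mx _ k i) => E' e1 e2 e1' pe.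
have EE : E *m E = E by rewrite -{2}e1 mulmxA e2 e1.
have <- : E *m E' = E by apply: prj_sub => // v; rewrite -/(prj E v) pe.
by rewrite -e1' mulmxA e2.
Qed.

(* Surjectivity of [e k i] onto the coordinate subspace suffices, since the ranks
   are equal. *)
Lemma chart_image (A : kalg F) (y : FlQ M A) (e : nat -> forall i, 'M[A]_(n i)) :
  chain (d := d) e -> sval y = (fun k i => prj (e k i)) ->
  (exists t, chart_pt t = y) <->
  forall (k : 'I_nu.+1) i, exists S, S *m e k i *m coord_proj A k i = coord_proj A k i.
Proof.
move=> ce ey; split=> [[t ty] k i|eS].
  have [E1 E2 _ _] := (chart_solP (sval t)).1 (svalP t).
  exists (chart_mx (sval t) k i); rewrite -{2}(E2 k i); congr (_ *m _).
  apply: prj_sub; first by rewrite -{2}(E1 k i) mulmxA E2 E1.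
  have : prj (chart_mx (sval t) k i) = prj (e k i).
    by have := congr1 (fun z => sval z k i) ty; rewrite ey.
  by move=> pe v; rewrite -/(prj _ v) pe.
pose S k i := sval (boolp.cid (eS k i)).
have SP k i : S k i *m e k i *m coord_proj A k i = coord_proj A k i.
  by rewrite /S; case: boolp.cid.
(* The projector with the kernel of [coord_proj] and with image inside that of [e k i]; equality of
   the ranks makes the images equal. *)
pose E k i := coord_proj A k i *m S k i *m e k i.
have ee (k : 'I_nu.+1) i : e k i *m e k i = e k i by rewrite (chain_mul ce) // -ltnS.
have E1 k i : coord_proj A k i *m E k i = E k i.
  rewrite /E -!(mulmxA (coord_proj A k i)) (mulmxA (coord_proj A k i)).
  by rewrite coord_projK.
have E2 k i : E k i *m coord_proj A k i = coord_proj A k i.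
  by rewrite /E -!(mulmxA (coord_proj A k i)) SP coord_projK.
have Ee k i : E k i *m e k i = E k i by rewrite /E -mulmxA ee.
have EE k i : E k i *m E k i = E k i by rewrite -{2}(E1 k i) mulmxA E2 E1.
have eE (k : 'I_nu.+1) i : e k i *m E k i = e k i.
  apply: idempotent_sub_eq => // L f.
  rewrite (chain_rank ce) -(coord_proj_rank L k i) -(coord_proj_map f).
  apply/eqP; rewrite eqn_leq; apply/andP; split.
    by rewrite -{1}(E1 k i) map_mxM mxrankM_maxl.
  by rewrite -{1}(E2 k i) map_mxM mxrankM_maxl.
have pE k i : prj (E k i) = prj (e k i).
  apply: prj_ext => v; rewrite /prj; split=> vE.
    by rewrite -vE -mulmxA Ee.
  by rewrite -vE -mulmxA eE.
clearbody E; have [flU subU] := svalP y; rewrite ey in flU subU.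
have inE : in_chart (map_rep (kstr A) M) E.
  split=> // [k l i lk|k a].
    apply: prj_sub => // v; rewrite -/(prj _ v) -[_ = _]/(prj (E l i) v) !pE.
    exact: (flU.2 k l i v lk).
  apply/row_matrixP => j; rewrite !row_mul.
  rewrite -[_ = _]/(prj (E k (tgt a)) (row j (E k (src a)) *m _)) pE.
  by apply: subU; rewrite -pE /prj -row_mul EE.
have solE : is_sol chart_poly (chart_vec E).
  apply/chart_solP; rewrite (_ : chart_mx _ = E) //.
  apply: functional_extensionality_dep => k.
  by apply: functional_extensionality_dep => i; rewrite chart_vecK.
exists (exist _ _ solE); apply: FlQ_eq => k i.
by rewrite /= chart_vecK pE ey.
Qed.

(** The ideal consists of the scalars after multiplication by which the criterion of [chart_image]
    holds. At a field-valued point of the chart, products of suitable minors are such scalars and do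
    not vanish; conversely, a combination equal to 1 combines the solutions [S] into one. *)
Lemma chart_open : open_sub (fun (A : kalg F) (y : FlQ M A) => exists t, chart_pt t = y).
Proof.
move=> A y; have [e [ce ey _]] := FlQ_pt_chain (svalP y).
exists (fun a => forall (k : 'I_nu.+1) i, exists S,
  S *m e k i *m coord_proj A k i = a *: coord_proj A k i) => B f.
have fey : sval (Defs.pmap (FlQ M) f y) = fun k i => prj (map_mx f (e k i)).
  by rewrite /= ey; exact: extend_chain.
split.
  move/(chart_image (chain_map f ce) fey) => eS.
  apply/generates_unit_fields => L h.
  have hk (k : 'I_nu.+1) i : exists a, h (f a) != 0 /\
      exists S, S *m e k i *m coord_proj A k i = a *: coord_proj A k i.
    have [S SP] := eS k i; set C := coord_sel A k i; set hf := h \o f.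
    pose W := map_mx hf (e k i *m C^T).
    have Wfull : row_full W.
      apply/row_fullP; exists (coord_sel L k i *m map_mx h S).
      have -> : W = map_mx h (map_mx f (e k i)) *m (coord_sel L k i)^T.
        by rewrite /W /hf map_mx_comp !map_mxM -!map_trmx !coord_sel_map.
      have := congr1 (map_mx h) SP.
      rewrite (map_mxM h (S *m _)) (map_mxM h S) coord_proj_map.
      have : coord_proj L k i *m (coord_sel L k i)^T = (coord_sel L k i)^T.
        by rewrite /coord_proj -mulmxA coord_selK mulmx1.
      move: (coord_proj L k i) => q qC Sq.
      set S' := map_mx h S in Sq *; set e' := map_mx h _ in Sq *.
      rewrite -qC -(mulmxA _ S') (mulmxA S' e') (mulmxA (S' *m e') q) Sq qC.
      exact: coord_selK.
    pose R : 'M[A]_(d k i, n i) := rowsub (fullrankfun Wfull) 1%:M.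
    (* [R] selects rows forming an invertible minor over [L]; Cramer's rule solves the criterion
       over [A] up to its determinant. *)
    exists (\det (R *m e k i *m C^T)); split.
      rewrite -(det_map_mx f) -(det_map_mx h) -map_mx_comp.
      rewrite (_ : map_mx _ _ = rowsub (fullrankfun Wfull) W).
        by rewrite -unitfE -unitmxE -row_full_unit; exact: fullrowsub_full.
      rewrite /R -mulmxA -rowsubE; apply/matrixP => u v.
      by rewrite [LHS]mxE [RHS]mxE /W mxE [RHS]mxE.
    exists (C^T *m \adj (R *m e k i *m C^T) *m R).
    rewrite /coord_proj -/C; set D := R *m e k i *m C^T.
    have -> : C^T *m \adj D *m R *m e k i *m (C^T *m C) =
        C^T *m (\adj D *m D) *m C by rewrite /D !mulmxA.
    by rewrite mul_adj_mx mul_mx_scalar -scalemxAl.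
  have hki (ki : 'I_nu.+1 * vert Q) := hk ki.1 ki.2.
  have [a aP] := boolp.choice hki.
  exists (\prod_ki a ki); split.
    move=> k i; have [_ [S SP]] := aP (k, i).
    exists ((\prod_(ki | ki != (k, i)) a ki) *: S).
    by rewrite -!scalemxAl SP scalerA [in RHS](bigD1 (k, i)) //= mulrC.
  rewrite !rmorph_prod; apply/prodf_neq0 => ki _; exact: (aP ki).1.
case=> m [a [b [Ia ab]]]; apply/(chart_image (chain_map f ce) fey) => k i.
have [S SP] : exists S : 'I_m -> 'M[A]_(n i), forall j,
    S j *m e k i *m coord_proj A k i = a j *: coord_proj A k i.
  have hS j : exists S, S *m e k i *m coord_proj A k i = a j *: coord_proj A k i.
    exact: Ia.
  by have [S SP] := boolp.choice hS; exists S.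
exists (\sum_j b j *: map_mx f (S j)).
rewrite !mulmx_suml -[RHS]scale1r -ab scaler_suml; apply: eq_bigr => j _.
rewrite -!scalemxAl -(coord_proj_map f) -!map_mxM SP map_mxZ scalerA //.
Qed.
End Chart.

(** The chart is taken at the coordinates of a maximal set of independent columns of each projector
    at the given point, which places the point in it. *)
Lemma FlQ_locally_fin_pres (F : fieldType) (Q : quiver) (d : filtration Q)
    (M : rep F (ftop d)) : locally_fin_pres (FlQ M).
Proof.
move=> L i x; have [e [ce ex _]] := FlQ_pt_chain (svalP x).
have hphi (k : 'I_(flen d).+1) v : exists phi : 'I_(d k v) -> 'I_(ftop d v),
    injective phi /\ row_free (rowsub phi (e k v : 'M[L]_(ftop d v))^T).
  have rk := chain_rank ce (idfun : {rmorphism L -> L}) k v.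
  have {}rk : \rank (e k v : 'M[L]_(ftop d v))^T = d k v.
    by rewrite mxrank_tr -rk map_mx_id.
  move: rk; case: _ /; exists (maxrankfun (e k v : 'M[L]_(ftop d v))^T); split.
    exact: maxrankfun_inj.
  exact: maxrowsub_free.
pose phi k v := sval (boolp.cid (hphi k v)).
have phi_inj k v : injective (phi k v) by rewrite /phi; case: boolp.cid => ? [].
have phi_free k v : row_free (rowsub (phi k v) (e k v : 'M[L]_(ftop d v))^T).
  by rewrite /phi; case: boolp.cid => ? [].
exists #|{: cvar d}|, #|{: ceqn d}|, (chart_poly M phi), (chart_pt phi_inj).
split.
- exact: chart_natural.
- exact: chart_inj.
- exact: chart_open.
apply/(chart_image phi_inj ce ex) => k v.
have /row_freeP [S SP] := phi_free k v.
exists ((coord_sel phi L k v)^T *m S^T); rewrite /coord_proj.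
have : S^T *m ((e k v : 'M[L]_(ftop d v)) *m (coord_sel phi L k v)^T) = 1%:M.
  by rewrite -[RHS]trmx1 -SP rowsubE !trmx_mul trmxK mulmxA.
move=> h; rewrite -(mulmxA _ S^T) -mulmxA.
rewrite (mulmxA (S^T *m _)) -(mulmxA S^T) h mul1mx //.
Qed.

(** * The theorem *)

Lemma growth_descent (K F : fieldType) (iota : {rmorphism K -> F}) (Q : quiver)
    (d : filtration Q) t :
  growth (@Par_ideal Q d F) t -> growth (@Par_ideal Q d K) t.
Proof. by case=> C IC; exists C => m /IC; apply: Par_ideal_descent iota _ _. Qed.

(** The chain of primes lives over [K] and the representation over [F]: vanishing passes up to [F]
    by base change, and growth passes down to [K], where the chain bounds it. *)
Lemma key_polynomials_Ad (K : fieldType) (Q : quiver) (d : filtration Q)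
    (F : fieldType) (iota : {rmorphism K -> F}) (M : rep F (ftop d)) (c : nat) :
  in_Ad iota M -> prime_chain (@Ad_ideal K Q d) c ->
  (ncoord (ftop d) <= \rank (ad_mx M M) + c)%N ->
  (forall q, Par_ideal q -> repev (A := selfalg F) M q = 0) /\
  ~ growth (@Par_ideal Q d F) (\rank (ad_mx M M)).+1.
Proof.
move=> MAd chainAd Nrc; split.
  apply: (Par_ideal_map (iota := iota)) => q qI.
  by apply: MAd; apply/Ad_ideal_Par.
move/(growth_descent iota) => gPar; move: Nrc; apply/negP; rewrite -ltnNge -addSn.
apply: growth_chain chainAd _; apply: growth_sub gPar => q.
by move/Ad_ideal_Par.
Qed.

Theorem theorem5p34 (K : fieldType) (Q : quiver) (d : filtration Q)
    (F : fieldType) (iota : {rmorphism K -> F}) (M : rep F (ftop d))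
    (M_in_Ad : in_Ad iota M)
    (ext_eq_codim : exists c : nat,
       ext1_dim (qmod_of_rep M) (qmod_of_rep M) c /\
       codim_is (@Ad_ideal K Q d) c) :
  smooth (FlQ M) /\ geometrically_irreducible (FlQ M).
Proof.
have [c [/ext1_dim_rank Nrc [chainAd _]]] := ext_eq_codim.
split; first split.
- exact: FlQ_locally_fin_pres.
- have [MPar dimPar] := key_polynomials_Ad M_in_Ad chainAd Nrc.
  have [X [XM XP]] := key_polynomials MPar dimPar.
  exact: FlQ_formally_smooth XM XP.
move=> L i; pose ML : rep L (ftop d) := map_rep i M.
have MLAd : in_Ad (i \o iota : {rmorphism K -> L}) ML.
  move=> p /M_in_Ad Mp; pose phi : kalg_hom (KAlg iota)
    (KAlg (i \o iota : {rmorphism K -> L})) :=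
    @KAlgHom K (KAlg iota) (KAlg (i \o iota : {rmorphism K -> L})) i (fun c => erefl).
  rewrite -[LHS]/(repev (map_rep phi M) p) -repev_map.
  by rewrite -[RHS](rmorph0 phi) -Mp.
(* Only the rank inequality has to be carried to [L], and ranks are invariant under field extension;
   no statement about Ext over [L] is required. *)
have NLrc : (ncoord (ftop d) <= \rank (ad_mx ML ML) + c)%N.
  by rewrite -ad_mx_map mxrank_map.
have [MPar dimPar] := key_polynomials_Ad MLAd chainAd NLrc.
have [X [XM XP]] := key_polynomials MPar dimPar.
exact: FlQ_irreducible XM XP MPar.
Qed.
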